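(* Consider the alternative model with $m=\delta_1$ (particles started from every positive integer, triple collisions annihilating all three particles). (a) For all $p\in[1/4,1)$, $\hat q<q$, hence $\psi(p)>\theta(p)$. (b) $0.2354<\hat p_c^-\le\hat p_c^+<0.2406$.
   Context: Common setting. Let $p\in[0,1]$; particle $\bullet_n$ ($n\ge1$) starts at time $0$ at location $n$ and moves at constant velocity $v_n$ until annihilated, where $(v_n)_{n\ge1}$ are i.i.d. with value $0$ with probability $p$ and values $-1,+1$ with probability $\frac{1-p}2$ each. When exactly two particles meet, both are annihilated and removed. Alternative model (probability $\hat{\mathbb P}_{\mathbb N}$): when three particles (necessarily a static one, a right-moving one and a left-moving one) meet, all three are annihilated. $\hat{\mathbb P}_{\mathbb Z}$ denotes the analogous process with particles $\bullet_n$ started from every $n\in\mathbb Z$. Let $\hat q$ be the $\hat{\mathbb P}_{\mathbb N}$-probability that some particle reaches location $0$ (i.e. there is $k$ with $v_k=-1$ such that $\bullet_k$ is not annihilated when or before it reaches $0$), and $$\psi(p)=\hat{\mathbb P}_{\mathbb Z}(\bullet_0\text{ is never annihilated}\mid v_0=0)=(1-\hat q)^2,$$ $$\hat p_c^-=\inf\{p\in[0,1]:\psi(p)>0\},\qquad\hat p_c^+=\sup\{p\in[0,1]:\psi(p)=0\}.$$ Main model (probability $\mathbb P$): when three particles (a static particle $\bullet_i$, a right-moving one and a left-moving one) meet, the static particle and one of the moving ones are annihilated while the other moving one continues unperturbed: the right-moving one survives if $s_i=+1$, the left-moving one if $s_i=-1$, where $(s_n)_n$ are i.i.d. uniform on $\{-1,+1\}$,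 independent of the velocities. Let $q$ be the probability in this model that some particle reaches location $0$, and $\theta(p)=(1-q)^2$, the probability that a static particle is never annihilated in the corresponding full-line process. (The value of $q$ in the main model is the same for every law $m$ of i.i.d. interdistances.) *)

(* Defs.v *)
From HB Require Import structures.
From mathcomp Require Import all_boot all_order all_algebra finmap.
From mathcomp Require Import all_classical all_reals all_analysis.
From mathcomp Require Import ring lra zify.

Set Implicit Arguments.
Unset Strict Implicit.
Unset Printing Implicit Defensive.

Import Order.TTheory GRing.Theory Num.Theory.

Local Open Scope classical_set_scope.
Local Open Scope ring_scope.

HB.instance Definition _ := isPointed.Build int 0.
HB.instance Definition _ := @isMeasurable.Build default_measure_display
  int (@discrete_measurable int) (@discrete_measurable0 int)
  (@discrete_measurableC int) (@discrete_measurableU int).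

(** * Deterministic dynamics

  [D : set int] is the set of starting points (particle [n] starts at [n]),
  [V n] is the velocity of particle [n], in {-1, 0, 1}.  Two particles can only
  meet at times that are multiples of 1/2 ([meeting_time_half] below), so the
  process is determined by its states at the times k/2, k = 0, 1, 2, ...  The
  state at time k/2 is the set of particles not annihilated at or before it. *)

Lemma meeting_time_half (R : realType) (i j a b : int) (t : R) :
  i != j -> a \in [:: -1; 0; 1] -> b \in [:: -1; 0; 1] -> 0 <= t ->
  i%:~R + a%:~R * t = j%:~R + b%:~R * t -> exists k : nat, t = k%:R / 2.
Proof.
move=> ij ha hb t0 e.
suff [z ez] : exists z : int, t = z%:~R / 2.
  case: z ez => z ez; first by exists z.
  have z0 : (0 : R) < z.+1%:R by rewrite ltr0n.
  by exfalso; move: ez; rewrite NegzE mulrNz -pmulrn => ez; lra.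
have ij0 : (i%:~R : R) - j%:~R != 0 by rewrite subr_eq0 eqr_int.
move: ha hb e; rewrite !inE => /or3P[] /eqP-> /or3P[] /eqP-> e.
- by case/eqP: ij0; lra.
- by exists (2 * (i - j)); rewrite intrM intrB; lra.
- by exists (i - j); rewrite intrB; lra.
- by exists (2 * (j - i)); rewrite intrM intrB; lra.
- by case/eqP: ij0; lra.
- by exists (2 * (i - j)); rewrite intrM intrB; lra.
- by exists (j - i); rewrite intrB; lra.
- by exists (2 * (j - i)); rewrite intrM intrB; lra.
- by case/eqP: ij0; lra.
Qed.

(* Twice the location at time k/2 of a particle that is still present. *)
Definition position2 (V : int -> int) (k : nat) (n : int) : int :=
  2 * n + V n * k%:Z.

(* The particles, other than [n], among those of [A] that [n] finds at its
   location at time k/2. *)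
Definition met (V : int -> int) (A : set int) (k : nat) (n : int) : set int :=
  [set m | [/\ A m, m != n & position2 V k m = position2 V k n]].

Fixpoint alive_hat (D : set int) (V : int -> int) (k : nat) : set int :=
  if k is k'.+1 then
    let A := alive_hat D V k' in A `&` [set n | met V A k n = set0]
  else D.

(* A moving particle [n] goes unperturbed through a triple collision when it
   meets a static particle [i] and a particle [j] of velocity opposite to its
   own, and the sign of [i] favours it. *)
Definition spared (V S : int -> int) (A : set int) (k : nat) (n : int) : Prop :=
  exists i j : int,
    [/\ met V A k n i, V i = 0, met V A k n j, V j = - V n &
        (V n = 1 /\ S i = 1) \/ (V n = -1 /\ S i = -1)].

Fixpoint alive (D : set int) (V S : int -> int) (k : nat) : set int :=
  if k is k'.+1 then
    let A := alive D V S k' in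
    A `&` [set n | met V A k n = set0 \/ spared V S A k n]
  else D.

Definition half_line : set int := [set n | 1 <= n].

(* [A k] is the set of particles present at time k/2. *)
Definition reaches0 (V : int -> int) (A : nat -> set int) : Prop :=
  exists (n : int) (k : nat), [/\ V n = -1, position2 V k n = 0 & A k n].

(** * Probability *)

Definition mutually_independent d d' (T : measurableType d)
    (T' : measurableType d') (R : realType) (P : probability T R)
    (I : choiceType) (X : I -> {mfun T >-> T'}) : Prop :=
  forall (J : {fset I}) (A : I -> set T'), (forall i, measurable (A i)) ->
    P (\bigcap_(i in [set` J]) (X i @^-1` A i))
    = (\prod_(i <- J) P (X i @^-1` A i))%E.

(* [v] and [s] are indexed by all integers, so that one space carries both the
   full-line process and the half-line one, which uses the indices n >= 1. *)
Definition ballistic_law d (T : measurableType d) (R : realType) (p : R)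
    (P : probability T R) (v s : int -> {mfun T >-> int}) : Prop :=
  [/\ forall n, [/\ P (v n @^-1` [set 0]) = p%:E,
                    P (v n @^-1` [set -1]) = ((1 - p) / 2)%:E &
                    P (v n @^-1` [set 1]) = ((1 - p) / 2)%:E],
      forall n, P (s n @^-1` [set -1]) = (1 / 2)%:E /\
                P (s n @^-1` [set 1]) = (1 / 2)%:E &
      mutually_independent P
        (fun i : int + int => match i with inl n => v n | inr n => s n end)].

Definition cond_prob d (T : measurableType d) (R : realType)
    (P : probability T R) (A B : set T) : R := fine (P (A `&` B)) / fine (P B).

Section quantities.
Context d (T : measurableType d) (R : realType).
Implicit Types (P : probability T R) (v s : int -> {mfun T >-> int}).

Definition q_hat P v : R :=
  fine (P [set w | reaches0 (v ^~ w) (alive_hat half_line (v ^~ w))]).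

Definition q P v s : R :=
  fine (P [set w | reaches0 (v ^~ w) (alive half_line (v ^~ w) (s ^~ w))]).

(* When P (v 0 = 0) = 0, this is 0 by the convention x / 0 = 0, which agrees
   with the value (1 - q_hat) ^+ 2 of psi at p = 0, where q_hat = 1. *)
Definition psi P v : R :=
  cond_prob P [set w | forall k, alive_hat setT (v ^~ w) k 0]
              [set w | v 0 w = 0].

Definition theta P v s : R := (1 - q P v s) ^+ 2.

(* In these two, [P p] is the law of parameter p. *)
Definition pc_hat_minus (P : R -> probability T R) v : R :=
  inf [set p | 0 <= p <= 1 /\ 0 < psi (P p) v].

Definition pc_hat_plus (P : R -> probability T R) v : R :=
  sup [set p | 0 <= p <= 1 /\ psi (P p) v = 0].

End quantities.

(* Main.v *)
From Stdlib Require Import BinNums BinPos BinNat Pnat Nnat.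
Require Import Defs.
From mathcomp Require Import finmap all_boot all_order all_algebra.
From mathcomp Require Import all_classical all_reals all_analysis.
From mathcomp Require Import ring lra zify.

Set Implicit Arguments.
Unset Strict Implicit.
Unset Printing Implicit Defensive.

Import Order.TTheory GRing.Theory Num.Theory numFieldNormedType.Exports.

Local Open Scope ring_scope.

(** Both models are instances of one, in which a sign is nonzero with probability
  rho: rho = 1 is the main model, and rho = 0 the alternative one, since a
  static particle of sign 0 spares nobody.  Let a_n be the probability that
  the n-th particle is the first to reach 0, so that the probability q of
  reaching 0 is the sum of the a_n, let t be the sum of the a_n^2, and let C be
  the probability that particle 1 is right-moving and annihilated by a
  left-moving particle away from any static one.

  Splitting the event "0 is first reached by the n-th particle" according to
  the fate of particle 1 gives a recursion for a_n.  If particle 1 is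
  right-moving and 1 is first reached by the n-th particle once particle 1 is
  removed, then either particle 1 is annihilated by the n-th one, or it is
  annihilated by a static particle which, without it, would have been destroyed
  from the right; this gives a second recursion.  Both involve the event that a
  right-moving particle 1 reaches a static one, which is a reversed copy of
  "0 is first reached by the n-th particle".  Summing over n and eliminating C,
    (1 - q)^2 (p ((1 + q)^2 + (1 - rho) t) - 1) = 0.
  For rho = 1 this is q = 1 or p (1 + q)^2 = 1, which is compared with
  p ((1 + q)^2 + t) = 1, the case rho = 0 with q < 1.

  It remains to decide, for rho = 0, when q < 1.  If so,
  2 C + p t = 1 - 2 p + p (1 - q)^2, whereas 2 C + p t = 1 - 2 p if q = 1.  As
  2 C + p t is a supremum of polynomials in p, q < 1 is an open condition.  So
  is q = 1 where p (4 + t) > 1: q and t are such suprema too, so that nearby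
  p ((1 + q)^2 + t) > 1.  By connectedness, q < 1 on [p0, 1] as soon as
  p (4 + t) > 1 there, which partial sums of t certify for p0 = 0.240599.  For
  p <= 0.236, p ((1 + q)^2 + t) = 1 is impossible because
  t <= a_1^2 + q max_(n >= 2) a_n is too small. *)

(** * Dynamics of subsystems *)

(** Everything rests on screening: a left-moving particle that is still present cannot be caught
    from its right, so whether the n-th particle is the first to reach 0 depends on the first n
    letters alone. Hence a_n is a polynomial in p, events on disjoint blocks of letters are
    independent, and the recursions are identities between finite sums. The mass t comes from ties:
    a static particle at equal distance d from its first visitors on both sides, of weight p a_d^2,
    where all three die if no sign favours anyone. The obstacle is the factor (1 - q)^2: q = 1
    solves the equation for every p, so algebra cannot tell which root is taken, and q is not shown
    to be monotone in p. This forces the topological argument, for which C is brought back after its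
    elimination: at q = 1 the combination 2 C + p t no longer involves t. The bounds 0.236 and
    0.240599 lie strictly inside the announced ones, so that strict inequalities survive the passage
    to inf and sup. *)

Definition survives (V S : int -> int) (A : set int) (k : nat) (n : int) :=
  met V A k n = set0 \/ spared V S A k n.

Lemma aliveS (V S : int -> int) (D : set int) (k : nat) (n : int) :
  alive D V S k.+1 n <-> alive D V S k n /\ survives V S (alive D V S k) k.+1 n.
Proof. by []. Qed.

Lemma met0P (V : int -> int) (A : set int) (k : nat) (n : int) :
  met V A k n = set0 <->
  forall m, A m -> position2 V k m = position2 V k n -> m = n.
Proof.
split=> [E m Am e|H].
  apply/eqP/negPn/negP => mn.
  have : met V A k n m by split.
  by rewrite E.
apply/seteqP; split=> [m [Am /eqP mn e]|//].
exact/mn/H.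
Qed.

(** Survival at a given time is decided location by location, so two systems can be compared one
    collision at a time. *)
Lemma survives_ext (V S : int -> int) (A A' : set int) (k : nat) (n : int) :
  (forall m, position2 V k m = position2 V k n -> A m <-> A' m) ->
  survives V S A k n <-> survives V S A' k n.
Proof.
move=> H.
have -> : survives V S A' k n = survives V S A k n; last by [].
have E : met V A' k n = met V A k n.
  apply/seteqP; split=> m [Am mn e]; split=> //.
  - exact/(H _ e).
  - exact/(H _ e).
by rewrite /survives /spared E.
Qed.

Lemma aliveW (V S : int -> int) (D : set int) (j k : nat) (n : int) :
  (j <= k)%N -> alive D V S k n -> alive D V S j n.
Proof.
elim: k => [|k IH]; first by rewrite leqn0 => /eqP ->.
by rewrite leq_eqVlt => /orP[/eqP-> //|jk] /aliveS[Ak _]; apply: IH Ak.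
Qed.

Lemma alive0 (V S : int -> int) (D : set int) (k : nat) (n : int) :
  alive D V S k n -> D n.
Proof. exact: (@aliveW V S D 0). Qed.

Lemma alive_hatE (D : set int) (V : int -> int) (k : nat) :
  alive_hat D V k = alive D V (fun=> 0) k.
Proof.
elim: k => //= k ->; congr (_ `&` _)%classic; apply/seteqP; split=> n /=.
  by left.
by case=> // -[i [j [_ _ _ _ /= s]]]; lia.
Qed.

(** Translations ([e = 1]) and reflections ([e = -1]) are treated together. A reflection also flips
    the signs, because a sign names the direction of the particle that it spares. *)
Lemma alive_iso (D D' : set int) (V V' S S' : int -> int) (e c : int) (k : nat) :
  e = 1 \/ e = -1 ->
  (forall n, D n -> V' (e * n + c) = e * V n /\ S' (e * n + c) = e * S n) ->
  (forall n, D' (e * n + c) <-> D n) ->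
  forall n, alive D' V' S' k (e * n + c) <-> alive D V S k n.
Proof.
move=> He HVS HD; elim: k => [|k IH] n; first exact: HD.
have ee : e * e = 1 by case: He => ->.
have surj m : m = e * (e * (m - c)) + c by rewrite mulrA ee mul1r subrK.
have inj m m' : e * m + c = e * m' + c -> m = m'.
  by case: He => ->; lia.
have pos m : D m -> position2 V' k.+1 (e * m + c) = e * position2 V k.+1 m + 2 * c.
  by move=> /HVS[Ev _]; rewrite /position2 Ev; ring.
rewrite !aliveS IH; split=> -[An sv]; split=> //.
- have Dn := alive0 An.
  case: sv => [/met0P m0|[i [j [[Ai iN ei] Vi [Aj jN ej] Vj s]]]].
    left; apply/met0P => m Am em; apply: inj; apply: m0; first exact/IH.
    by rewrite !pos ?em//; exact: alive0 Am.
  right; rewrite (surj i) (surj j) in Ai iN ei Vi Aj jN ej Vj s.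
  set i' := e * (i - c) in Ai iN ei Vi Aj jN ej Vj s.
  set j' := e * (j - c) in Ai iN ei Vi Aj jN ej Vj s.
  move/IH in Ai; move/IH in Aj.
  have Di := alive0 Ai; have Dj := alive0 Aj.
  have [Ei Esi] := HVS _ Di; have [Ej Esj] := HVS _ Dj; have [En Esn] := HVS _ Dn.
  rewrite !pos // in ei ej; rewrite Ei in Vi; rewrite Ej En in Vj.
  rewrite En Esi in s.
  exists i', j'; split.
  + by split=> //; [apply: contraNneq iN => -> | case: He => He; lia].
  + by case: He => He; lia.
  + by split=> //; [apply: contraNneq jN => -> | case: He => He; lia].
  + by case: He => He; lia.
  + by case: He => He; lia.
- have Dn := alive0 An.
  case: sv => [/met0P m0|[i [j [[Ai iN ei] Vi [Aj jN ej] Vj s]]]].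
    left; apply/met0P => m; rewrite (surj m); move: (e * (m - c)) => m' /IH Am.
    have Dm := alive0 Am.
    by rewrite !pos // => em; rewrite (m0 m') //; case: He => He; lia.
  right; have Di := alive0 Ai; have Dj := alive0 Aj.
  have [Ei Esi] := HVS _ Di; have [Ej Esj] := HVS _ Dj; have [En Esn] := HVS _ Dn.
  exists (e * i + c), (e * j + c); split.
  + split; [exact/IH | by apply: contraNneq iN => /inj -> | by rewrite !pos // ei].
  + by rewrite Ei Vi mulr0.
  + split; [exact/IH | by apply: contraNneq jN => /inj -> | by rewrite !pos // ej].
  + by rewrite Ej En Vj mulrN.
  + by rewrite En Esi; case: He => He; lia.
Qed.

Lemma alive_ext (D : set int) (V V' S S' : int -> int) (k : nat) (n : int) :
  (forall n, D n -> V n = V' n /\ S n = S' n) ->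
  alive D V S k n <-> alive D V' S' k n.
Proof.
move=> H; have := @alive_iso D D V' V S' S 1 0 k (or_introl erefl) _ _ n.
by rewrite mul1r addr0; apply => // m; rewrite !mul1r addr0; last by []; move/H => [].
Qed.

Section dynamics.
Variables (V S : int -> int).
Hypothesis HV : forall n, V n = -1 \/ V n = 0 \/ V n = 1.

Local Notation pos := (position2 V).
Local Notation al D k := (alive D V S k).

Lemma posP (k : nat) (n : int) :
  (V n = -1 /\ pos k n = 2 * n - k%:Z) \/ (V n = 0 /\ pos k n = 2 * n) \/
  (V n = 1 /\ pos k n = 2 * n + k%:Z).
Proof. by rewrite /position2; case: (HV n) => [|[]] ->; lia. Qed.

Lemma static_not_spared (A : set int) (k : nat) (n : int) :
  V n = 0 -> ~ spared V S A k n.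
Proof. by move=> V0 [i [j [_ _ _ _]]]; rewrite V0; lia. Qed.

(** If both were spared, the static particle at their common location would be the same for both;
    its sign would give them the same velocity, hence the same starting point. *)
Lemma no_cohabitation (D : set int) (k : nat) (a b : int) :
  al D k.+1 a -> al D k.+1 b -> pos k.+1 a = pos k.+1 b -> a = b.
Proof.
move=> /aliveS[Aa sa] /aliveS[Ab sb] e; case: sa => [/met0P m0|sa].
  by rewrite (m0 b).
case: sb => [/met0P m0|sb]; first by rewrite (m0 a).
move: sa sb => [i [j [[_ _ ei] Vi _ _ sa]]] [i' [j' [[_ _ ei'] Vi' _ _ sb]]].
have ii : i = i' by have := posP k.+1 i; have := posP k.+1 i'; lia.
subst i'.
by have := posP k.+1 a; have := posP k.+1 b; lia.
Qed.

(** In one step a doubled distance shrinks by at most 2. Opposite movers have doubled positions of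
    equal parity, so they can swap only through a common position, where they cannot both
    survive. *)
Lemma alive_order (D : set int) (k : nat) (a b : int) :
  al D k a -> al D k b -> a < b -> pos k a < pos k b.
Proof.
elim: k => [|k IH] Aa Ab ab; first by have := posP 0 a; have := posP 0 b; lia.
have := IH (aliveW (leqnSn k) Aa) (aliveW (leqnSn k) Ab) ab.
have : pos k.+1 a <> pos k.+1 b by move=> /(no_cohabitation Aa Ab); lia.
have := posP k a; have := posP k b; have := posP k.+1 a; have := posP k.+1 b; lia.
Qed.

Lemma alive_orderS (D : set int) (k : nat) (a b : int) :
  al D k a -> al D k b -> a <= b -> pos k.+1 a <= pos k.+1 b.
Proof.
move=> Aa Ab ab; have [->//|ne] := eqVneq a b.
have {}ab : a < b by lia.
have := alive_order Aa Ab ab.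
have := posP k a; have := posP k b; have := posP k.+1 a; have := posP k.+1 b; lia.
Qed.

Lemma alive_glue (B D : set int) (k : nat) :
  (forall (j : nat) m n, (j < k)%N -> al B j m -> al D j n -> pos j.+1 m <> pos j.+1 n) ->
  forall (j : nat) n, (j <= k)%N -> al (B `|` D)%classic j n <-> al B j n \/ al D j n.
Proof.
move=> H; elim=> [|j IH] n jk; first by [].
have {}IH m := IH m (ltnW jk).
rewrite !aliveS; split=> [[/IH[] An sv]|[] [An sv]].
- left; split=> //; move: sv; apply: (iffLR (survives_ext S _)) => m e.
  split=> [/IH[]// Am|Am]; last by apply/IH; left.
  by case: (H _ _ _ jk An Am).
- right; split=> //; move: sv; apply: (iffLR (survives_ext S _)) => m e.
  split=> [/IH[]// Am|Am]; last by apply/IH; right.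
  by case: (H _ _ _ jk Am An).
- split; first by apply/IH; left.
  move: sv; apply: (iffLR (survives_ext S _)) => m e.
  split=> [Am|/IH[]// Am]; first by apply/IH; left.
  by case: (H _ _ _ jk An Am).
- split; first by apply/IH; right.
  move: sv; apply: (iffLR (survives_ext S _)) => m e.
  split=> [Am|/IH[]// Am]; first by apply/IH; right.
  by case: (H _ _ _ jk Am An).
Qed.

Lemma alive_restart (B D : set int) (k0 : nat) :
  (forall n, al B k0 n <-> al D k0 n) ->
  forall (k : nat) n, (k0 <= k)%N -> al B k n <-> al D k n.
Proof.
move=> H; elim=> [|k IH] n; first by rewrite leqn0 => /eqP <-.
rewrite leq_eqVlt => /orP[/eqP <-|]; first exact: H.
rewrite ltnS => /IH{}IH; rewrite !aliveS IH.
by split=> -[An sv]; split=> //; move: sv; apply: (iffLR (survives_ext S _)) => m _; rewrite IH.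
Qed.

Lemma alive_singleton (D : set int) (k : nat) (n : int) :
  (forall m, al D k m <-> m = n) ->
  forall (k' : nat) m, (k <= k')%N -> al D k' m <-> m = n.
Proof.
move=> H; elim=> [|k' IH] m; first by rewrite leqn0 => /eqP <-.
rewrite leq_eqVlt => /orP[/eqP <-|]; first exact: H.
rewrite ltnS => kk; rewrite aliveS IH //; split=> [[]//|->]; split=> //.
by left; apply/met0P => m'; rewrite IH.
Qed.

(** Screening: while [l] is present, [B] stays weakly on its left, and no particle started beyond
    [l] catches up with a left-moving one. The time [k.+1] is included because the collisions of
    that step are located by the state at time [k]. *)
Lemma alive_wallS (B D : set int) (l : int) (k : nat) :
  (forall n, B n -> n <= l) -> (forall n, D n -> l < n) -> V l = -1 ->
  al B k l -> forall (j : nat) n, (j <= k.+1)%N ->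
  al (B `|` D)%classic j n <-> al B j n \/ al D j n.
Proof.
move=> HB HD Vl Al; apply: alive_glue => j m n jk Bm Dn.
have Bl : al B j l by apply: aliveW Al.
have := alive_orderS Bm Bl (HB _ (alive0 Bm)).
have := HD _ (alive0 Dn).
have := posP j.+1 l; have := posP j.+1 n; lia.
Qed.

Lemma alive_wall (B D : set int) (l : int) (k : nat) :
  (forall n, B n -> n <= l) -> (forall n, D n -> l < n) -> V l = -1 ->
  al (B `|` D)%classic k l -> al B k l.
Proof.
move=> HB HD Vl; have nD j : ~ al D j l by move=> /alive0/HD; lia.
elim: k => [|k IH]; first by move=> [//|/HD]; lia.
move=> Al; have Bl := IH (aliveW (leqnSn k) Al).
by case/(alive_wallS HB HD Vl Bl l (leqnn _)): Al => // /nD.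
Qed.

(** A particle present at time [j] is tested at its location one step later, before removals, so
    that reaching [a] and dying there counts as reaching it. *)
Definition stays_right (R : set int) (a : int) (k : nat) :=
  forall (j : nat) m, (j < k)%N -> al R j m -> 2 * a < pos j.+1 m.

Definition stays_left (L : set int) (a : int) (k : nat) :=
  forall (j : nat) m, (j < k)%N -> al L j m -> pos j.+1 m < 2 * a.

Lemma stays_rightW (R : set int) (a : int) (j k : nat) :
  (j <= k)%N -> stays_right R a k -> stays_right R a j.
Proof. by move=> jk H i m ij; apply: H; apply: leq_trans ij jk. Qed.

Lemma alive_static (L R X : set int) (i : int) (k : nat) :
  (forall n, L n -> n < i) -> (forall n, R n -> i < n) -> V i = 0 ->
  (forall n, X n <-> L n \/ n = i \/ R n) ->
  stays_left L i k -> stays_right R i k ->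
  forall (j : nat) n, (j <= k)%N -> al X j n <-> al L j n \/ n = i \/ al R j n.
Proof.
move=> HL HR Vi HX SL SR.
have si : forall (j : nat) m, al [set i]%classic j m <-> m = i.
  by move=> j m; apply: (@alive_singleton [set i]%classic 0).
have -> : X = (L `|` ([set i] `|` R))%classic.
  by apply/seteqP; split=> n /HX.
have H1 : forall (j : nat) n, (j <= k)%N ->
    al ([set i] `|` R)%classic j n <-> al [set i]%classic j n \/ al R j n.
  apply: alive_glue => j m n jk /si -> /(SR _ _ jk).
  by have := posP j.+1 i; lia.
move=> j n jk; rewrite -(si j n) -H1 //; move: j n jk; apply: alive_glue.
move=> j m n jk Am /(H1 _ _ (ltnW jk)); rewrite si => -[->|].
  by have := SL _ _ jk Am; have := posP j.+1 i; lia.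
by move=> /(SR _ _ jk); have := SL _ _ jk Am; lia.
Qed.

(** Nothing jumps over the location [i]: a doubled position changes by at most 1 per step, so a
    particle that avoids [2 * i] stays on its side. *)
Lemma static_alive (L R X : set int) (i : int) (k : nat) :
  (forall n, L n -> n < i) -> (forall n, R n -> i < n) -> V i = 0 ->
  (forall n, X n <-> L n \/ n = i \/ R n) ->
  al X k i -> stays_left L i k /\ stays_right R i k.
Proof.
move=> HL HR Vi HX; elim: k => [_|k IH]; first by split.
move=> /aliveS[/[dup] Xi /IH[SL SR]] [/met0P m0|/(static_not_spared Vi) //].
have E := alive_static HL HR Vi HX SL SR.
have m0' m : al X k m -> m <> i -> pos k.+1 m <> 2 * i.
  move=> Am mi e; apply/mi/m0 => //.
  by rewrite e; have := posP k.+1 i; lia.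
split=> j m; rewrite ltnS leq_eqVlt => /orP[/eqP ->|jk] Am.
- have Xm : al X k m by apply/(E _ _ (leqnn k)); left.
  have mi := HL _ (alive0 Am).
  have : pos k.+1 m <> 2 * i by apply: m0' => //; lia.
  case: k SL Am {IH Xi SR m0 E m0' Xm} => [_ _|k SL Am].
    by have := posP 1 m; lia.
  have := SL _ _ (leqnn _) (aliveW (leqnSn _) Am).
  by have := posP k.+2 m; have := posP k.+1 m; lia.
- exact: SL jk Am.
- have Xm : al X k m by apply/(E _ _ (leqnn k)); right; right.
  have mi := HR _ (alive0 Am).
  have : pos k.+1 m <> 2 * i by apply: m0' => //; lia.
  case: k SR Am {IH Xi SL m0 E m0' Xm} => [_ _|k SR Am].
    by have := posP 1 m; lia.
  have := SR _ _ (leqnn _) (aliveW (leqnSn _) Am).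
  by have := posP k.+2 m; have := posP k.+1 m; lia.
- exact: SR jk Am.
Qed.

End dynamics.

(** * First particle to reach a location *)

Definition block (a : int) (n : nat) : set int := [set m | a < m <= a + n%:Z]%classic.

(* [a + n] is the first particle to reach [a] among those started from the
   right of [a]; only the particles of [block a n] matter *)
Definition hits (V S : int -> int) (a : int) (n : nat) :=
  [/\ (0 < n)%N, V (a + n%:Z) = -1, alive (block a n) V S n.*2.-1 (a + n%:Z) &
      stays_right V S (block a n) a n.*2.-1].

Definition initial (a : int) (R : set int) :=
  (forall m, R m -> a < m) /\ (forall m n, R m -> a < n -> n <= m -> R n).

Lemma initial_block (a : int) (n : nat) : initial a (block a n).
Proof. by split=> [m|m m'] /=; rewrite /block /=; lia. Qed.

Lemma initial_split (a : int) (R : set int) (n : nat) :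
  initial a R -> R (a + n%:Z) ->
  R = (block a n `|` [set m | R m /\ (a + n%:Z < m)%R])%classic.
Proof.
move=> [R1 R2] Rn; apply/seteqP; split=> m /=.
  move=> Rm; have := R1 _ Rm; have [mn am|mn am] := leP m (a + n%:Z).
    by left; rewrite /block /= am.
  by right.
by move=> [/andP[am mn]|[]//]; apply: R2 Rn _ _.
Qed.

Section hitting.
Variables (V S : int -> int).
Hypothesis HV : forall n, V n = -1 \/ V n = 0 \/ V n = 1.

Local Notation pos := (position2 V).
Local Notation al D k := (alive D V S k).
Local Notation posP := (posP HV).

Lemma stays_right_pos (R : set int) (a : int) (k j : nat) (m : int) :
  (forall m, R m -> a < m) -> stays_right V S R a k -> (j <= k)%N ->
  al R j m -> 2 * a < pos j m.
Proof.
move=> Ra SR; case: j => [_ /alive0 /Ra|j jk Am].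
  by have := posP 0 m; lia.
exact: SR jk (aliveW (leqnSn _) Am).
Qed.

(** At time [n.*2.-1] the hitting particle has doubled position [2 * a + 1]; by order, any other
    survivor would lie strictly between [2 * a] and it. *)
Lemma hits_alive (a : int) (n : nat) : hits V S a n ->
  forall (k : nat) m, (n.*2.-1 <= k)%N -> al (block a n) k m <-> m = a + n%:Z.
Proof.
move=> [n0 Vn An SR]; apply: (alive_singleton (k := n.*2.-1)) => m.
split=> [Am|->//]; apply/eqP/negPn/negP => /eqP mn.
have [R1 _] := initial_block a n.
have := stays_right_pos R1 SR (leqnn _) Am.
have /andP[_ mle] : block a n m := alive0 Am.
have /(alive_order HV Am An) : m < a + n%:Z by lia.
by have := posP n.*2.-1 (a + n%:Z); lia.
Qed.

Lemma hits_survivor (a : int) (n : nat) (k : nat) :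
  hits V S a n -> al (block a n) k (a + n%:Z).
Proof.
move=> /hits_alive H.
by apply: (@aliveW _ _ _ _ (maxn k n.*2.-1)); [lia | apply/H => //; lia].
Qed.

Lemma hits_wall (a : int) (n : nat) (R : set int) :
  initial a R -> R (a + n%:Z) -> hits V S a n ->
  forall (k : nat) m,
    al R k m <-> al (block a n) k m \/ al [set m | R m /\ a + n%:Z < m]%classic k m.
Proof.
move=> iR Rn hn k m; rewrite {1}(initial_split iR Rn).
have [_ Vn _ _] := hn.
apply: (alive_wallS HV (l := a + n%:Z) (k := k)) => //.
- by move=> ? /andP[].
- by move=> ? [].
- exact: hits_survivor.
Qed.

Lemma hits_in (a : int) (n : nat) (R : set int) (k : nat) :
  initial a R -> R (a + n%:Z) -> hits V S a n -> al R k (a + n%:Z).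
Proof. by move=> iR Rn hn; apply/(hits_wall iR Rn hn); left; apply: hits_survivor. Qed.

Lemma hits_not_stays (a : int) (n k : nat) (R : set int) :
  initial a R -> R (a + n%:Z) -> hits V S a n -> (n.*2 <= k)%N ->
  ~ stays_right V S R a k.
Proof.
move=> iR Rn hn nk SR; have [n0 Vn _ _] := hn.
have := SR n.*2.-1 _ _ (hits_in _ iR Rn hn).
by have := posP n.*2.-1.+1 (a + n%:Z); lia.
Qed.

(** The nearer particle also survives inside the longer block, and would reach [a] too early. *)
Lemma hits_inj (a : int) (n n' : nat) : hits V S a n -> hits V S a n' -> n = n'.
Proof.
wlog nn : n n' / (n < n')%N.
  by move=> H hn hn'; case: (ltngtP n n') => // nn; [|apply/esym]; exact: H nn _ _.
move=> hn [n0' _ _ SR].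
case: (@hits_not_stays a n n'.*2.-1 (block a n')) => //; last by lia.
  exact: initial_block.
by case: hn => *; rewrite /block /=; lia.
Qed.

Lemma wall_block (a : int) (n k : nat) (R : set int) :
  initial a R -> V (a + n%:Z) = -1 -> al R k (a + n%:Z) ->
  al (block a n) k (a + n%:Z) /\
  forall (j : nat) m, (j <= k.+1)%N ->
    al R j m <-> al (block a n) j m \/ al [set m | R m /\ a + n%:Z < m]%classic j m.
Proof.
move=> iR Vn An; have E := initial_split iR (alive0 An).
have H1 : forall m, block a n m -> m <= a + n%:Z by move=> ? /andP[].
have H2 : forall m, [set m | R m /\ a + n%:Z < m]%classic m -> a + n%:Z < m by move=> ? [].
have Bn : al (block a n) k (a + n%:Z).
  by apply: (alive_wall HV H1 H2) => //; rewrite -E.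
split=> // j m jk.
by rewrite {1}E; apply: (alive_wallS HV H1 H2 _ Bn).
Qed.

(** The first particle to violate [stays_right] passes from above [2 * a] to at most [2 * a] in one
    step. It is therefore left-moving at doubled position [2 * a + 1], which forces [k = n.*2.-1];
    screening then discards what lies on its right. *)
Lemma first_hit (a : int) (k : nat) (R : set int) :
  initial a R -> ~ stays_right V S R a k ->
  exists n, [/\ (n.*2 <= k)%N, R (a + n%:Z) & hits V S a n].
Proof.
move=> iR; have [R1 R2] := iR; elim: k => [H|k IH H]; first by case: H.
have [SR|/IH[n [nk Rn hn]]] := pselect (stays_right V S R a k); last first.
  by exists n; split=> //; lia.
have [m Am pm] : exists2 m, al R k m & pos k.+1 m <= 2 * a.
  apply: contrapT => H'; apply: H => j m; rewrite ltnS leq_eqVlt => /orP[/eqP ->|jk] Am.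
    by rewrite ltNge; apply/negP => pm; apply: H'; exists m.
  exact: SR jk Am.
have := stays_right_pos R1 SR (leqnn _) Am.
have am := R1 _ (alive0 Am).
have [n en] : exists n : nat, m = a + n%:Z by exists (absz (m - a)); lia.
subst m => pk.
have [Vn kn] : V (a + n%:Z) = -1 /\ k = n.*2.-1.
  by have := posP k (a + n%:Z); have := posP k.+1 (a + n%:Z); lia.
have n0 : (0 < n)%N by lia.
have [Bn E] := wall_block iR Vn Am.
exists n; split; [lia | exact: alive0 Am |]; split=> //; first by rewrite -kn.
rewrite -kn => j m jk Bm; apply: SR => //.
by apply/E; [lia | left].
Qed.

End hitting.

(** * Arrivals from the left, by reflection *)

Definition rblock (i : int) (d : nat) : set int := [set m | i - d%:Z <= m < i]%classic.

Definition rhits (V S : int -> int) (i : int) (d : nat) :=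
  [/\ (0 < d)%N, V (i - d%:Z) = 1, alive (rblock i d) V S d.*2.-1 (i - d%:Z) &
      stays_left V S (rblock i d) i d.*2.-1].

Definition mirror (f : int -> int) (n : int) : int := - f (- n).

Lemma alive_mirror (D D' : set int) (V S : int -> int) (k : nat) (n : int) :
  (forall n, D' (- n) <-> D n) ->
  alive D' (mirror V) (mirror S) k (- n) <-> alive D V S k n.
Proof.
move=> HD; have := @alive_iso D D' V (mirror V) S (mirror S) (-1) 0 k (or_intror erefl) _ _ n.
rewrite mulN1r addr0; apply.
  by move=> m _; rewrite mulN1r addr0 /mirror opprK !mulN1r.
by move=> m; rewrite mulN1r addr0.
Qed.

Lemma position2_mirror (V : int -> int) (k : nat) (n : int) :
  position2 (mirror V) k (- n) = - position2 V k n.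
Proof. by rewrite /position2 /mirror opprK; ring. Qed.

Lemma stays_mirror (V S : int -> int) (L R : set int) (a : int) (k : nat) :
  (forall n, R (- n) <-> L n) ->
  stays_right (mirror V) (mirror S) R (- a) k <-> stays_left V S L a k.
Proof.
move=> HD; split=> H j m jk Am.
- have := H _ _ jk (iffRL (alive_mirror V S j m HD) Am).
  by rewrite position2_mirror; lia.
- rewrite -(opprK m) in Am.
  have := H _ _ jk (iffLR (alive_mirror V S j (- m) HD) Am).
  by have := position2_mirror V j.+1 (- m); rewrite opprK => ->; lia.
Qed.

Lemma rhits_mirror (V S : int -> int) (i : int) (d : nat) :
  rhits V S i d <-> hits (mirror V) (mirror S) (- i) d.
Proof.
have HD n : block (- i) d (- n) <-> rblock i d n by rewrite /block /rblock /=; lia.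
rewrite /rhits /hits -(propext (stays_mirror V S _ _ HD)).
have -> : - i + d%:Z = - (i - d%:Z) by lia.
have -> : (mirror V (- (i - d%:Z)) = -1) = (V (i - d%:Z) = 1).
  by rewrite /mirror opprK; apply/propext; lia.
by rewrite (propext (alive_mirror V S d.*2.-1 (i - d%:Z) HD)).
Qed.

(** A block that annihilates itself without reaching [b]. Its last particle is left-moving and takes
    part in the last collision, at time [K.+1]: it screens the rest of the line until the block has
    vanished, and afterwards there is nothing left to meet. *)
Definition dead_block (V S : int -> int) (b : int) (s : nat) :=
  [/\ (0 < s)%N, V (b + s%:Z) = -1 & exists K,
   [/\ alive (block b s) V S K (b + s%:Z), forall m, ~ alive (block b s) V S K.+1 m &
       stays_right V S (block b s) b K.+1]].

(* [1] is annihilated by [l], with no static particle involved *)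
Definition crossing (V S : int -> int) (l : nat) :=
  [/\ (1 < l)%N, V 1 = 1, alive (block 0 l) V S l.-2 1 &
      forall m, met V (alive (block 0 l) V S l.-2) l.-1 1 m <-> m = l%:Z].

(* [1] would reach the static particle [d.+1] if nothing came from its right *)
Definition reaches_static (V S : int -> int) (d : nat) :=
  rhits V S d.+1%:Z d /\ V d.+1%:Z = 0.

Section first_particle.
Variables (V S : int -> int).
Hypothesis HV : forall n, V n = -1 \/ V n = 0 \/ V n = 1.

Local Notation pos := (position2 V).
Local Notation al D k := (alive D V S k).
Local Notation posP := (posP HV).
Local Notation hits := (hits V S).
Local Notation rhits := (rhits V S).
Local Notation stays_right := (stays_right V S).
Local Notation stays_left := (stays_left V S).
Local Notation dead_block := (dead_block V S).
Local Notation crossing := (crossing V S).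
Local Notation reaches_static := (reaches_static V S).

Lemma mirror_velocities n : mirror V n = -1 \/ mirror V n = 0 \/ mirror V n = 1.
Proof. by rewrite /mirror; have := HV (- n); lia. Qed.

Lemma rhits_alive (i : int) (d : nat) : rhits i d ->
  forall (k : nat) m, (d.*2.-1 <= k)%N -> al (rblock i d) k m <-> m = i - d%:Z.
Proof.
move=> /rhits_mirror/(hits_alive mirror_velocities) H k m dk.
have HD n : block (- i) d (- n) <-> rblock i d n by rewrite /block /rblock /=; lia.
by rewrite -(alive_mirror V S k m HD) H //; lia.
Qed.

Lemma rhits_survivor (i : int) (d k : nat) : rhits i d -> al (rblock i d) k (i - d%:Z).
Proof.
move=> /rhits_alive H.
by apply: (@aliveW _ _ _ _ (maxn k d.*2.-1)); [lia | apply/H => //; lia].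
Qed.

Lemma dead_block_hits (b : int) (s n : nat) : dead_block b s ->
  hits b n <-> exists2 j, n = (s + j)%N & hits (b + s%:Z) j.
Proof.
move=> [s0 Vs [K [AK DK SK]]].
have SB k : stays_right (block b s) b k.
  move=> j m _ Am; have [jK|jK] := leqP j K; first exact: SK Am.
  by case: (DK m); apply: aliveW Am.
(* The last particle separates the two parts up to time [K.+1]; after that the left part is
   empty. *)
have glue (D : set int) : (forall m, D m -> b + s%:Z < m) ->
    forall (k : nat) m, al (block b s `|` D)%classic k m <-> al (block b s) k m \/ al D k m.
  move=> HD k m; have H1 : forall m, block b s m -> m <= b + s%:Z by move=> ? /andP[].
  have E := alive_wallS HV H1 HD Vs AK.
  apply: (alive_glue (k := k)) => // {k m} j m m' _ Bm Dm.
  have [jK|jK] := leqP j K; last by case: (DK m); apply: aliveW Bm.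
  have Bl : al (block b s) j (b + s%:Z) by apply: aliveW AK.
  have := alive_orderS HV Bm Bl (H1 _ (alive0 Bm)).
  have := HD _ (alive0 Dm).
  by have := posP j.+1 (b + s%:Z); have := posP j.+1 m'; lia.
have glueb (j k : nat) m :
    al (block b (s + j)) k m <-> al (block b s) k m \/ al (block (b + s%:Z) j) k m.
  rewrite -glue; last by move=> ? /andP[].
  have -> // : block b (s + j) = (block b s `|` block (b + s%:Z) j)%classic.
  by apply/seteqP; split=> x; rewrite /block /=; lia.
have comp j : hits (b + s%:Z) j -> hits b (s + j).
  move=> hj; have [j0 Vj Aj SR] := hj.
  have ej : b + (s + j)%N%:Z = b + s%:Z + j%:Z by lia.
  split; [lia | by rewrite ej | |].
    by rewrite ej; apply/glueb; right; apply: hits_survivor.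
  move=> i m im /glueb[/SB|Am]; first exact.
  have [ij|ij] := ltnP i j.*2.-1; first by have := SR _ _ ij Am; lia.
  have -> := iffLR (hits_alive HV hj m ij) Am.
  by have := posP i.+1 (b + s%:Z + j%:Z); lia.
split=> [hn|[j -> ]]; last exact: comp.
have [n0 Vn An SR] := hn; have [ns|sn] := leqP n s.
  case: (@hits_not_stays V S HV b n n.*2 (block b s)) => //; first exact: initial_block.
  by rewrite /block /=; lia.
have [j ej] : exists j, n = (s + j)%N by exists (n - s)%N; lia.
exists j => //; subst n.
have en : b + (s + j)%N%:Z = b + s%:Z + j%:Z by lia.
rewrite en in Vn An.
have [/alive0|Dn] := iffLR (glueb _ _ _) An; first by rewrite /block /=; lia.
split=> //; first by lia.
  by apply: aliveW Dn; lia.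
apply: contrapT => /(first_hit HV (initial_block _ _)) [j' [j'j _ /[dup] h' /comp h]].
have e := hits_inj HV hn h.
by case: h'; lia.
Qed.

(** While [a] survives, it meets others only in triple collisions where it is spared. Without [a],
    the static and the left-moving particle of such a collision annihilate each other all the same,
    so the rest is not affected. *)
Lemma remove_first (a : int) (B X : set int) : V a = 1 ->
  (forall m, B m -> a < m) -> (forall m, X m <-> m = a \/ B m) ->
  forall k : nat, al X k a -> forall m, al X k m <-> m = a \/ al B k m.
Proof.
move=> Va HB HX; elim=> [_ m|k IH]; first exact: HX.
move=> /[dup] Xa /aliveS[Xa' sv] m; have {}E := IH Xa'.
have [->|/eqP ma] := eqVneq m a; first by split=> // _; left.
rewrite -[_ \/ _]/(m = a \/ al B k.+1 m).
have [pm|/eqP pm] := eqVneq (pos k.+1 m) (pos k.+1 a).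
  split=> [Xm|[//|]]; first by case: ma; apply: no_cohabitation Xm Xa pm.
  move=> /aliveS[Bm svm]; exfalso.
  case: sv => [/met0P m0|[i [j [[Ai ia ei] Vi [Aj ja ej] Vj _]]]].
    by apply/ma/m0 => //; apply/E; right.
  have Bi : al B k i by move/E: Ai => [/eqP|//]; rewrite (negbTE ia).
  have Bj : al B k j by move/E: Aj => [/eqP|//]; rewrite (negbTE ja).
  have am := HB _ (alive0 Bm).
  case: svm => [/met0P m0|[i' [j' [_ _ [Aj' _ ej'] Vj' sm]]]].
    have := m0 _ Bi; have := m0 _ Bj; rewrite ei ej pm => /(_ erefl) jm /(_ erefl) im.
    by move: Vj; rewrite jm -im Vi Va.
  have := HB _ (alive0 Aj').
  have := posP k.+1 j'; have := posP k.+1 m; have := posP k.+1 a; lia.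
rewrite !aliveS; split=> [[/E[//|Am] sm]|[//|[Am sm]]].
- right; split=> //; move: sm; apply: (iffLR (survives_ext S _)) => m' em.
  split=> [/E[e|//]|Am']; last by apply/E; right.
  by case: pm; rewrite -em e.
- split; first by apply/E; right.
  move: sm; apply: (iffLR (survives_ext S _)) => m' em.
  split=> [Am'|/E[e|//]]; first by apply/E; right.
  by case: pm; rewrite -em e.
Qed.

Lemma crossing_blocks (l : nat) : crossing l ->
  [/\ V l%:Z = -1, forall m, al (block 1 l.-1) l.-2 m <-> m = l%:Z,
   forall j m, (j <= l.-2)%N -> al (block 0 l) j m <-> m = 1 \/ al (block 1 l.-1) j m &
   forall j m, (j <= l.-2)%N -> al (block 0 l) j m -> 2 + j.+1%:Z <= pos j.+1 m].
Proof.
move=> [l1 V1 A1 H].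
have E j m : (j <= l.-2)%N -> al (block 0 l) j m <-> m = 1 \/ al (block 1 l.-1) j m.
  move=> jl; apply: remove_first => //; last exact: aliveW A1.
    by move=> m' /andP[].
  by move=> m'; rewrite /block /=; lia.
have P j m : (j <= l.-2)%N -> al (block 0 l) j m -> 2 + j.+1%:Z <= pos j.+1 m.
  move=> jl Am; have m1 : 1 <= m by have := alive0 Am; rewrite /block /=; lia.
  have := alive_orderS HV (aliveW jl A1) Am m1.
  by have := posP j.+1 1; lia.
have [Al l1' pl] := iffRL (H l%:Z) erefl.
have Vl : V l%:Z = -1 by have := posP l.-1 l%:Z; have := posP l.-1 1; lia.
split=> // m; split=> [Bm|->]; last first.
  by have /E := Al => /(_ (leqnn _))[|//]; lia.
have Am : al (block 0 l) l.-2 m by apply/E => //; right.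
apply/H; split=> //.
  by have := alive0 Bm; rewrite /block /=; lia.
have : m <= l%:Z by have := alive0 Bm; rewrite /block /=; lia.
move=> /(alive_orderS HV Am Al); have := P _ _ (leqnn _) Am.
have -> : l.-2.+1 = l.-1 by lia.
by have := posP l.-1 1; lia.
Qed.

Lemma crossing_dead (l : nat) : crossing l -> dead_block 0 l.
Proof.
move=> cl; have [Vl E1 E P] := crossing_blocks cl; have [l1 V1 A1 H] := cl.
have [Al l1' pl] := iffRL (H l%:Z) erefl.
rewrite /dead_block add0r; split=> //; first by lia.
exists l.-2; split=> //; last first.
  by move=> j m jl /(P _ _ jl); lia.
have A2 m : al (block 0 l) l.-2 m -> m = 1 \/ m = l%:Z.
  by move=> /E => /(_ (leqnn _)) [->|/E1]; [left|right].
move=> m /aliveS[]; have e2 : l.-2.+1 = l.-1 by lia.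
rewrite e2 => /A2 Hm [/met0P m0|[i [j [[Ai _ _] Vi _ _ _]]]]; last first.
  by have [e|e] := A2 _ Ai; subst i; lia.
case: Hm => e; subst m.
  by have := m0 _ Al pl; lia.
by have := m0 _ A1 (esym pl); lia.
Qed.

(** Until particle 1 meets [l], the whole block stays on the right of particle 1, hence of location
    1; at that time [l] is alone with it. *)
Lemma crossing_hits (l : nat) : crossing l -> hits 1 l.-1.
Proof.
move=> cl; have [Vl E1 E P] := crossing_blocks cl; have [l1 V1 A1 H] := cl.
have el : 1 + l.-1%:Z = l%:Z by lia.
have E1' := alive_singleton E1.
rewrite /hits el; split=> //; first by lia.
  by apply/E1' => //; lia.
move=> j m jl Bm; have [jl'|jl'] := ltnP j l.-2.
  have /P : al (block 0 l) j m by apply/E; [lia | right].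
  by move=> /(_ (ltnW jl')); lia.
have -> := iffLR (E1' _ _ jl') Bm.
by have := posP j.+1 l%:Z; lia.
Qed.

End first_particle.

(** * Encounter of the first particle with a static one *)

Section static_encounter.
Variables (V S : int -> int).
Hypothesis HV : forall n, V n = -1 \/ V n = 0 \/ V n = 1.

Local Notation pos := (position2 V).
Local Notation al D k := (alive D V S k).
Local Notation posP := (posP HV).
Local Notation hits := (hits V S).
Local Notation rhits := (rhits V S).
Local Notation stays_right := (stays_right V S).
Local Notation stays_left := (stays_left V S).
Local Notation dead_block := (dead_block V S).
Local Notation crossing := (crossing V S).
Local Notation reaches_static := (reaches_static V S).

(** Used with [L] empty, when the static particle comes first, and with [L] the particles between a
    right-moving particle and the static one that it would reach. *)
Lemma static_dead_block (b : int) (e d : nat) (L : set int) :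
  let i := b + e.+1%:Z in
  (forall m, L m <-> b < m < i) -> V i = 0 -> hits i d ->
  (forall m, ~ al L d.*2.-1 m) -> stays_left L i d.*2.-1 -> stays_right L b d.*2.-1 ->
  dead_block b (e.+1 + d).
Proof.
move=> i HL Vi hd L0 SL SRL; have [d0 Vd Ad SR] := hd.
have ei : b + (e.+1 + d)%N%:Z = i + d%:Z by rewrite /i; lia.
have ib : b < i by rewrite /i; lia.
have E : forall (j : nat) n, (j <= d.*2.-1)%N ->
    al (block b (e.+1 + d)) j n <-> al L j n \/ n = i \/ al (block i d) j n.
  apply: (alive_static HV) => //.
  - by move=> n /HL/andP[].
  - by move=> n /andP[].
  - by move=> n; rewrite HL /block /= ei; lia.
have E1 m : al (block b (e.+1 + d)) d.*2.-1 m -> m = i \/ m = i + d%:Z.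
  move=> /E => /(_ (leqnn _)) [/L0//|[->|/(hits_alive HV hd) ->]]; first by left.
    by right.
  exact: leqnn.
have Xi : al (block b (e.+1 + d)) d.*2.-1 i by apply/E => //; right; left.
have Xd : al (block b (e.+1 + d)) d.*2.-1 (i + d%:Z) by apply/E => //; right; right.
have ed : d.*2.-1.+1 = d.*2 by lia.
split; [lia | by rewrite ei |]; exists d.*2.-1; rewrite ei; split=> //.
  move=> m /aliveS[]; rewrite ed => /E1 Hm sv.
  have pi := posP d.*2 i; have pd := posP d.*2 (i + d%:Z).
  case: sv => [/met0P m0|].
    have := m0 _ Xi; have := m0 _ Xd; case: Hm => ->; lia.
  case: Hm => ->; first exact: static_not_spared.
  move=> [i' [j [_ _ [/E1 Aj _ _] Vj _]]].
  by case: Aj => ej; subst j; lia.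
move=> j m; rewrite ltnS leq_eqVlt => /orP[/eqP -> /E1 Hm|jd].
  by rewrite ed; have := posP d.*2 i; have := posP d.*2 (i + d%:Z); case: Hm => ->; lia.
move=> /E => /(_ (ltnW jd)) [/(SRL _ _ jd)//|[->|/(SR _ _ jd)]]; last by lia.
by have := posP j.+1 i; lia.
Qed.

Lemma static_first_dead (b : int) (d : nat) : V (b + 1) = 0 -> hits (b + 1) d ->
  dead_block b d.+1.
Proof.
move=> V0 hd; rewrite -(add1n d).
by apply: (@static_dead_block b 0 d (fun=> False)) => // [m|m /alive0|j m _ /alive0|j m _ /alive0] //; lia.
Qed.

Lemma reaches_static_survivor (d : nat) : reaches_static d ->
  (forall k, al (rblock d.+1%:Z d) k 1) /\
  (forall (k : nat) m, (d.*2.-1 <= k)%N -> al (rblock d.+1%:Z d) k m <-> m = 1).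
Proof.
move=> [hd _]; have e : 1 = d.+1%:Z - d%:Z by lia.
split=> [k|k m kd]; rewrite e; first exact: rhits_survivor.
exact: rhits_alive.
Qed.

(* Removing the first particle of the block crossed by [1] leaves a block that
   empties by itself. *)
Lemma reaches_static_inner (d : nat) (L := [set m | 1 < m < d.+1%:Z]%classic) :
  reaches_static d ->
  [/\ V 1 = 1, forall (k : nat) m, (d.*2.-1 <= k)%N -> ~ al L k m,
   forall k, stays_left L d.+1%:Z k & forall k, stays_right L 1 k].
Proof.
move=> hd; have [A1 A2] := reaches_static_survivor hd.
have [[d0 V1 _ SL] _] := hd.
have e : d.+1%:Z - d%:Z = 1 by lia.
rewrite e in V1.
have E k : forall m, al (rblock d.+1%:Z d) k m <-> m = 1 \/ al L k m.
  apply: (remove_first HV) => //; first by move=> m /andP[].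
  by move=> m; rewrite /L /rblock /=; lia.
have L0 : forall (k : nat) m, (d.*2.-1 <= k)%N -> ~ al L k m.
  move=> k m kd Lm; have /A2 : al (rblock d.+1%:Z d) k m by apply/E; right.
  by move=> /(_ kd) m1; have := alive0 Lm; rewrite /L /=; lia.
split=> // k j m _ Lm; have [jd|jd] := ltnP j d.*2.-1.
- by apply: SL jd _; apply/E; right.
- by case: (L0 _ _ jd Lm).
- have Lm' : al (rblock d.+1%:Z d) j m by apply/E; right.
  have := alive_orderS HV (A1 j) Lm'; have := alive0 Lm; rewrite /L /= => /andP[m1 _].
  by move=> /(_ (ltW m1)); have := posP j.+1 1; lia.
- by case: (L0 _ _ jd Lm).
Qed.

Lemma block_static (d n : nat) : (d < n)%N ->
  let R := block d.+1%:Z (n - d.+1) in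
  [/\ forall m, rblock d.+1%:Z d m -> m < d.+1%:Z, forall m, R m -> d.+1%:Z < m &
      forall m, block 0 n m <-> rblock d.+1%:Z d m \/ m = d.+1%:Z \/ R m].
Proof.
move=> dn R; rewrite /R /block /rblock; split=> m /=; lia.
Qed.

(** Particle 1 and the static particle are both gone at time [d.*2], and the right side is as if
    they had never been there: either nothing has arrived from it yet, or there is a tie that the
    sign -1 settles for the left-moving particle. *)
Lemma pass_static (d n : nat) : reaches_static d -> (d < n)%N ->
  let R := block d.+1%:Z (n - d.+1) in
  stays_right R d.+1%:Z d.*2 \/
    (stays_right R d.+1%:Z d.*2.-1 /\ n = d.*2.+1 /\ hits d.+1%:Z d /\ S d.+1%:Z = -1) ->
  (forall j, (j < d.*2)%N -> al (block 0 n) j 1) /\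
  (forall (k : nat) m, (d.*2 <= k)%N -> al (block 0 n) k m <-> al R k m).
Proof.
move=> hd dn R HR; have [A1 A2] := reaches_static_survivor hd.
have [[d0 V1 _ SL] V0] := hd; have e : d.+1%:Z - d%:Z = 1 by lia.
rewrite e in V1.
have [HL HR' HX] := block_static dn.
have SR : stays_right R d.+1%:Z d.*2.-1.
  by case: HR => [|[]//]; apply: stays_rightW; lia.
have E := alive_static HV HL HR' V0 HX SL SR.
split=> [j jd|]; first by apply/E; [lia | left].
apply: (alive_restart (k0 := d.*2)) => m.
have ed : d.*2 = d.*2.-1.+1 by lia.
have X1 : al (block 0 n) d.*2.-1 1 by apply/E => //; left.
have Xi : al (block 0 n) d.*2.-1 d.+1%:Z by apply/E => //; right; left.
have p1 := posP d.*2 1; have pi := posP d.*2 d.+1%:Z.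
have di : 1 <> d.+1%:Z by lia.
have X0 : ~ al (block 0 n) d.*2 d.+1%:Z.
  rewrite ed aliveS -ed => -[_ [/met0P /(_ _ X1)|]]; first by lia.
  exact: static_not_spared.
case: HR => [SR2|[_ [en [h Si]]]].
  have loc j : al (block 0 n) d.*2.-1 j -> pos d.*2 j = 2 * d.+1%:Z ->
      j = 1 \/ j = d.+1%:Z.
    move=> /E => /(_ (leqnn _)) [/(A2 _ _ (leqnn _)) -> _|[-> _|Rj pj]].
    - by left.
    - by right.
    - have := SR2 d.*2.-1 j; rewrite -ed pj => H.
      by have := H (leqnn _) Rj; rewrite ltxx.
  have X01 : ~ al (block 0 n) d.*2 1.
    rewrite ed aliveS -ed => -[_ [/met0P /(_ _ Xi)|[i [j [_ _ [Aj _ pj] Vj _]]]]].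
      by lia.
    by have [||] := loc _ Aj; [lia | |]; move=> ej; subst j; lia.
  split=> [Xm|Rm].
    have := aliveW (leq_pred _) Xm; rewrite E // => -[/(A2 _ _ (leqnn _)) e1|[e1|Rm]].
    - by subst m.
    - by subst m.
    move: Xm; rewrite ed !aliveS -ed => -[_ sv]; split=> //; move: sv.
    have pm := SR2 d.*2.-1 m; rewrite -ed in pm.
    have {pm} pm : 2 * d.+1%:Z < pos d.*2 m by apply: pm Rm; lia.
    apply: (iffLR (survives_ext S _)) => m' em; split.
      move=> /E => /(_ (leqnn _)) [/(A2 _ _ (leqnn _)) e1|[e1|//]]; subst m'; lia.
    by move=> Rm'; apply/E => //; right; right.
  have Rm' := aliveW (leq_pred _) Rm.
  move: Rm; rewrite ed !aliveS -ed => -[_ sv]; split; first by apply/E => //; right; right.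
  move: sv; have pm := SR2 d.*2.-1 m; rewrite -ed in pm.
  have {pm} pm : 2 * d.+1%:Z < pos d.*2 m by apply: pm Rm'; lia.
  apply: (iffLR (survives_ext S _)) => m' em; split.
    by move=> Rm2; apply/E => //; right; right.
  move=> /E => /(_ (leqnn _)) [/(A2 _ _ (leqnn _)) e1|[e1|//]]; subst m'; lia.
(* The tie: at time [d.*2.-1] only particle 1, the static particle and the left-moving [l]
   remain. *)
have eR : R = block d.+1%:Z d by rewrite /R en; congr block; lia.
have R2 := hits_alive HV h; rewrite -eR in R2.
have [_ Vj _ _] := h.
have [l el] : {l : int | l = d.+1%:Z + d%:Z} by exists (d.+1%:Z + d%:Z).
rewrite -el in R2 Vj.
have pl := posP d.*2 l.
have Xl : al (block 0 n) d.*2.-1 l by apply/E => //; right; right; apply/R2.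
have loc j : al (block 0 n) d.*2.-1 j -> j = 1 \/ j = d.+1%:Z \/ j = l.
  by move=> /E => /(_ (leqnn _)) [/(A2 _ _ (leqnn _)) ->|[->|/(R2 _ _ (leqnn _)) ->]]; auto.
rewrite R2 ?leq_pred//; split=> [/[dup] Xm /(aliveW (leq_pred _))/loc[e1|[e1|//]]|->].
- subst m; move: Xm; rewrite ed aliveS -ed => -[_ [/met0P /(_ _ Xi)|]]; first by lia.
  move=> [i [j [[Ai _ ei] Vi _ _ s]]].
  by have [ej|[ej|ej]] := loc _ Ai; subst i; lia.
- by subst m.
- rewrite ed aliveS -ed; split=> //; right; exists d.+1%:Z, 1; split=> //; last by right.
  + by split=> //; lia.
  + by split=> //; lia.
  + by rewrite Vj V1.
Qed.

Lemma reaches_static_hits (d d' : nat) : reaches_static d -> hits d.+1%:Z d' ->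
  (d < d')%N \/ (d = d' /\ S d.+1%:Z = -1) -> hits 0 (d.+1 + d').
Proof.
move=> hd h dd; have [d0' Vd' _ SR'] := h.
have dn : (d < d.+1 + d')%N by lia.
have eR : block d.+1%:Z (d.+1 + d' - d.+1) = block d.+1%:Z d' by congr block; lia.
have := pass_static hd dn; rewrite eR => -[|X1 X2].
  case: dd => [dd|[dd Si]]; first by left; apply: stays_rightW SR'; lia.
  by right; subst d'; split=> //; split; [lia|].
have dd' : (d <= d')%N by lia.
have V1 : V 1 = 1 by have [] := reaches_static_inner hd.
have en : 0 + (d.+1 + d')%N%:Z = d.+1%:Z + d'%:Z by lia.
split; rewrite ?en //.
  by apply/X2; [lia | apply: hits_survivor].
move=> j m jn Xm; have [jd|jd] := ltnP j d.*2.
  have m1 : 1 <= m by have := alive0 Xm; rewrite /block /=; lia.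
  have := alive_orderS HV (X1 _ jd) Xm m1.
  by have := posP j.+1 1; lia.
move/X2: Xm => /(_ jd) Rm; have [jd'|jd'] := ltnP j d'.*2.-1.
  by have := SR' _ _ jd' Rm; lia.
have -> := iffLR (hits_alive HV h _ jd') Rm.
by have := posP j.+1 (d.+1%:Z + d'%:Z); lia.
Qed.

Lemma reaches_static_nohit (d n : nat) : reaches_static d -> (d < n)%N ->
  (forall k, stays_right (block d.+1%:Z (n - d.+1)) d.+1%:Z k) -> ~ hits 0 n.
Proof.
move=> hd dn SR hn; have [_ X2] := pass_static hd dn (or_introl (SR _)).
have [n0 Vn _ _] := hn.
have := hits_survivor HV n.*2 hn; rewrite X2 => [|]; last by lia.
move=> Rn; have jk : (n.*2.-1 < n.*2)%N by lia.
have := SR _ _ _ jk (aliveW (leq_pred _) Rn).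
rewrite add0r in Vn *.
by have := posP n.*2.-1.+1 n%:Z; lia.
Qed.

Lemma triple_dead (d : nat) : reaches_static d -> hits d.+1%:Z d ->
  S d.+1%:Z <> 1 -> S d.+1%:Z <> -1 -> dead_block 0 d.*2.+1.
Proof.
move=> hd h S1 SN1; have [A1 A2] := reaches_static_survivor hd.
have [[d0 V1 _ SL] V0] := hd; have e : d.+1%:Z - d%:Z = 1 by lia.
rewrite e in V1; have dn : (d < d.*2.+1)%N by lia.
have [HL HR' HX] := block_static dn.
have [_ Vj _ SR] := h.
have eR : block d.+1%:Z (d.*2.+1 - d.+1) = block d.+1%:Z d by congr block; lia.
rewrite eR in HR' HX.
have E := alive_static HV HL HR' V0 HX SL SR.
have R2 := hits_alive HV h.
have en : 0 + d.*2.+1%:Z = d.+1%:Z + d%:Z by lia.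
have [l el] : {l : int | l = d.+1%:Z + d%:Z} by exists (d.+1%:Z + d%:Z).
rewrite -el in R2 Vj en.
have X1 : al (block 0 d.*2.+1) d.*2.-1 1 by apply/E => //; left.
have Xi : al (block 0 d.*2.+1) d.*2.-1 d.+1%:Z by apply/E => //; right; left.
have Xl : al (block 0 d.*2.+1) d.*2.-1 l by apply/E => //; right; right; apply/R2.
have loc j : al (block 0 d.*2.+1) d.*2.-1 j -> j = 1 \/ j = d.+1%:Z \/ j = l.
  by move=> /E => /(_ (leqnn _)) [/(A2 _ _ (leqnn _)) ->|[->|/(R2 _ _ (leqnn _)) ->]]; auto.
have ed : d.*2.-1.+1 = d.*2 by lia.
have p1 := posP d.*2 1; have pi := posP d.*2 d.+1%:Z; have pl := posP d.*2 l.
split; rewrite ?en//; exists d.*2.-1; split=> //; rewrite ?ed.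
  move=> m; rewrite -ed aliveS ed => -[/loc Hm [/met0P m0|]].
    by have := m0 _ X1; have := m0 _ Xi; case: Hm => [->|[->|->]]; lia.
  move=> [i [j [[Ai _ ei] Vi _ _ s]]].
  have ii : i = d.+1%:Z by have [ej|[ej|ej]] := loc _ Ai; subst i; lia.
  by subst i; case: s => -[].
move=> j m jd Xm; have m1 : 1 <= m by have := alive0 Xm; rewrite /block /=; lia.
have Xj1 : al (block 0 d.*2.+1) j 1 by apply: aliveW X1; lia.
by have := alive_orderS HV Xj1 Xm m1; have := posP j.+1 1; lia.
Qed.

(** The time of death identifies the partner. Particle 1 then has doubled position [2 + k.+1], so a
    static partner is [d.+1] with [k.+1 = d.*2], and a left-moving one is [k.+2]. *)
Lemma fate (n k : nat) : V 1 = 1 -> al (block 0 n) k 1 -> ~ al (block 0 n) k.+1 1 ->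
  ((k.+2 <= n)%N /\ crossing k.+2) \/
  exists d, [/\ k.+1 = d.*2, (d < n)%N, reaches_static d &
    let R := block d.+1%:Z (n - d.+1) in
    stays_right R d.+1%:Z d.*2.-1 /\
    (stays_right R d.+1%:Z d.*2 \/
     [/\ hits d.+1%:Z d, (d.*2.+1 <= n)%N & S d.+1%:Z <> 1])].
Proof.
move=> V1 X1 NX1.
have p1 := posP k.+1 1.
have [[i [Ai Vi ei]]|nostatic] :=
    pselect (exists i, [/\ al (block 0 n) k i, V i = 0 & pos k.+1 i = pos k.+1 1]).
  right; have i0 : 1 <= i <= n%:Z by have := alive0 Ai; rewrite /block /=; lia.
  have pi := posP k.+1 i.
  have [d ed] : exists d : nat, i = d.+1%:Z by exists (absz i).-1; lia.
  subst i; have kd : k.+1 = d.*2 by lia.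
  have kd' : k = d.*2.-1 by lia.
  exists d; have dn : (d < n)%N by lia.
  have [HL HR HX] := block_static dn.
  have [SL SR] := static_alive HV HL HR Vi HX Ai.
  have E := alive_static HV HL HR Vi HX SL SR.
  have hd : reaches_static d.
    have e : d.+1%:Z - d%:Z = 1 by lia.
    split=> //; rewrite /rhits e -kd'; split=> //; first by lia.
    by have /(E _ _ (leqnn k)) [//|[?|/alive0/HR ?]] := X1; exfalso; lia.
  split=> //; cbv zeta; rewrite -kd'; split=> //.
  set R := block d.+1%:Z _ in E SR HR HX *.
  have [[j [Aj Vj ej]]|nol] :=
    pselect (exists j, [/\ al (block 0 n) k j, V j = -1 & pos k.+1 j = pos k.+1 1]).
    right; have pj := posP k.+1 j.
    have jd : j = d.+1%:Z + d%:Z by lia.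
    subst j; have jn := alive0 Aj.
    have jn' : (d.*2.+1 <= n)%N by move: jn; rewrite /block /=; lia.
    have Rj : al R k (d.+1%:Z + d%:Z).
      by have /(E _ _ (leqnn k)) [/alive0/HL ?|[?|//]] := Aj; exfalso; lia.
    have [Bj E'] := wall_block HV (initial_block _ _) Vj Rj.
    split=> //.
      split=> //; [lia | by rewrite -kd' |].
      rewrite -kd' => i m ik Bm; apply: SR => //.
      by apply/E'; [lia | left].
    move=> S1; apply: NX1; rewrite aliveS; split=> //; right.
    exists d.+1%:Z, (d.+1%:Z + d%:Z); split=> //; [|by split=> //; lia|by rewrite Vj V1|by left].
    by split=> //; lia.
  left; rewrite -kd => j m; rewrite ltnS leq_eqVlt => /orP[/eqP ->|]; last exact: SR.
  move=> Rm; have Xm : al (block 0 n) k m by apply/E => //; right; right.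
  have := stays_right_pos HV HR SR (leqnn _) Rm; have := HR _ (alive0 Rm).
  have pm := posP k m; have pm' := posP k.+1 m.
  rewrite ltNge => mi pk; apply/negP => pk'; apply: nol; exists m.
  by split=> //; lia.
left; have [m [Am m1 em]] : exists m, met V (al (block 0 n) k) k.+1 1 m.
  apply: contrapT => H; apply: NX1; rewrite aliveS; split=> //; left.
  by apply/seteqP; split=> m // Hm; apply: H; exists m.
have mm m' : met V (al (block 0 n) k) k.+1 1 m' -> m' = k.+2%:Z /\ V m' = -1.
  move=> [Am' m1' em']; have pm := posP k.+1 m'.
  have V0 : V m' <> 0 by move=> V0; apply: nostatic; exists m'.
  by lia.
have [mk Vm] := mm _ (And3 Am m1 em); subst m.
have kn : (k.+2 <= n)%N by have := alive0 Am; rewrite /block /=; lia.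
split=> //.
have [Bk E'] := @wall_block V S HV 0 k.+2 k _ (initial_block 0 n) Vm Am.
have B2 m : al (block 0 n) k m -> 1 <= m <= k.+2%:Z -> al (block 0 k.+2) k m.
  by move=> /E' => /(_ (leqnSn _)) [//|/alive0 /= []]; lia.
split=> //=; first by apply: B2 => //; lia.
move=> m; split=> [[Bm m1' em']|->].
  by apply: (mm m _).1; split=> //; apply/E' => //; left.
by split=> //; apply: B2 => //; lia.
Qed.

End static_encounter.

(* [1] dies on the static particle [d.+1], which [d.+1 + d'] would otherwise
   have been the first to reach *)
Definition blocked (V S : int -> int) (d d' : nat) :=
  [/\ reaches_static V S d, hits V S d.+1%:Z d' &
      (d < d')%N \/ (d = d' /\ S d.+1%:Z <> 1)].

Lemma initial_half_line : initial 0 half_line.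
Proof. by split=> [m|m n]; rewrite /half_line /=; lia. Qed.

(** * Case analysis of the first arrival at 0 and at 1 *)

Section fates.
Variables (V S : int -> int).
Hypothesis HV : forall n, V n = -1 \/ V n = 0 \/ V n = 1.

Local Notation pos := (position2 V).
Local Notation al D k := (alive D V S k).
Local Notation posP := (posP HV).
Local Notation hits := (hits V S).
Local Notation rhits := (rhits V S).
Local Notation stays_right := (stays_right V S).
Local Notation stays_left := (stays_left V S).
Local Notation dead_block := (dead_block V S).
Local Notation crossing := (crossing V S).
Local Notation reaches_static := (reaches_static V S).
Local Notation blocked := (blocked V S).

Lemma hits_one : hits 0 1 <-> V 1 = -1.
Proof.
split=> [[]//|V1]; split=> //.
  rewrite add0r; apply/(@alive_singleton V S (block 0 1) 0 1) => // m.
  by rewrite /= /block /=; lia.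
move=> j m; rewrite ltnS leqn0 => /eqP -> /=; rewrite /block /= => m1.
by have := posP 1 m; lia.
Qed.

Lemma hits_left (n : nat) : V 1 = -1 -> hits 0 n <-> n = 1%N.
Proof.
by move=> /hits_one h1; split=> [hn|->//]; apply: (hits_inj HV hn h1).
Qed.

Lemma hits_static (n : nat) : V 1 = 0 -> hits 0 n <->
  exists i j, [/\ n = (i.+1 + j)%N, hits 1 i & hits i.+1%:Z j].
Proof.
move=> V1; split=> [hn|[i [j [-> hi hj]]]]; last first.
  apply/(dead_block_hits HV _ (static_first_dead HV _ _)); last by exists j.
  - by [].
  - by [].
have [n0 Vn An SR] := hn.
have X1 : ~ al (block 0 n) n.*2 1.
  by move=> /(hits_alive HV hn) => /(_ (leq_pred _)); rewrite add0r => e; rewrite -e V1 in Vn.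
have HX m : block 0 n m <-> @set0 int m \/ m = 1 \/ block 1 n.-1 m.
  by rewrite /block /set0 /=; lia.
(* If nothing arrived from the right, the static particle 1 would survive, whereas [n] is the only
   survivor of its block. *)
have NR : ~ stays_right (block 1 n.-1) 1 n.*2.
  move=> SR1; apply: X1.
  apply: (iffRL (@alive_static V S HV set0 _ _ 1 _ _ _ V1 HX _ SR1 _ 1 (leqnn _))).
  - by [].
  - by move=> m /andP[].
  - by move=> j m _ /alive0.
  - by right; left.
have [i [_ Ri hi]] := first_hit HV (initial_block _ _) NR.
have /(dead_block_hits HV n) := static_first_dead HV (b := 0) V1 hi.
move=> /iffLR /(_ hn) [j -> hj]; exists i, j; split=> //.
Qed.

(** With [crossing_death], this makes the fates of particle 1 mutually exclusive: each one
    determines when it dies on the half-line and whether a static particle is there. *)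
Lemma blocked_death (d d' : nat) : blocked d d' ->
  [/\ forall j, (j < d.*2)%N -> al half_line j 1, ~ al half_line d.*2 1 &
      al half_line d.*2.-1 d.+1%:Z].
Proof.
move=> [hd h dd]; have [A1 A2] := reaches_static_survivor HV hd.
have [[d0 V1 _ SL] V0] := hd; have e : d.+1%:Z - d%:Z = 1 by lia.
rewrite e in V1; have dn : (d < d.+1 + d')%N by lia.
have [HL HR' HX] := block_static dn.
have [d0' Vj Aj SR'] := h.
have eR : block d.+1%:Z (d.+1 + d' - d.+1) = block d.+1%:Z d' by congr block; lia.
rewrite eR in HR' HX.
have SR : stays_right (block d.+1%:Z d') d.+1%:Z d.*2.-1.
  by apply: stays_rightW SR'; lia.
have E := alive_static HV HL HR' V0 HX SL SR.
have en : 0 + (d.+1 + d')%N%:Z = d.+1%:Z + d'%:Z by lia.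
have Hn : half_line (0 + (d.+1 + d')%N%:Z) by rewrite /half_line /=; lia.
have Xn : al (block 0 (d.+1 + d')) d.*2.-1 (0 + (d.+1 + d')%N%:Z).
  by rewrite en; apply/E => //; right; right; apply: hits_survivor.
have ed : d.*2.-1.+1 = d.*2 by lia.
have EH : forall (j : nat) m, (j <= d.*2)%N -> al half_line j m <->
    al (block 0 (d.+1 + d')) j m \/
    al [set m | half_line m /\ 0 + (d.+1 + d')%N%:Z < m]%classic j m.
  rewrite -{1}ed {1}(initial_split initial_half_line Hn).
  apply: (alive_wallS HV _ _ _ Xn); rewrite ?en //.
  - by move=> m /andP[]; rewrite en.
  - by move=> m [].
have X1 j : (j < d.*2)%N -> al (block 0 (d.+1 + d')) j 1 by move=> jd; apply/E; [lia | left].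
have Xi : al (block 0 (d.+1 + d')) d.*2.-1 d.+1%:Z by apply/E => //; right; left.
split=> [j jd||].
- by apply/EH; [lia | left; apply: X1].
- have p1 := posP d.*2 1; have pi := posP d.*2 d.+1%:Z.
  move=> /EH => /(_ (leqnn _)) [|/alive0 /= []]; last by lia.
  rewrite -{1}ed aliveS ed => -[_ [/met0P /(_ _ Xi)|]]; first by lia.
  move=> [i [j [[Ai _ ei] Vi [Aj' _ ej] Vj' s]]].
  have ii : i = d.+1%:Z by have := posP d.*2 i; lia.
  subst i; have S1 : S d.+1%:Z = 1 by lia.
  case: dd => [dd|[//]].
  have pj := posP d.*2 j.
  have /E := Aj' => /(_ (leqnn _)) [/alive0/HL|[|Rj]]; [lia|lia|].
  have dd1 : (d.*2.-1 < d'.*2.-1)%N by lia.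
  by have := SR' _ _ dd1 Rj; rewrite ed; lia.
- by apply/EH; [lia | left].
Qed.

Lemma crossing_death (l : nat) : crossing l ->
  [/\ al half_line l.-2 1, ~ al half_line l.-1 1 &
      forall i, V i = 0 -> al half_line l.-2 i -> pos l.-1 i <> pos l.-1 1].
Proof.
move=> cl; have [l1 V1 A1 H] := cl; have [Vl E1 E P] := crossing_blocks HV cl.
have [Al l1' pl] := iffRL (H l%:Z) erefl.
have Hn : half_line (0 + l%:Z) by rewrite /half_line /=; lia.
rewrite add0r in Hn.
have el : l.-2.+1 = l.-1 by lia.
have EH : forall (j : nat) m, (j <= l.-1)%N -> al half_line j m <->
    al (block 0 l) j m \/ al [set m | half_line m /\ l%:Z < m]%classic j m.
  rewrite -{1}el {1}(@initial_split 0 half_line l initial_half_line) ?add0r //.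
  apply: (alive_wallS HV _ _ _ Al) => //.
  - by move=> m /andP[]; rewrite add0r.
  - by move=> m [].
split.
- by apply/EH; [lia | left].
- move=> /EH => /(_ (leqnn _)) [|/alive0 /= []]; last by lia.
  rewrite -{1}el aliveS el => -[_ [/met0P m0|[i [j [Mi Vi _ _ _]]]]].
    by have := m0 _ Al pl; lia.
  by have := iffLR (H i) Mi => e; subst i; lia.
- move=> i Vi /EH => /(_ _) [|Bi|/alive0 /= []]; first by lia.
    move=> ei; have Mi : met V (al (block 0 l) l.-2) l.-1 1 i.
      by split=> //; apply: contra_eqN ei => /eqP ei; subst i; lia.
    by have := iffLR (H i) Mi => e; subst i; lia.
  by move=> _ li; have := posP l.-1 i; have := posP l.-1 1; lia.
Qed.

Lemma crossing_inj (l l' : nat) : crossing l -> crossing l' -> l = l'.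
Proof.
move=> cl cl'; have := hits_inj HV (crossing_hits HV cl) (crossing_hits HV cl').
by case: cl; case: cl'; lia.
Qed.

Lemma blocked_inj (d d' e e' : nat) : blocked d d' -> blocked e e' -> d = e /\ d' = e'.
Proof.
wlog de : d d' e e' / (d <= e)%N.
  move=> H b b'; have [/H|/ltnW/H] := leqP d e; first exact.
  by move=> /(_ _ _ b' b) [-> ->].
move=> b b'; have ed : d = e.
  apply/eqP; rewrite eqn_leq de /= leqNgt; apply/negP => lt.
  have [_ N _] := blocked_death b; have [Y _ _] := blocked_death b'.
  by apply/N/Y; lia.
subst e; split=> //.
by case: b b' => _ h _ [_ h' _]; apply: hits_inj h h'.
Qed.

Lemma crossing_not_blocked (l d d' : nat) : crossing l -> blocked d d' -> False.
Proof.
move=> cl b; have [Y N Z] := blocked_death b; have [Y' N' Z'] := crossing_death cl.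
have [l1 V1 _ _] := cl.
have [[_ Vd] _ _] := b.
have ld : l.-1 = d.*2.
  case: (ltngtP l.-1 d.*2) => // lt; first by case: N'; apply: Y.
  by case: N; apply: aliveW Y'; lia.
apply: (Z' d.+1%:Z) => //.
  by have -> : l.-2 = d.*2.-1 by lia.
by have := posP l.-1 1; have := posP l.-1 d.+1%:Z; lia.
Qed.

Lemma fate_hits (n N : nat) : V 1 = 1 -> ~ al (block 0 n) N 1 -> (0 < n)%N ->
  (exists2 l, (l <= n)%N & crossing l) \/
  exists d, [/\ (d < n)%N, (d.*2 <= N)%N, reaches_static d &
    stays_right (block d.+1%:Z (n - d.+1)) d.+1%:Z d.*2.-1 /\
    (stays_right (block d.+1%:Z (n - d.+1)) d.+1%:Z d.*2 \/
     [/\ hits d.+1%:Z d, (d.*2.+1 <= n)%N & S d.+1%:Z <> 1])].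
Proof.
move=> V1 + n0; elim: N => [[]|N IH NX]; first by rewrite /= /block /=; lia.
have [X|/IH[|[d [dn dN hd H]]]] := pselect (al (block 0 n) N 1).
- have [[kn ck]|[d [kd dn hd H]]] := fate HV V1 X NX.
    by left; exists N.+2.
  by right; exists d; split=> //; lia.
- by left.
- by right; exists d; split=> //; lia.
Qed.

(** The four fates of particle 1: it dies with a left-moving particle; it dies in a tie where nobody
    is spared; it removes a static particle before the right side arrives; it loses a tie to the
    left-moving particle. In the first two a whole block vanishes and another arrival must follow;
    in the last two the particle that was heading for the static one goes on to 0. *)
Lemma hits_right (n : nat) : V 1 = 1 -> hits 0 n <->
  [\/ exists l j, [/\ n = (l + j)%N, crossing l & hits l%:Z j],
      exists d j, [/\ n = (d.*2.+1 + j)%N, blocked d d, S d.+1%:Z <> -1 & hits d.*2.+1%:Z j],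
      exists d d', [/\ n = (d.+1 + d')%N, blocked d d' & (d < d')%N] |
      exists d, [/\ n = (d.+1 + d)%N, blocked d d & S d.+1%:Z = -1]].
Proof.
move=> V1; split=> [hn|].
  have [n0 Vn _ _] := hn.
  have X1 : ~ al (block 0 n) n.*2 1.
    by move=> /(hits_alive HV hn) => /(_ (leq_pred _)); rewrite add0r => e; rewrite -e V1 in Vn.
  case: (fate_hits V1 X1 n0) => [[l ln cl]|[d [dn _ hd [SR []]]]].
  - have [j e hj] := iffLR (dead_block_hits HV n (crossing_dead HV cl)) hn.
    by constructor 1; exists l, j; rewrite add0r in hj.
  - move=> SR2.
    have [|NSR] := pselect (forall k, stays_right (block d.+1%:Z (n - d.+1)) d.+1%:Z k).
      by move=> /(reaches_static_nohit HV hd dn).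
    have [k {}NSR] : exists k, ~ stays_right (block d.+1%:Z (n - d.+1)) d.+1%:Z k.
      by apply: contrapT => H; apply: NSR => k; apply: contrapT => H'; apply: H; exists k.
    have [d' [_ Rd' hd']] := first_hit HV (initial_block _ _) NSR.
    have dd' : (d < d')%N.
      rewrite ltnNge; apply/negP => dd'.
      by apply: (hits_not_stays HV (initial_block _ _) Rd' hd' _ SR2); lia.
    constructor 3; exists d, d'; split=> //; last by split=> //; left.
    by apply: (hits_inj HV hn); apply: (reaches_static_hits HV hd hd'); left.
  - move=> [h dn' S1]; have b : blocked d d by split=> //; right.
    have [Sm|Sm] := pselect (S d.+1%:Z = -1).
      constructor 4; exists d; split=> //.
      by apply: (hits_inj HV hn); apply: (reaches_static_hits HV hd h); right.
    have [j e hj] := iffLR (dead_block_hits HV n (triple_dead HV hd h S1 Sm)) hn.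
    by constructor 2; exists d, j; rewrite add0r in hj.
case=> [[l [j [-> cl hj]]]|[d [j [-> b Sm hj]]]|[d [d' [-> b dd]]]|[d [-> b Sm]]].
- by apply/(dead_block_hits HV _ (crossing_dead HV cl)); exists j; rewrite ?add0r.
- have [hd h dd] := b.
  have S1 : S d.+1%:Z <> 1 by case: dd => [|[]//]; rewrite ltnn.
  by apply/(dead_block_hits HV _ (triple_dead HV hd h S1 Sm)); exists j; rewrite ?add0r.
- by have [hd h _] := b; apply: (reaches_static_hits HV hd h); left.
- by have [hd h _] := b; apply: (reaches_static_hits HV hd h); right.
Qed.

(** Without particle 1, the static particle on which it dies is destroyed from the right instead,
    after the particles in between have cleared themselves. *)
Lemma blocked_dead (d d' : nat) : blocked d d' -> dead_block 1 (d + d').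
Proof.
move=> [hd h dd]; have [V1 L0 SL SR] := reaches_static_inner HV hd.
have [[d0 _ _ _] Vd] := hd.
have dd' : (d <= d')%N by lia.
have ed : 1 + d.-1.+1%:Z = d.+1%:Z by lia.
have -> : (d + d')%N = (d.-1.+1 + d')%N by lia.
apply: (static_dead_block HV (L := [set m | 1 < m < d.+1%:Z]%classic)); rewrite ?ed //.
by move=> m; apply: L0; lia.
Qed.

Lemma hits_second (m : nat) : V 1 = 1 -> hits 1 m <->
  crossing m.+1 \/
  exists d d' d'', [/\ m = (d + d' + d'')%N, blocked d d' & hits (d.+1 + d')%N%:Z d''].
Proof.
move=> V1; split; last first.
  case=> [cm|[d [d' [d'' [-> b h]]]]]; first exact: (crossing_hits HV cm).
  apply/(dead_block_hits HV _ (blocked_dead b)); exists d'' => //.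
move=> hm.
have [m0 Vm _ _] := hm.
have E k : al (block 0 m.+1) k 1 ->
    forall x, al (block 0 m.+1) k x <-> x = 1 \/ al (block 1 m) k x.
  apply: (remove_first HV) => //; first by move=> x /andP[].
  by move=> x; rewrite /block /=; lia.
have X1 : ~ al (block 0 m.+1) m.*2 1.
  move=> X1; have Xm : al (block 0 m.+1) m.*2 (1 + m%:Z).
    by apply/E => //; right; apply: (hits_survivor HV).
  have em : 1 + m%:Z = m.+1%:Z by lia.
  rewrite em in Xm Vm; have m1 : 1 < m.+1%:Z by lia.
  by have := alive_order HV X1 Xm m1; have := posP m.*2 1; have := posP m.*2 m.+1%:Z; lia.
case: (fate_hits V1 X1 isT) => [[l lm cl]|[d [dn _ hd [SR H]]]].
  left; have e := hits_inj HV hm (crossing_hits HV cl).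
  by have -> : m.+1 = l by case: cl; lia.
right; have [[d0 _ _ _] Vd] := hd.
have [_ L0 SL SRL] := reaches_static_inner HV hd.
set R := block d.+1%:Z _ in SR H.
(* Otherwise the static particle would survive in [block 1 m], whose only survivor is the hitting
   particle. *)
have NSR : ~ forall k, stays_right R d.+1%:Z k.
  move=> SR'.
  have HL : forall x : int, [set x | 1 < x < d.+1%:Z]%classic x -> x < d.+1%:Z.
    by move=> x /andP[].
  have HR : forall x : int, R x -> d.+1%:Z < x by move=> x /andP[].
  have HX : forall x, block 1 m x <-> [set x | 1 < x < d.+1%:Z]%classic x \/
      x = d.+1%:Z \/ R x by move=> x; rewrite /R /block /=; lia.
  have Xd : al (block 1 m) m.*2 d.+1%:Z.
    by apply: (iffRL (alive_static HV HL HR Vd HX (SL _) (SR' _) _ (leqnn _))); right; left.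
  have e := iffLR (hits_alive HV hm _ (leq_pred _)) Xd.
  by rewrite -e Vd in Vm.
have [k {}NSR] : exists k, ~ stays_right R d.+1%:Z k.
  by apply: contrapT => H'; apply: NSR => k; apply: contrapT => H''; apply: H'; exists k.
have [d' [_ Rd' hd']] := first_hit HV (initial_block _ _) NSR.
have dd' : (d <= d')%N.
  rewrite leqNgt; apply/negP => dd'.
  by apply: (hits_not_stays HV (initial_block _ _) Rd' hd' _ SR); lia.
have b : blocked d d'.
  split=> //; have [e|ne] := eqVneq d d'; last by left; lia.
  right; split=> //; case: H => [SR2|[_ _ //]].
  by case: (hits_not_stays HV (initial_block _ _) Rd' hd' _ SR2); lia.
have [d'' e hd''] := iffLR (dead_block_hits HV m (blocked_dead b)) hm.
by exists d, d', d''.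
Qed.

Lemma reaches0E : reaches0 V (alive half_line V S) <-> exists n, hits 0 n.
Proof.
split=> [[m [k [Vm pm Am]]]|[n hn]].
  have m1 : 1 <= m := alive0 Am.
  have pk := posP k m.
  have NSR : ~ stays_right half_line 0 k.
    move=> SR; have ek : k.-1.+1 = k by lia.
    have := SR k.-1 m; rewrite ek => /(_ (leqnn _) (aliveW (leq_pred _) Am)).
    by lia.
  by have [n [_ _ hn]] := first_hit HV initial_half_line NSR; exists n.
have [n0 Vn _ _] := hn; exists n%:Z, n.*2; split.
- by rewrite add0r in Vn.
- by have := posP n.*2 n%:Z; rewrite add0r in Vn; lia.
- rewrite -(add0r n%:Z); apply: (hits_in HV _ initial_half_line _ hn).
  by rewrite /half_line /=; lia.
Qed.

Lemma static_survives : V 0 = 0 ->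
  (forall k, al setT k 0) <-> ~ (exists n, hits 0 n) /\ ~ (exists n, rhits 0 n).
Proof.
move=> V0; pose R : set int := [set m | 0 < m]%classic; pose L : set int := [set m | m < 0]%classic.
have HL : forall m, L m -> m < 0 by [].
have HR : forall m, R m -> 0 < m by [].
have HX : forall m, [set: int]%classic m <-> L m \/ m = 0 \/ R m.
  by move=> m; rewrite /L /R /=; split=> // _; lia.
have iR : initial 0 R by split=> // m n; rewrite /R /=; lia.
have HM m : R (- m) <-> L m by rewrite /R /L /=; lia.
have HVm := mirror_velocities HV.
have iR' : initial (- 0) R by rewrite oppr0.
have Rn (n : nat) : (0 < n)%N -> R (0 + n%:Z) by rewrite /R /=; lia.
split=> [A0|[N1 N2] k].
  split=> -[n hn].
    have n0 : (0 < n)%N by case: hn.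
    have [_ SR] := static_alive HV HL HR V0 HX (A0 n.*2).
    exact: (hits_not_stays HV iR (Rn _ n0) hn (leqnn _) SR).
  have n0 : (0 < n)%N by case: hn.
  have [SL _] := static_alive HV HL HR V0 HX (A0 n.*2).
  have SL' := iffRL (stays_mirror V S 0 n.*2 HM) SL.
  have hn' := iffLR (rhits_mirror V S 0 n) hn.
  rewrite oppr0 in SL' hn'.
  exact: (hits_not_stays HVm iR (Rn _ n0) hn' (leqnn _) SL').
have SL : stays_left L 0 k.
  apply/(stays_mirror V S 0 k HM); rewrite oppr0; apply: contrapT.
  move=> /(first_hit HVm iR)[n [_ _ hn]].
  by apply: N2; exists n; apply/rhits_mirror; rewrite oppr0.
have SR : stays_right R 0 k.
  by apply: contrapT => /(first_hit HV iR)[n [_ _ hn]]; apply: N1; exists n.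
by apply: (iffRL (alive_static HV HL HR V0 HX SL SR 0 (leqnn k))); right; left.
Qed.

End fates.

(** * Finite words *)

(* A letter is the velocity and the sign of a particle.  The parameter [rho] of
   [weight] is the probability that a sign is nonzero. *)
Definition alphabet : seq (int * int) :=
  [seq (x, y) | x <- [:: -1; 0; 1], y <- [:: -1; 0; 1]].

Definition opp_letter (l : int * int) : int * int := (- l.1, - l.2).

(** Particle [k.+1] carries letter [k]. Indices outside the word get 0, which local events do not
    read and which is still an admissible velocity. *)
Definition word_v (w : seq (int * int)) (n : int) : int :=
  if n is Posz k.+1 then (nth (0, 0) w k).1 else 0.
Definition word_s (w : seq (int * int)) (n : int) : int :=
  if n is Posz k.+1 then (nth (0, 0) w k).2 else 0.

Definition shiftz (a : nat) (f : int -> int) (n : int) : int := f (n + a%:Z).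

Definition local (n : nat) (E : (int -> int) -> (int -> int) -> Prop) :=
  forall V S V' S', (forall m : int, 0 < m <= n%:Z -> V m = V' m /\ S m = S' m) ->
  E V S -> E V' S'.

Section words.
Variables (R : realType) (p rho : R).

Definition weight (l : int * int) : R :=
  (if l.1 == 0 then p else (1 - p) / 2) * (if l.2 == 0 then 1 - rho else rho / 2).

(** A finite sum rather than an integral: one expression serves the recursions, the transfer to the
    probability space and, being polynomial in [p], the continuity arguments. *)
Fixpoint expect (n : nat) (F : seq (int * int) -> R) : R :=
  if n is n'.+1 then \sum_(l <- alphabet) weight l * expect n' (fun w => F (l :: w))
  else F [::].

Definition good_word (n : nat) (w : seq (int * int)) :=
  size w = n /\ all [in alphabet] w.

Lemma expect_ext (n : nat) (F G : seq (int * int) -> R) :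
  (forall w, good_word n w -> F w = G w) -> expect n F = expect n G.
Proof.
elim: n F G => [|n IH] F G FG /=; first exact: FG.
apply: eq_big_seq => l lA; congr (_ * _); apply: IH => w [sw aw].
by apply: FG; split=> /=; rewrite ?sw // lA.
Qed.

Lemma expect_cat (m n : nat) (F : seq (int * int) -> R) :
  expect (m + n) F = expect m (fun u => expect n (fun w => F (u ++ w))).
Proof.
elim: m F => //= m IH F; apply: eq_bigr => l _; congr (_ * _); exact: IH.
Qed.

Lemma expectZ (n : nat) (k : R) (F : seq (int * int) -> R) :
  expect n (fun w => k * F w) = k * expect n F.
Proof.
elim: n F => //= n IH F; rewrite big_distrr; apply: eq_bigr => l _ /=.
by rewrite IH mulrCA.
Qed.

Lemma expectD (n : nat) (F G : seq (int * int) -> R) :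
  expect n (fun w => F w + G w) = expect n F + expect n G.
Proof.
elim: n F G => //= n IH F G; rewrite -big_split; apply: eq_bigr => l _ /=.
by rewrite IH mulrDr.
Qed.

Lemma expect0 (n : nat) : expect n (fun=> 0) = 0.
Proof. by elim: n => //= n ->; rewrite big1 // => l _; rewrite mulr0. Qed.

Lemma expect_sum (n : nat) (I : Type) (r : seq I) (P : pred I)
    (F : I -> seq (int * int) -> R) :
  expect n (fun w => \sum_(i <- r | P i) F i w) = \sum_(i <- r | P i) expect n (F i).
Proof.
elim: r => [|i r IH].
  by rewrite big_nil -[RHS](expect0 n); apply: expect_ext => w _; rewrite big_nil.
rewrite big_cons -IH; case: ifP => Pi; last first.
  by apply: expect_ext => w _; rewrite big_cons Pi.
by rewrite -expectD; apply: expect_ext => w _; rewrite big_cons Pi.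
Qed.

Lemma weight_sum : \sum_(l <- alphabet) weight l = 1.
Proof. by rewrite /weight /alphabet /= !big_cons big_nil /=; field. Qed.

Lemma expect1 (n : nat) : expect n (fun=> 1) = 1.
Proof.
by elim: n => //= n ->; rewrite -[RHS]weight_sum; apply: eq_bigr => l _; rewrite mulr1.
Qed.

Lemma expect_rcons (n : nat) (F : seq (int * int) -> R) :
  expect n.+1 F = \sum_(l <- alphabet) weight l * expect n (fun w => F (rcons w l)).
Proof.
rewrite -addn1 expect_cat /= expect_sum; apply: eq_bigr => l _.
by rewrite expectZ; congr (_ * _); apply: expect_ext => w _; rewrite cats1.
Qed.

Lemma expect_rev (n : nat) (F : seq (int * int) -> R) :
  expect n (F \o rev) = expect n F.
Proof.
elim: n F => // n IH F; rewrite expect_rcons /=; apply: eq_bigr => l _.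
by rewrite -(IH (fun w => F (l :: w))); congr (_ * _); apply: expect_ext => w _ /=; rewrite rev_rcons.
Qed.

(** Letters have a symmetric law. Together with [expect_rev] this gives invariance under reflection
    of a block. *)
Lemma expect_opp (n : nat) (F : seq (int * int) -> R) :
  expect n (fun w => F (map opp_letter w)) = expect n F.
Proof.
elim: n F => //= n IH F.
under eq_bigr => l _ do rewrite (IH (fun w => F (opp_letter l :: w))).
rewrite /alphabet /= !big_cons !big_nil /= /opp_letter /weight /=; rewrite !oppr0 ?opprK; ring.
Qed.

Definition word_prob (n : nat) (E : (int -> int) -> (int -> int) -> Prop) : R :=
  expect n (fun w => `[< E (word_v w) (word_s w) >]%:R).

Hypothesis p01 : 0 <= p <= 1.
Hypothesis rho01 : 0 <= rho <= 1.

Lemma weight_ge0 (l : int * int) : 0 <= weight l.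
Proof.
case/andP: p01 => p0 p1; case/andP: rho01 => r0 r1.
by rewrite /weight; case: ifP => _; case: ifP => _; apply: mulr_ge0; lra.
Qed.

Lemma expect_ge0 (n : nat) (F : seq (int * int) -> R) :
  (forall w, 0 <= F w) -> 0 <= expect n F.
Proof.
elim: n F => [F H|n IH F H] /=; first exact: H.
by apply: sumr_ge0 => l _; apply: mulr_ge0; [exact: weight_ge0 | apply: IH].
Qed.

End words.

Lemma word_velocities (n : nat) (w : seq (int * int)) : good_word n w ->
  forall m, word_v w m = -1 \/ word_v w m = 0 \/ word_v w m = 1.
Proof.
move=> [_ /allP aw] [[|k]|k] /=; [by auto | | by auto].
have [kw|kw] := ltnP k (size w); last by rewrite nth_default //=; auto.
have := aw _ (mem_nth (0, 0) kw); case: (nth _ _ _) => x y.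
by rewrite /alphabet !inE /= => /or4P[/eqP[-> _]|/eqP[-> _]|/eqP[-> _]|/or4P[/eqP[-> _]|/eqP[-> _]|/eqP[-> _]|/or3P[/eqP[-> _]|/eqP[-> _]|/eqP[-> _]]]]; auto.
Qed.

Section word_events.
Variables (R : realType) (p rho : R).
Local Notation Pr := (word_prob p rho).

Lemma local_iff (n : nat) (E : (int -> int) -> (int -> int) -> Prop) (V S V' S' : int -> int) :
  local n E -> (forall m : int, 0 < m <= n%:Z -> V m = V' m /\ S m = S' m) ->
  E V S <-> E V' S'.
Proof. by move=> LE H; split; apply: LE => // m /H[-> ->]. Qed.

Lemma word_prob_ext (n : nat) (E F : (int -> int) -> (int -> int) -> Prop) :
  (forall w, good_word n w -> E (word_v w) (word_s w) <-> F (word_v w) (word_s w)) ->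
  Pr n E = Pr n F.
Proof. by move=> EF; apply: expect_ext => w gw; rewrite (propext (EF w gw)). Qed.

Lemma word_prob_shift (m k : nat) (E F : (int -> int) -> (int -> int) -> Prop) :
  local m E -> local k F ->
  Pr (m + k) (fun V S => E V S /\ F (shiftz m V) (shiftz m S)) = Pr m E * Pr k F.
Proof.
move=> LE LF; rewrite /word_prob expect_cat mulrC -expectZ; apply: expect_ext => u [su _].
rewrite mulrC -expectZ; apply: expect_ext => w [sw _].
rewrite -natrM mulnb asbool_and; congr ((_ && _)%:R); apply: asbool_equiv_eq.
  apply: local_iff LE _ => -[[|x]|x] //= xm.
  by rewrite nth_cat su; have -> : (x < m)%N by lia.
apply: local_iff LF _ => -[[|x]|x] // xm; rewrite /shiftz.
have -> : Posz x.+1 + Posz m = Posz (x + m).+1 by lia.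
rewrite /= nth_cat su; have -> : (x + m < m)%N = false by lia.
by rewrite addnK.
Qed.

End word_events.

Lemma alive_shift (V S V' S' : int -> int) (D D' : set int) (c : int) (k : nat) :
  (forall m, D m -> V' (m + c) = V m /\ S' (m + c) = S m) ->
  (forall m, D' (m + c) <-> D m) ->
  forall m, alive D' V' S' k (m + c) <-> alive D V S k m.
Proof.
move=> HV HD m; have := @alive_iso D D' V V' S S' 1 c k (or_introl erefl) _ _ m.
rewrite mul1r; apply => x; rewrite ?mul1r; last exact: HD.
by move=> /HV[-> ->].
Qed.

Lemma hits_shift (V S V' S' : int -> int) (a c : int) (n : nat) :
  (forall m, block a n m -> V' (m + c) = V m /\ S' (m + c) = S m) ->
  hits V' S' (a + c) n <-> hits V S a n.
Proof.
move=> H; have HD m : block (a + c) n (m + c) <-> block a n m by rewrite /block /=; lia.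
have A k m := alive_shift k H HD m.
have e : a + c + n%:Z = a + n%:Z + c by lia.
have [->|n0] := posnP n; first by split=> -[].
have Vn : V' (a + n%:Z + c) = V (a + n%:Z) by have [] := H (a + n%:Z); rewrite /block /=; lia.
have P k m : block a n m -> position2 V' k (m + c) = position2 V k m + 2 * c.
  by move=> /H[Vm _]; rewrite /position2 Vm; ring.
split=> -[_ Va Aa SR]; split=> //; rewrite ?e ?Vn // in Va Aa *.
- exact/A.
- move=> j m jn Am; have := SR j (m + c) jn (iffRL (A j m) Am).
  by rewrite P; [lia | exact: alive0 Am].
- exact/A.
- move=> j m; have -> : m = (m - c) + c by lia.
  by move=> jn /A Am; rewrite P; [have := SR _ _ jn Am; lia | exact: alive0 Am].
Qed.

Lemma hits_shift0 (V S : int -> int) (a : nat) (n : nat) :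
  hits V S a%:Z n <-> hits (shiftz a V) (shiftz a S) 0 n.
Proof.
have := @hits_shift (shiftz a V) (shiftz a S) V S 0 a%:Z n; rewrite add0r; apply.
by [].
Qed.

Lemma local_hits (n : nat) : local n (fun V S => hits V S 0 n).
Proof.
move=> V S V' S' H hn; have := @hits_shift V S V' S' 0 0 n; rewrite addr0 => E.
by apply/E => // m; rewrite /block /= add0r addr0 => /H[-> ->].
Qed.

Lemma local_crossing (n : nat) : local n (fun V S => crossing V S n).
Proof.
move=> V S V' S' H [n1 V1 A1 M]; have H1 : V 1 = V' 1 by case: (H 1) => //; lia.
have E m : alive (block 0 n) V' S' n.-2 m <-> alive (block 0 n) V S n.-2 m.
  by apply: alive_ext => x; rewrite /block /= add0r => /H[-> ->].
split=> //; [by rewrite -H1 | exact/E |] => m; rewrite -M.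
have P x : alive (block 0 n) V S n.-2 x -> position2 V' n.-1 x = position2 V n.-1 x.
  by move=> /alive0; rewrite /block /= add0r /position2 => /H[-> _].
split=> -[Am m1 em]; split=> //; first exact/E.
- by move/E in Am; rewrite -!P.
- exact/E.
- by rewrite !P.
Qed.

Lemma local_rhits (d : nat) : local d (fun V S => rhits V S d.+1%:Z d).
Proof.
move=> V S V' S' H /rhits_mirror hd; apply/rhits_mirror.
have := @hits_shift (mirror V) (mirror S) (mirror V') (mirror S') (- d.+1%:Z) 0 d.
rewrite addr0 => E; apply/E => // m; rewrite /block /= => md.
by rewrite addr0 /mirror; case: (H (- m)) => [|-> ->] //; lia.
Qed.

(** Reading a word backwards with all letters negated reflects the block and preserves weights. *)
Lemma rhits_prob (R : realType) (p rho : R) (d : nat) :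
  word_prob p rho d (fun V S => rhits V S d.+1%:Z d)
  = word_prob p rho d (fun V S => hits V S 0 d).
Proof.
rewrite /word_prob -[RHS]expect_opp -[RHS]expect_rev; apply: expect_ext => w [sw _] /=.
congr (_%:R); congr nat_of_bool; apply: asbool_equiv_eq; rewrite rhits_mirror.
set V := word_v (map _ _); set S := word_s (map _ _).
have := @hits_shift (mirror (word_v w)) (mirror (word_s w)) V S (- d.+1%:Z) d.+1%:Z d.
rewrite addNr => E; apply: iff_sym; apply: E => m; rewrite /block /= /V /S => md.
have [x [xd ex]] : exists x : nat, (x < d)%N /\ m = x%:Z - d%:Z by exists (absz (m + d%:Z)); lia.
have -> : m + d.+1%:Z = x.+1%:Z by lia.
have em : - m = (d - x.+1).+1%:Z by lia.
rewrite /mirror em /= (nth_map (0, 0)) ?size_rev ?sw // nth_rev ?sw //.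
Qed.

Lemma shift_shift (a b : nat) (f : int -> int) : shiftz a (shiftz b f) = shiftz (a + b)%N f.
Proof. by apply/funext => n; rewrite /shiftz PoszD addrA. Qed.

Lemma local_and_shift (m k : nat) (E F : (int -> int) -> (int -> int) -> Prop) :
  local m E -> local k F ->
  local (m + k)%N (fun V S => E V S /\ F (shiftz m V) (shiftz m S)).
Proof.
move=> LE LF V S V' S' H [EV FV]; split.
  by apply: LE EV => x xm; apply: H; lia.
by apply: LF FV => x xm; apply: H; lia.
Qed.

Lemma sum_unique (R : realType) (I : finType) (P b : pred I) :
  (forall i j, P i -> P j -> b i -> b j -> i = j) ->
  \sum_(i | P i) (b i)%:R = [exists i, P i && b i]%:R :> R.
Proof.
move=> U; case: existsP => [[i /andP[Pi bi]]|N].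
  rewrite (bigD1 i) //= bi big1 ?addr0 // => j /andP[Pj ji].
  by case: (boolP (b j)) => // bj; rewrite (U i j) ?eqxx in ji.
by rewrite big1 // => i Pi; case: (boolP (b i)) => // bi; case: N; exists i; rewrite Pi.
Qed.

Lemma sum_exclusive4 (R : realType) (B b1 b2 b3 b4 : bool) :
  B = [|| b1, b2, b3 | b4] ->
  ~~ (b1 && b2) -> ~~ (b1 && b3) -> ~~ (b1 && b4) -> ~~ (b2 && b3) ->
  ~~ (b2 && b4) -> ~~ (b3 && b4) ->
  B%:R = b1%:R + b2%:R + b3%:R + b4%:R :> R.
Proof.
by move=> ->; case: b1; case: b2; case: b3; case: b4 => //= *; rewrite ?addr0 ?add0r.
Qed.

(** * Recursions *)

Section indicators.
Variables (R : realType) (V S : int -> int).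
Hypothesis HV : forall n, V n = -1 \/ V n = 0 \/ V n = 1.

Local Notation I E := (`[< E >]%:R : R).

(** The cases exclude each other, and within each the index is unique, so the indicator is a plain
    sum of indicators; taking expectations then needs only linearity. *)
Lemma hits_indicator (n : nat) :
  I (hits V S 0 n.+1) = (n == 0)%:R * I (V 1 = -1)
    + \sum_(i < n.+1) I (V 1 = 0 /\ hits V S 1 i /\ hits V S i.+1%:Z (n - i))
    + (\sum_(l < n.+2) I (crossing V S l /\ hits V S l%:Z (n.+1 - l))
    + \sum_(d < n.+1 | (d.*2 <= n)%N)
        I [/\ blocked V S d d, S d.+1%:Z <> -1 & hits V S d.*2.+1%:Z (n - d.*2)]
    + \sum_(d < n.+1 | (d.*2 < n)%N) I (blocked V S d (n - d))
    + \sum_(d < n.+1 | d.*2 == n) I (blocked V S d d /\ S d.+1%:Z = -1)).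
Proof.
have cross1 l : crossing V S l -> V 1 = 1 by case.
have block1 d d' : blocked V S d d' -> V 1 = 1.
  by case=> hd _ _; case: (reaches_static_inner HV hd).
have asF E : ~ E -> I E = 0 by move=> nE; rewrite asboolF.
case: (HV 1) => [V1|[V1|V1]].
- rewrite (big1 _ (fun=> _)) => [|i _]; last by rewrite asF // V1 => -[].
  rewrite (big1 _ (fun=> _)) => [|l _]; last by rewrite asF // => -[/cross1]; rewrite V1.
  rewrite (big1 _ (fun=> _)) => [|d _]; last by rewrite asF // => -[/block1]; rewrite V1.
  rewrite (big1 _ (fun=> _)) => [|d _]; last by rewrite asF // => /block1; rewrite V1.
  rewrite (big1 _ (fun=> _)) => [|d _]; last by rewrite asF // => -[/block1]; rewrite V1.
  rewrite !addr0 -natrM mulnb; congr (_%:R); congr nat_of_bool.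
  rewrite (asbool_equiv_eq (hits_left S HV n.+1 V1)); apply/asboolP/andP => [[->]|[/eqP -> _]//].
  by split=> //; apply/asboolP.
- rewrite (asF (V 1 = -1)) ?mulr0 ?add0r; last by rewrite V1.
  rewrite [X in _ + X](_ : _ = 0) ?addr0; last first.
    rewrite (big1 _ (fun=> _)) => [|l _]; last by rewrite asF // => -[/cross1]; rewrite V1.
    rewrite (big1 _ (fun=> _)) => [|d _]; last by rewrite asF // => -[/block1]; rewrite V1.
    rewrite (big1 _ (fun=> _)) => [|d _]; last by rewrite asF // => /block1; rewrite V1.
    rewrite (big1 _ (fun=> _)) => [|d _]; last by rewrite asF // => -[/block1]; rewrite V1.
    by rewrite !addr0.
  rewrite sum_unique => [|i j _ _ /asboolP[_ [hi _]] /asboolP[_ [hj _]]]; last first.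
    by apply/val_inj/(hits_inj HV hi hj).
  congr (_%:R); congr nat_of_bool; apply/asboolP/existsP.
    move=> /(hits_static S HV _ V1)[i [j [e hi hj]]].
    have lt : (i < n.+1)%N by case: hj; lia.
    exists (Ordinal lt); apply/asboolP; split=> //; split=> //=.
    by have -> : (n - i)%N = j by lia.
  move=> [i /= /asboolP[_ [hi hj]]]; apply/(hits_static S HV _ V1).
  by exists i, (n - i)%N; split=> //; have := ltn_ord i; lia.
rewrite (asF (V 1 = -1)) ?mulr0 ?add0r; last by rewrite V1.
rewrite (big1 _ (fun=> _)) => [|i _]; last by rewrite asF // V1 => -[].
rewrite add0r.
rewrite sum_unique => [|i j _ _ /asboolP[hi _] /asboolP[hj _]]; last first.
  by apply/val_inj/(crossing_inj HV hi hj).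
rewrite sum_unique => [|i j _ _ /asboolP[hi _ _] /asboolP[hj _ _]]; last first.
  by apply/val_inj; have [] := blocked_inj HV hi hj.
rewrite sum_unique => [|i j _ _ /asboolP hi /asboolP hj]; last first.
  by apply/val_inj; have [] := blocked_inj HV hi hj.
rewrite sum_unique => [|i j _ _ /asboolP[hi _] /asboolP[hj _]]; last first.
  by apply/val_inj; have [] := blocked_inj HV hi hj.
apply: sum_exclusive4.
- apply/asboolP/idP => [/(hits_right S HV _ V1)|].
    case=> [[l [j [e cl hj]]]|[d [j [e b Sm hj]]]|[d [d' [e b dd]]]|[d [e b Sm]]].
    + apply/orP; left; apply/existsP.
      have lt : (l < n.+2)%N by lia.
      exists (Ordinal lt); apply/asboolP; split=> //=.
      by have -> : (n.+1 - l)%N = j by lia.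
    + apply/orP; right; apply/orP; left; apply/existsP.
      have lt : (d < n.+1)%N by lia.
      exists (Ordinal lt); apply/andP; split=> /=; first by lia.
      by apply/asboolP; split=> //=; have -> : (n - d.*2)%N = j by lia.
    + apply/orP; right; apply/orP; right; apply/orP; left; apply/existsP.
      have lt : (d < n.+1)%N by lia.
      exists (Ordinal lt); apply/andP; split=> /=; first by lia.
      by apply/asboolP; have -> : (n - d)%N = d' by lia.
    + apply/orP; right; apply/orP; right; apply/orP; right; apply/existsP.
      have lt : (d < n.+1)%N by lia.
      exists (Ordinal lt); apply/andP; split=> /=; first by lia.
      exact/asboolP.
  move=> H; apply/(hits_right S HV _ V1); case/or4P: H => /existsP[d].
  + move=> /asboolP[cl hj]; constructor 1; exists d, (n.+1 - d)%N; split=> //.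
    by have := ltn_ord d; lia.
  + move=> /andP[dn /asboolP[b Sm hj]]; constructor 2; exists d, (n - d.*2)%N; split=> //; lia.
  + move=> /andP[dn /asboolP b]; constructor 3; exists d, (n - d)%N; split=> //; lia.
  + move=> /andP[dn /asboolP[b Sm]]; constructor 4; exists d; split=> //; lia.
- apply/negP => /andP[/existsP[l /asboolP[cl _]] /existsP[d /andP[_ /asboolP[b _ _]]]].
  exact: crossing_not_blocked cl b.
- apply/negP => /andP[/existsP[l /asboolP[cl _]] /existsP[d /andP[_ /asboolP b]]].
  exact: crossing_not_blocked cl b.
- apply/negP => /andP[/existsP[l /asboolP[cl _]] /existsP[d /andP[_ /asboolP[b _]]]].
  exact: crossing_not_blocked cl b.
- apply/negP => /andP[/existsP[l /andP[_ /asboolP[b' _ _]]] /existsP[d /andP[dn /asboolP b]]].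
  by have := blocked_inj HV b b'; lia.
- apply/negP => /andP[/existsP[l /andP[_ /asboolP[b' Sm _]]] /existsP[d /andP[dn /asboolP[b Sm']]]].
  by apply: Sm; have [-> _] := blocked_inj HV b' b.
- apply/negP => /andP[/existsP[l /andP[ln /asboolP b']] /existsP[d /andP[dn /asboolP[b Sm']]]].
  by have := blocked_inj HV b b'; lia.
Qed.

Lemma second_indicator (n : nat) :
  I (V 1 = 1 /\ hits V S 1 n) = I (crossing V S n.+1)
    + \sum_(d < n.+1) \sum_(d' < n.+1 | (d + d' <= n)%N)
        I (blocked V S d d' /\ hits V S (d.+1 + d')%N%:Z (n - d - d')).
Proof.
rewrite pair_big_dep /=; rewrite sum_unique; last first.
  move=> [i i'] [j j'] /= _ _ /asboolP[b _] /asboolP[b' _].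
  by have [/val_inj -> /val_inj ->] := blocked_inj HV b b'.
have -> : `[< V 1 = 1 /\ hits V S 1 n >] = `[< crossing V S n.+1 >] ||
    [exists x : 'I_n.+1 * 'I_n.+1, (x.1 + x.2 <= n)%N &&
      `[< blocked V S x.1 x.2 /\ hits V S (x.1.+1 + x.2)%N%:Z (n - x.1 - x.2) >]].
  apply/asboolP/orP => [[V1 /(hits_second S HV n V1)]|].
    case=> [cn|[d [d' [d'' [e b h]]]]]; first by left; apply/asboolP.
    have ld : (d < n.+1)%N by lia.
    have ld' : (d' < n.+1)%N by lia.
    right; apply/existsP; exists (Ordinal ld, Ordinal ld') => /=.
    apply/andP; split; first by lia.
    by apply/asboolP; split=> //; have -> : (n - d - d')%N = d'' by lia.
  case=> [/asboolP cn|/existsP[[d d'] /= /andP[dn /asboolP[b h]]]].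
    by have V1 : V 1 = 1 by [case: cn]; split=> //; apply/(hits_second S HV n V1); left.
  have V1 : V 1 = 1 by case: b => hd _ _; case: (reaches_static_inner HV hd).
  split=> //; apply/(hits_second S HV n V1); right; exists d, d', (n - d - d')%N.
  by split=> //; lia.
case: (boolP `[< _ >]) => [/asboolP cn|_]; last by rewrite add0r.
case: existsP => [[[d d'] /= /andP[_ /asboolP[b _]]]|_]; last by rewrite addr0.
by case: (crossing_not_blocked HV cn b).
Qed.

End indicators.

Section recursion.
Variables (R : realType) (p rho : R).
Local Notation Pr := (word_prob p rho).

Definition hits_prob (n : nat) : R := Pr n (fun V S => hits V S 0 n).
Definition crossing_prob (l : nat) : R := Pr l (fun V S => crossing V S l).

Local Notation a := hits_prob.
Local Notation c := crossing_prob.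

Lemma expect_asbool (n : nat) (E F : seq (int * int) -> Prop) :
  (forall w, good_word n w -> E w <-> F w) ->
  expect p rho n (fun w => `[< E w >]%:R) = expect p rho n (fun w => `[< F w >]%:R).
Proof. by move=> EF; apply: expect_ext => w gw; rewrite (propext (EF w gw)). Qed.

Lemma word_prob_letter (f : int -> int -> bool) :
  Pr 1 (fun V S => f (V 1) (S 1)) = \sum_(l <- alphabet) weight p rho l * (f l.1 l.2)%:R.
Proof. by rewrite /word_prob /=; apply: eq_bigr => l _; rewrite asboolb. Qed.

Lemma local_letter (f : int -> int -> bool) : local 1 (fun V S => f (V 1) (S 1)).
Proof. by move=> V S V' S' H; have [//|-> ->] := H 1. Qed.

Lemma prob_static : Pr 1 (fun V S => V 1 == 0) = p.
Proof.
by rewrite (word_prob_letter (fun x _ => x == 0)) /weight /alphabet /= !big_cons big_nil /=; field.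
Qed.

Lemma prob_left : Pr 1 (fun V S => V 1 == -1) = (1 - p) / 2.
Proof.
by rewrite (word_prob_letter (fun x _ => x == -1)) /weight /alphabet /= !big_cons big_nil /=; field.
Qed.

Lemma prob_right : Pr 1 (fun V S => V 1 == 1) = (1 - p) / 2.
Proof.
by rewrite (word_prob_letter (fun x _ => x == 1)) /weight /alphabet /= !big_cons big_nil /=; field.
Qed.

Lemma prob_static_left : Pr 1 (fun V S => (V 1 == 0) && (S 1 == -1)) = rho / 2 * p.
Proof.
rewrite (word_prob_letter (fun x y => (x == 0) && (y == -1))) /weight /alphabet /=.
by rewrite !big_cons big_nil /=; field.
Qed.

Lemma prob_static_neutral :
  Pr 1 (fun V S => [&& V 1 == 0, S 1 != 1 & S 1 != -1]) = (1 - rho) * p.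
Proof.
rewrite (word_prob_letter (fun x y => [&& x == 0, y != 1 & y != -1])) /weight /alphabet /=.
by rewrite !big_cons big_nil /=; field.
Qed.

Lemma prob_static_not_right :
  Pr 1 (fun V S => (V 1 == 0) && (S 1 != 1)) = (1 - rho / 2) * p.
Proof.
rewrite (word_prob_letter (fun x y => (x == 0) && (y != 1))) /weight /alphabet /=.
by rewrite !big_cons big_nil /=; field.
Qed.

Lemma hits_prob0 : a 0 = 0.
Proof. by rewrite /hits_prob /word_prob /= asboolF // => -[]. Qed.

Lemma crossing_prob0 : c 0 = 0.
Proof. by rewrite /crossing_prob /word_prob /= asboolF // => -[]. Qed.

Lemma prob_letter_hits (f : int -> int -> bool) (i : nat) :
  Pr i.+1 (fun V S => f (V 1) (S 1) /\ hits V S 1 i)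
  = Pr 1 (fun V S => f (V 1) (S 1)) * a i.
Proof.
apply: (etrans _ (word_prob_shift p rho (@local_letter f) (@local_hits i))).
by apply: word_prob_ext => w _; rewrite -(hits_shift0 _ _ 1).
Qed.

Lemma prob_static_hits (i j : nat) :
  Pr (i + j).+1 (fun V S => V 1 = 0 /\ hits V S 1 i /\ hits V S i.+1%:Z j) = p * a i * a j.
Proof.
have E1 := word_prob_shift p rho (@local_hits i) (@local_hits j).
have E2 := word_prob_shift p rho (@local_letter (fun x _ => x == 0))
           (local_and_shift (@local_hits i) (@local_hits j)).
apply: (etrans _ (etrans E2 (etrans (congr2 *%R prob_static E1) (mulrA _ _ _)))).
rewrite add1n; apply: word_prob_ext => w _; rewrite !shift_shift.
rewrite -(hits_shift0 _ _ 1) -(hits_shift0 _ _ (i + 1)) addn1.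
by split=> [[/eqP]|[/eqP]].
Qed.

Lemma prob_crossing_hits (l j : nat) :
  Pr (l + j) (fun V S => crossing V S l /\ hits V S l%:Z j) = c l * a j.
Proof.
rewrite -(word_prob_shift _ _ (@local_crossing l) (@local_hits j)).
by apply: word_prob_ext => w _; rewrite -hits_shift0.
Qed.

Lemma prob_reaches_static2 (f : int -> int -> bool) (d d' : nat) :
  Pr (d.+1 + d') (fun V S => [/\ rhits V S d.+1%:Z d, f (V d.+1%:Z) (S d.+1%:Z) &
                                 hits V S d.+1%:Z d'])
  = Pr 1 (fun V S => f (V 1) (S 1)) * a d * a d'.
Proof.
have E1 := word_prob_shift p rho (@local_letter f) (@local_hits d').
have E2 := word_prob_shift p rho (@local_rhits d)
           (local_and_shift (@local_letter f) (@local_hits d')).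
have E3 x : a d * (x * a d') = x * a d * a d' by rewrite mulrCA mulrA.
apply: (etrans _ (etrans E2 (etrans (congr2 *%R (rhits_prob p rho d) E1) (E3 _)))).
have -> : (d.+1 + d')%N = (d + (1 + d'))%N by lia.
apply: word_prob_ext => w _; rewrite !shift_shift add1n -hits_shift0.
rewrite /shiftz; have -> : 1 + d%:Z = d.+1%:Z by lia.
by split=> [[]|[? []]].
Qed.

Lemma local_reaches_static2 (f : int -> int -> bool) (d d' : nat) :
  local (d.+1 + d')%N (fun V S => [/\ rhits V S d.+1%:Z d, f (V d.+1%:Z) (S d.+1%:Z) &
                                      hits V S d.+1%:Z d']).
Proof.
have := local_and_shift (@local_rhits d)
  (local_and_shift (@local_letter f) (@local_hits d')).
rewrite addnA addn1 => L V S V' S' H [h1 h2 h3].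
have e x : shiftz d x 1 = x d.+1%:Z :> int by rewrite /shiftz; congr x; lia.
have := L V S V' S' H; rewrite !shift_shift !add1n -!hits_shift0 !e.
by case=> // h1' [].
Qed.

Lemma local_reaches_static1 (f : int -> int -> bool) (d : nat) :
  local d.+1 (fun V S => rhits V S d.+1%:Z d /\ f (V d.+1%:Z) (S d.+1%:Z)).
Proof.
have := local_and_shift (@local_rhits d) (@local_letter f).
rewrite addn1 => L V S V' S' H [h1 h2].
have e x : shiftz d x 1 = x d.+1%:Z :> int by rewrite /shiftz; congr x; lia.
by have := L V S V' S' H; rewrite !e; apply.
Qed.

Lemma prob_reaches_static1 (f : int -> int -> bool) (d : nat) :
  Pr d.+1 (fun V S => rhits V S d.+1%:Z d /\ f (V d.+1%:Z) (S d.+1%:Z))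
  = Pr 1 (fun V S => f (V 1) (S 1)) * a d.
Proof.
have E2 := word_prob_shift p rho (@local_rhits d) (@local_letter f).
apply: (etrans _ (etrans E2 (etrans (congr2 *%R (rhits_prob p rho d) erefl) (mulrC _ _)))).
rewrite addn1; apply: word_prob_ext => w _.
by rewrite /shiftz; have -> : 1 + d%:Z = d.+1%:Z by lia.
Qed.

Lemma prob_reaches_static3 (f : int -> int -> bool) (d d' j : nat) :
  Pr (d.+1 + d' + j) (fun V S =>
     [/\ rhits V S d.+1%:Z d, f (V d.+1%:Z) (S d.+1%:Z), hits V S d.+1%:Z d' &
         hits V S (d.+1 + d')%N%:Z j])
  = Pr 1 (fun V S => f (V 1) (S 1)) * a d * a d' * a j.
Proof.
have L := @local_reaches_static2 f d d'.
have E := word_prob_shift p rho L (@local_hits j).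
apply: (etrans _ (etrans E (congr2 *%R (prob_reaches_static2 f d d') erefl))).
apply: word_prob_ext => w _; rewrite -hits_shift0.
by split=> [[]|[[]]].
Qed.

Lemma hits_prob_rec (n : nat) :
  a n.+1 = (n == 0)%:R * ((1 - p) / 2) + \sum_(i < n.+1) p * a i * a (n - i)
    + (\sum_(l < n.+2) c l * a (n.+1 - l)
    + \sum_(d < n.+1 | (d.*2 <= n)%N) (1 - rho) * p * a d * a d * a (n - d.*2)
    + \sum_(d < n.+1 | (d.*2 < n)%N) p * a d * a (n - d)
    + \sum_(d < n.+1 | d.*2 == n) rho / 2 * p * a d * a d).
Proof.
rewrite {1}/hits_prob /word_prob.
rewrite (expect_ext _ _ (G := fun w =>
  (n == 0)%:R * `[< word_v w 1 = -1 >]%:R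
    + \sum_(i < n.+1) `[< word_v w 1 = 0 /\ hits (word_v w) (word_s w) 1 i /\
         hits (word_v w) (word_s w) i.+1%:Z (n - i) >]%:R
    + (\sum_(l < n.+2) `[< crossing (word_v w) (word_s w) l /\
         hits (word_v w) (word_s w) l%:Z (n.+1 - l) >]%:R
    + \sum_(d < n.+1 | (d.*2 <= n)%N)
        `[< [/\ blocked (word_v w) (word_s w) d d, word_s w d.+1%:Z <> -1 &
            hits (word_v w) (word_s w) d.*2.+1%:Z (n - d.*2)] >]%:R
    + \sum_(d < n.+1 | (d.*2 < n)%N) `[< blocked (word_v w) (word_s w) d (n - d) >]%:R
    + \sum_(d < n.+1 | d.*2 == n)
        `[< blocked (word_v w) (word_s w) d d /\ word_s w d.+1%:Z = -1 >]%:R))); last first.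
  by move=> w gw; apply: hits_indicator; apply: word_velocities gw.
rewrite !expectD expectZ !expect_sum; congr (_ + _ + (_ + _ + _ + _)).
- case: n => [|n]; last by rewrite !mul0r.
  rewrite !mul1r -prob_left; apply: expect_ext => w _.
  by congr (_%:R); congr nat_of_bool; apply: asbool_equiv_eq; split=> /eqP.
- apply: eq_bigr => i _; rewrite -prob_static_hits; have := ltn_ord i => ltin.
  by have -> : (i + (n - i)).+1 = n.+1 by lia.
- apply: eq_bigr => l _; rewrite -prob_crossing_hits; have := ltn_ord l => ltln.
  by have -> : (l + (n.+1 - l))%N = n.+1 by lia.
- apply: eq_bigr => d dn; rewrite -prob_static_neutral.
  rewrite -(prob_reaches_static3 (fun x y => [&& x == 0, y != 1 & y != -1])).
  have -> : (d.+1 + d + (n - d.*2))%N = n.+1 by lia.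
  rewrite /word_prob; apply: expect_asbool => w _; have -> : (d.+1 + d)%N = d.*2.+1 by lia.
  split=> [[[[hd Vd] h [lt|[_ Sd]]] Sm hj]|[hd /and3P[/eqP Vd /eqP Sd /eqP Sm] h hj]].
  + by rewrite ltnn in lt.
  + by split=> //; apply/and3P; split=> //; apply/eqP.
  + by split=> //; split=> //; right.
- apply: eq_bigr => d dn.
  have E := prob_reaches_static2 (fun x _ => x == 0) d (n - d).
  rewrite prob_static in E; rewrite -E {E}.
  have -> : (d.+1 + (n - d))%N = n.+1 by lia.
  rewrite /word_prob; apply: expect_asbool => w _.
  split=> [[[hd Vd] h _]|[hd /eqP Vd h]]; split=> //; first exact/eqP.
  by left; lia.
- apply: eq_bigr => d dn; rewrite -prob_static_left.
  rewrite -(prob_reaches_static2 (fun x y => (x == 0) && (y == -1))).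
  have -> : (d.+1 + d)%N = n.+1 by lia.
  rewrite /word_prob; apply: expect_asbool => w _.
  split=> [[[[hd Vd] h _] Sm]|[hd /andP[/eqP Vd /eqP Sm] h]].
    by split=> //; apply/andP; split; apply/eqP.
  by split=> //; split=> //; right; split=> //; rewrite Sm.
Qed.

(** The conditional probability that a static particle whose first visitors come from distances [d]
    and [d'] stops particle 1: in a tie, its sign must differ from 1. *)
Definition block_weight (d d' : nat) : R :=
  if (d < d')%N then 1 else if d == d' then 1 - rho / 2 else 0.

Lemma crossing_prob_rec (n : nat) :
  (1 - p) / 2 * a n = c n.+1 + \sum_(d < n.+1) \sum_(d' < n.+1 | (d + d' <= n)%N)
     block_weight d d' * p * a d * a d' * a (n - d - d').
Proof.
rewrite -prob_right -(prob_letter_hits (fun x _ => x == 1)) /word_prob.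
rewrite (expect_ext _ _ (G := fun w => `[< crossing (word_v w) (word_s w) n.+1 >]%:R
    + \sum_(d < n.+1) \sum_(d' < n.+1 | (d + d' <= n)%N)
        `[< blocked (word_v w) (word_s w) d d' /\
            hits (word_v w) (word_s w) (d.+1 + d')%N%:Z (n - d - d') >]%:R)); last first.
  move=> w gw; rewrite -second_indicator; last exact: word_velocities gw.
  by congr (_%:R); congr nat_of_bool; apply: asbool_equiv_eq; split=> -[/eqP].
rewrite expectD expect_sum; congr (_ + _); apply: eq_bigr => d _.
rewrite expect_sum; apply: eq_bigr => d' dn; rewrite /block_weight.
have en : (d.+1 + d' + (n - d - d'))%N = n.+1 by lia.
case: ltngtP => dd.
- have E := prob_reaches_static3 (fun x _ => x == 0) d d' (n - d - d').
  rewrite prob_static in E; rewrite mul1r -E {E} en.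
  rewrite /word_prob; apply: expect_asbool => w _.
  split=> [[[[hd Vd] h _] hj]|[hd /eqP Vd h hj]]; first by split=> //; exact/eqP.
  by split=> //; split=> //; left.
- rewrite !mul0r -[RHS](expect0 p rho n.+1); apply: expect_ext => w _.
  by rewrite asboolF // => -[[_ _ []]]; lia.
- rewrite -prob_static_not_right.
  rewrite -(prob_reaches_static3 (fun x y => (x == 0) && (y != 1))) en.
  rewrite /word_prob; apply: expect_asbool => w _.
  split=> [[[[hd Vd] h dd'] hj]|[hd /andP[/eqP Vd /eqP Sd] h hj]].
    split=> //; apply/andP; split; first exact/eqP.
    by case: dd' => [|[_ /eqP//]]; lia.
  by split=> //; split=> //; right.
Qed.

End recursion.

(** * Measurability and the law of finite blocks *)

Section real_probability.
Context (d : measure_display) (T : measurableType d) (R : realType) (P : probability T R).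
Local Open Scope classical_set_scope.

Definition pr (A : set T) : R := fine (P A).

Lemma prE (A : set T) : measurable A -> P A = (pr A)%:E.
Proof. by move=> mA; rewrite /pr fineK // fin_num_measure. Qed.

Lemma pr_ge0 (A : set T) : 0 <= pr A.
Proof. exact/fine_ge0. Qed.

Lemma prT : pr setT = 1.
Proof. by rewrite /pr probability_setT. Qed.

Lemma pr0 : pr set0 = 0.
Proof. by rewrite /pr measure0. Qed.

Lemma prU (A B : set T) : measurable A -> measurable B -> A `&` B = set0 ->
  pr (A `|` B) = pr A + pr B.
Proof.
move=> mA mB AB; apply: EFin_inj.
by rewrite EFinD -!prE ?measureU //; apply: measurableU.
Qed.

Lemma pr_setID (A B : set T) : measurable A -> measurable B ->
  pr A = pr (A `&` B) + pr (A `&` ~` B).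
Proof.
move=> mA mB; rewrite -prU.
- by rewrite -setIUr setUCr setIT.
- exact: measurableI.
- by apply: measurableI => //; apply: measurableC.
- by rewrite setIACA setICr setI0.
Qed.

Lemma le_pr (A B : set T) : measurable A -> measurable B -> A `<=` B -> pr A <= pr B.
Proof.
move=> mA mB AB; rewrite (pr_setID mB mA).
have -> : B `&` A = A by rewrite setIC; apply/setIidPl.
by rewrite lerDl pr_ge0.
Qed.

Lemma pr_null (A B : set T) : measurable A -> measurable B -> pr B = 1 ->
  pr (A `&` ~` B) = 0.
Proof.
move=> mA mB B1; have mC := measurableC mB.
apply/eqP; rewrite eq_le pr_ge0 andbT.
apply: (@le_trans _ _ (pr (~` B))); first by apply: le_pr => //; exact: measurableI.
by have := pr_setID measurableT mB; rewrite prT !setTI B1; lra.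
Qed.

Lemma pr_almost (A B : set T) : measurable A -> measurable B -> pr B = 1 ->
  pr A = pr (A `&` B).
Proof. by move=> mA mB B1; rewrite (pr_setID mA mB) (pr_null mA mB B1) addr0. Qed.

Lemma pr_bigsetU (I : eqType) (r : seq I) (B : I -> set T) :
  (forall i, measurable (B i)) -> uniq r -> (forall i j, i != j -> B i `&` B j = set0) ->
  pr (\big[setU/set0]_(i <- r) B i) = \sum_(i <- r) pr (B i).
Proof.
move=> mB + H; elim: r => [|i r IH]; first by rewrite !big_nil pr0.
move=> /= /andP[ir ur]; rewrite !big_cons prU ?IH //.
  by apply: bigsetU_measurable.
rewrite big_distrr big_seq big1 // => j jr /=.
by apply: H; apply: contraNneq ir => ->.
Qed.

Lemma pr_partition (I : eqType) (r : seq I) (A : set T) (B : I -> set T) :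
  measurable A -> (forall i, measurable (B i)) -> uniq r ->
  (forall i j, i != j -> B i `&` B j = set0) ->
  \sum_(i <- r) pr (B i) = 1 -> pr A = \sum_(i <- r) pr (A `&` B i).
Proof.
move=> mA mB ur H; rewrite -pr_bigsetU // => /(pr_almost mA) ->; last first.
  by apply: bigsetU_measurable.
rewrite big_distrr pr_bigsetU //=; first by move=> i; apply: measurableI.
by move=> i j ij; rewrite setIACA H // setI0.
Qed.

Lemma pr_bigcup_cvg (F : nat -> set T) : (forall i, measurable (F i)) -> trivIset setT F ->
  (fun n => \sum_(0 <= i < n) pr (F i)) @ \oo --> pr (\bigcup_n F n).
Proof.
move=> mF tF; have mU : measurable (\bigcup_n F n) by apply: bigcupT_measurable.
have H : (fun n => (\sum_(0 <= i < n) P (F i))%E) @ \oo --> P (\bigcup_n F n).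
  exact: measure_semi_sigma_additive.
rewrite (prE mU) in H; move/fine_cvgP: H => [_].
apply: cvg_trans; apply: near_eq_cvg; near=> n => /=.
under eq_bigr => i _ do rewrite prE //.
by rewrite sumEFin.
Unshelve. all: by end_near.
Qed.

End real_probability.

(** * Measurability of the events of the dynamics *)

Section measurability.
Context (d : measure_display) (T : measurableType d).

Definition event (E : T -> Prop) := measurable [set w | E w]%classic.

Lemma event_and (E F : T -> Prop) : event E -> event F -> event (fun w => E w /\ F w).
Proof. exact: measurableI. Qed.

Lemma event_or (E F : T -> Prop) : event E -> event F -> event (fun w => E w \/ F w).
Proof. exact: measurableU. Qed.

Lemma event_not (E : T -> Prop) : event E -> event (fun w => ~ E w).
Proof. exact: measurableC. Qed.

Lemma event_const (E : Prop) : event (fun=> E).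
Proof.
have [e|e] := pselect E.
  by have -> : (fun=> E) = (fun=> True) :> (T -> Prop) by [apply/funext => w; apply/propext]; exact: measurableT.
by have -> : (fun=> E) = (fun=> False) :> (T -> Prop) by [apply/funext => w; apply/propext]; exact: measurable0.
Qed.

Lemma event_ext (E F : T -> Prop) : (forall w, E w <-> F w) -> event E -> event F.
Proof. by move=> EF; have -> : E = F by apply/funext => w; apply/propext. Qed.

Lemma event_exists (I : countType) (E : I -> T -> Prop) :
  (forall i, event (E i)) -> event (fun w => exists i, E i w).
Proof.
move=> mE; have := @countable_bigcupT_measurable _ T I (fun i => [set w | E i w]%classic).
move=> /(_ (countableP _) mE); apply: event_ext => w.
by split=> [[i _ Ei]|[i Ei]]; exists i.
Qed.

Lemma event_forall (I : countType) (E : I -> T -> Prop) :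
  (forall i, event (E i)) -> event (fun w => forall i, E i w).
Proof.
move=> mE; have := event_not (event_exists (fun i => event_not (mE i))).
apply: event_ext => w; split=> [H i|H [i]]; last by apply; apply: H.
by apply: contrapT => nE; apply: H; exists i.
Qed.

Lemma event_imply (E : Prop) (F : T -> Prop) : (E -> event F) -> event (fun w => E -> F w).
Proof.
move=> H; have [e|e] := pselect E.
  by apply: event_ext (H e) => w; split=> // /(_ e).
by apply: (event_ext _ (event_const True)) => w; split=> // _ /e.
Qed.

Variables (v s : int -> {mfun T >-> int}).

(** Any predicate is allowed because [int] carries the discrete sigma-algebra. *)
Lemma event_value (f : {mfun T >-> int}) (A : int -> Prop) : event (fun w => A (f w)).
Proof. exact: (@measurable_funPTI _ _ _ _ f [set x | A x]%classic). Qed.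

Lemma event_value2 (f g : {mfun T >-> int}) (A : int -> int -> Prop) :
  event (fun w => A (f w) (g w)).
Proof.
have : event (fun w => exists x, f w = x /\ A x (g w)).
  apply: event_exists => x; apply: event_and; first exact: (event_value f (fun y => y = x)).
  exact: event_value.
by apply: event_ext => w; split=> [[x [-> //]]|]; exists (f w).
Qed.

Definition measurable_family (A : T -> set int) := forall n, event (fun w => A w n).

Lemma event_met (A : T -> set int) (k : nat) (n m : int) : measurable_family A ->
  event (fun w => met (v ^~ w) (A w) k n m).
Proof.
move=> mA; rewrite /met /=.
apply: (@event_ext (fun w => A w m /\ (m != n /\
    position2 (v ^~ w) k m = position2 (v ^~ w) k n))).
  by move=> w; split=> [[? []]|[]].
apply: event_and; first exact: mA.
apply: event_and; first exact: event_const.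
exact: (event_value2 (v m) (v n) (fun x y => 2 * m + x * k%:Z = 2 * n + y * k%:Z)).
Qed.

Lemma event_survives (A : T -> set int) (k : nat) (n : int) : measurable_family A ->
  event (fun w => survives (v ^~ w) (s ^~ w) (A w) k n).
Proof.
move=> mA; apply: event_or.
  have := event_not (event_exists (fun m => event_met k n m mA)).
  apply: event_ext => w; split=> [H|-> [m]//].
  by apply/seteqP; split=> m // Hm; apply: H; exists m.
apply: event_exists => i; apply: event_exists => j.
apply: (@event_ext (fun w => met (v ^~ w) (A w) k n i /\ (v i w = 0 /\
   (met (v ^~ w) (A w) k n j /\ (v j w = - v n w /\
   (v n w = 1 /\ s i w = 1 \/ v n w = -1 /\ s i w = -1)))))).
  by move=> w; split=> [[? [? [? []]]]|[]].
apply: event_and; first exact: event_met.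
apply: event_and; first exact: (event_value (v i) (fun x => x = 0)).
apply: event_and; first exact: event_met.
apply: event_and; first exact: (event_value2 (v j) (v n) (fun x y => x = - y)).
exact: (event_value2 (v n) (s i) (fun x y => x = 1 /\ y = 1 \/ x = -1 /\ y = -1)).
Qed.

Lemma event_alive (D : set int) (k : nat) (n : int) :
  event (fun w => alive D (v ^~ w) (s ^~ w) k n).
Proof.
elim: k n => [|k IH] n; first exact: event_const.
apply: event_and; first exact: IH.
exact: event_survives.
Qed.

Lemma event_reaches0 (D : set int) :
  event (fun w => reaches0 (v ^~ w) (alive D (v ^~ w) (s ^~ w))).
Proof.
apply: event_exists => n; apply: event_exists => k.
apply: (@event_ext (fun w => v n w = -1 /\ (position2 (v ^~ w) k n = 0 /\
   alive D (v ^~ w) (s ^~ w) k n))).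
  by move=> w; split=> [[? []]|[]].
apply: event_and; first exact: (event_value (v n) (fun x => x = -1)).
apply: event_and; last exact: event_alive.
exact: (event_value (v n) (fun x => 2 * n + x * k%:Z = 0)).
Qed.

Lemma event_hits (a : int) (n : nat) :
  event (fun w => hits (v ^~ w) (s ^~ w) a n).
Proof.
apply: (@event_ext (fun w => (0 < n)%N /\ (v (a + n%:Z) w = -1 /\
   (alive (block a n) (v ^~ w) (s ^~ w) n.*2.-1 (a + n%:Z) /\
    stays_right (v ^~ w) (s ^~ w) (block a n) a n.*2.-1)))).
  by move=> w; split=> [[? [? []]]|[]].
apply: event_and; first exact: event_const.
apply: event_and; first exact: (event_value _ (fun x => x = -1)).
apply: event_and; first exact: event_alive.
apply: event_forall => j; apply: event_forall => m; apply: event_imply => _.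
apply: (@event_ext (fun w => ~ alive (block a n) (v ^~ w) (s ^~ w) j m \/
   2 * a < position2 (v ^~ w) j.+1 m)).
  move=> w; split=> [[//|//]|H].
  by have [?|?] := pselect (alive (block a n) (v ^~ w) (s ^~ w) j m); [right; apply: H|left].
apply: event_or; first by apply: event_not; exact: event_alive.
exact: (event_value (v m) (fun x => 2 * a < 2 * m + x * j.+1%:Z)).
Qed.

Lemma event_rhits (i : int) (n : nat) :
  event (fun w => rhits (v ^~ w) (s ^~ w) i n).
Proof.
apply: (@event_ext (fun w => (0 < n)%N /\ (v (i - n%:Z) w = 1 /\
   (alive (rblock i n) (v ^~ w) (s ^~ w) n.*2.-1 (i - n%:Z) /\
    stays_left (v ^~ w) (s ^~ w) (rblock i n) i n.*2.-1)))).
  by move=> w; split=> [[? [? []]]|[]].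
apply: event_and; first exact: event_const.
apply: event_and; first exact: (event_value _ (fun x => x = 1)).
apply: event_and; first exact: event_alive.
apply: event_forall => j; apply: event_forall => m; apply: event_imply => _.
apply: (@event_ext (fun w => ~ alive (rblock i n) (v ^~ w) (s ^~ w) j m \/
   position2 (v ^~ w) j.+1 m < 2 * i)).
  move=> w; split=> [[//|//]|H].
  by have [?|?] := pselect (alive (rblock i n) (v ^~ w) (s ^~ w) j m); [right; apply: H|left].
apply: event_or; first by apply: event_not; exact: event_alive.
exact: (event_value (v m) (fun x => 2 * m + x * j.+1%:Z < 2 * i)).
Qed.

End measurability.

(** * From finite words to the probability space *)

Definition shifti (a : int) (f : int -> int) (n : int) : int := f (n + a).

Section link.
Context (d : measure_display) (T : measurableType d) (R : realType) (P : probability T R).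
Variables (v s : int -> {mfun T >-> int}) (p rho : R).
Local Open Scope classical_set_scope.

(* The letters of [u] are read at the indices [a + 1], [a + 2], ... *)
Definition cylinder (a : int) (u : seq (int * int)) : set T :=
  [set w | forall i, (i < size u)%N ->
     v (i.+1%:Z + a) w = (nth (0, 0) u i).1 /\ s (i.+1%:Z + a) w = (nth (0, 0) u i).2].

(** The form in which the law is used from here on. It holds with [rho = 1] for the given signs, and
    with [rho = 0] for signs identically 0. *)
Definition word_law := forall a u, all [in alphabet] u ->
  P (cylinder a u) = (\prod_(l <- u) weight p rho l)%:E.

Hypothesis law : word_law.

Local Notation pr := (pr P).
Local Notation Pr := (word_prob p rho).

Lemma measurable_cylinder (a : int) (u : seq (int * int)) : measurable (cylinder a u).
Proof.
apply: event_forall => i; apply: event_imply => _; apply: event_and.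
  exact: (event_value _ (fun x => x = _)).
exact: (event_value _ (fun x => x = _)).
Qed.

Lemma pr_cylinder (a : int) (u : seq (int * int)) : all [in alphabet] u ->
  pr (cylinder a u) = \prod_(l <- u) weight p rho l.
Proof. by move=> au; rewrite /pr law. Qed.

Lemma cylinder_letter_disjoint (a : int) (l l' : int * int) : l != l' ->
  cylinder a [:: l] `&` cylinder a [:: l'] = set0.
Proof.
move=> ll; apply/seteqP; split=> // w [/(_ 0%N isT) /= [v1 s1] /(_ 0%N isT) /= [v2 s2]].
by case/eqP: ll; rewrite [l]surjective_pairing [l']surjective_pairing -v1 -v2 -s1 -s2.
Qed.

Lemma pr_letters (a : int) (A : set T) : measurable A ->
  pr A = \sum_(l <- alphabet) pr (A `&` cylinder a [:: l]).
Proof.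
move=> mA; apply: pr_partition => //.
- by move=> l; apply: measurable_cylinder.
- by move=> l l'; apply: cylinder_letter_disjoint.
rewrite -[RHS](weight_sum p rho); apply: eq_big_seq => l lA.
by rewrite pr_cylinder ?big_seq1 //= lA.
Qed.

Lemma cylinder_rcons (a : int) (u : seq (int * int)) (l : int * int) :
  cylinder a (rcons u l) = cylinder a u `&` cylinder ((size u)%:Z + a) [:: l].
Proof.
apply/seteqP; split=> w.
  move=> H; split=> i iu.
    by have := H i; rewrite size_rcons nth_rcons iu => /(_ (ltnW iu)).
  have := H (size u); rewrite size_rcons nth_rcons ltnn eqxx ltnSn => /(_ isT).
  by case: i iu => // _; have -> : (size u).+1%:Z + a = 1 + ((size u)%:Z + a) by lia.
move=> [H1 H2] i; rewrite size_rcons ltnS leq_eqVlt => /orP[/eqP ->|iu].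
  have := H2 0%N isT; rewrite nth_rcons ltnn eqxx /=.
  by have -> : (size u).+1%:Z + a = 1 + ((size u)%:Z + a) by lia.
by rewrite nth_rcons iu; apply: H1.
Qed.

Lemma pr_local (a : int) (n : nat) (E : (int -> int) -> (int -> int) -> Prop) :
  local n E -> event (fun w => E (shifti a (v ^~ w)) (shifti a (s ^~ w))) ->
  pr [set w | E (shifti a (v ^~ w)) (shifti a (s ^~ w))] = Pr n E.
Proof.
move=> LE mA; set A := [set w | _].
(* Induction on the number [k] of letters still unread; once all [n] are read, [E] is constant on
   the cylinder. *)
have main (k : nat) (u : seq (int * int)) : all [in alphabet] u -> (size u + k)%N = n ->
    pr (A `&` cylinder a u) = \prod_(l <- u) weight p rho l *
      expect p rho k (fun w => `[< E (word_v (u ++ w)) (word_s (u ++ w)) >]%:R).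
  elim: k u => [|k IH] u au su /=.
    rewrite cats0 addn0 in su *; rewrite -(pr_cylinder a au).
    have Eu w : cylinder a u w ->
        E (shifti a (v ^~ w)) (shifti a (s ^~ w)) <-> E (word_v u) (word_s u).
      move=> cw; apply: local_iff LE _ => -[[|i]|i] // im; rewrite /shifti.
      by have [] := cw i; [move: im; rewrite su | move=> -> ->].
    case: (asboolP (E _ _)) => Ev; rewrite ?mulr1 ?mulr0.
      by congr pr; apply/setIidPr => w cw; apply/(Eu w cw).
    have -> : A `&` cylinder a u = set0; last exact: pr0.
    by apply/seteqP; split=> // w [Aw cw]; apply/Ev/(Eu w cw).
  have mC := measurable_cylinder a u.
  rewrite (pr_letters ((size u)%:Z + a)); last exact: measurableI.
  rewrite big_distrr /=; apply: eq_big_seq => l lA.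
  rewrite -setIA -cylinder_rcons IH.
  - rewrite -cats1 big_cat big_seq1 /= -mulrA; congr (_ * (_ * _)).
    by apply: expect_ext => w _; rewrite -catA.
  - by rewrite all_rcons au andbT.
  - by rewrite size_rcons; lia.
apply: etrans (etrans (main n [::] isT erefl) _); last by rewrite big_nil mul1r.
congr pr.
by apply/seteqP; split=> [w Aw|w []//]; split=> // i.
Qed.

Lemma pr_event (a : int) (n : nat) (E : (int -> int) -> (int -> int) -> Prop)
    (F : T -> Prop) : local n E ->
  (forall w, F w <-> E (shifti a (v ^~ w)) (shifti a (s ^~ w))) -> event F ->
  pr [set w | F w] = Pr n E.
Proof.
move=> LE FE mF; rewrite -(pr_local LE (event_ext FE mF)); congr pr.
by apply/seteqP; split=> w /FE.
Qed.

(** The law prescribes the velocities only almost surely, while the deterministic lemmas want them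
    in {-1, 0, 1} at every index. Events are therefore intersected with this set of probability
    1. *)
Definition good_config : set T :=
  [set w | forall n, v n w = -1 \/ v n w = 0 \/ v n w = 1].

Lemma measurable_good : measurable good_config.
Proof.
by apply: event_forall => n; apply: (event_value _ (fun x => x = -1 \/ x = 0 \/ x = 1)).
Qed.

Lemma pr_good : pr good_config = 1.
Proof.
pose B (n : int) : set T := [set w | v n w = -1 \/ v n w = 0 \/ v n w = 1].
have mB n : measurable (B n).
  exact: (event_value _ (fun x => x = -1 \/ x = 0 \/ x = 1)).
have B1 n : pr (B n) = 1.
  have := @pr_local (n - 1) 1 (fun V _ => V 1 = -1 \/ V 1 = 0 \/ V 1 = 1).
  rewrite /shifti; have -> : 1 + (n - 1) = n by lia.
  move=> ->; last 2 first.
  - by move=> V S V' S' H; have [//|-> _] := H 1.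
  - exact: mB.
  rewrite -[RHS](expect1 p rho 1); apply: expect_ext => w gw.
  by rewrite asboolT //; exact: (word_velocities gw).
have N : P.-negligible (\bigcup_k (if unpickle k is Some n then ~` B n else set0)).
  apply: negligible_bigcup => k; case: unpickle => [n|]; last exact: negligible_set0.
  apply/negligibleP; first exact: measurableC.
  have : P (~` B n) = 0%E; last by [].
  rewrite (prE P); last exact: measurableC.
  by rewrite -(setTI (~` B n)) pr_null.
have : P (~` good_config) = 0%E.
  apply: measure_negligible; first exact/measurableC/measurable_good.
  apply: negligibleS N => w /existsNP[n nB].
  by exists (pickle n); rewrite // pickleK.
move=> H; have := pr_setID P measurableT measurable_good.
by rewrite prT !setTI /pr H /= addr0.
Qed.

Lemma trivIset_hits (A : set T) :
  trivIset setT (fun n => A `&` [set w | hits (v ^~ w) (s ^~ w) 0 n] `&` good_config).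
Proof. by move=> i j _ _ [w [[[_ hi] g] [[_ hj] _]]]; apply: (hits_inj g hi hj). Qed.

Lemma trivIset_rhits (A : set T) :
  trivIset setT (fun n => A `&` [set w | rhits (v ^~ w) (s ^~ w) 0 n] `&` good_config).
Proof.
move=> i j _ _ [w [[[_ /rhits_mirror hi] g] [[_ /rhits_mirror hj] _]]].
exact: (hits_inj (mirror_velocities g) hi hj).
Qed.

Lemma pr_exists_cvg (A : set T) (H : nat -> T -> Prop) : measurable A ->
  (forall n, event (H n)) ->
  trivIset setT (fun n => A `&` [set w | H n w] `&` good_config) ->
  (fun n => \sum_(0 <= i < n) pr (A `&` [set w | H i w])) @ \oo -->
     pr (A `&` [set w | exists n, H n w]).
Proof.
move=> mA mH tH; have mG := measurable_good.
have mF i : measurable (A `&` [set w | H i w] `&` good_config).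
  by apply: measurableI => //; apply: measurableI => //; exact: mH.
have := pr_bigcup_cvg (P := P) mF tH.
have -> : \bigcup_n (A `&` [set w | H n w] `&` good_config) =
    A `&` [set w | exists n, H n w] `&` good_config.
  by apply/seteqP; split=> w; [move=> [n _ [[? ?] ?]] | move=> [[? [n ?]] ?]; exists n];
    split=> //; split=> //; exists n.
rewrite -(pr_almost _ mG pr_good); last by apply: measurableI => //; apply: event_exists.
apply: cvg_trans; apply: near_eq_cvg; near=> n; apply: eq_bigr => i _.
apply/esym/pr_almost => //; last exact: pr_good.
by apply: measurableI => //; exact: mH.
Unshelve. all: by end_near.
Qed.

Local Notation a := (hits_prob p rho).

Lemma shifti0 (f : int -> int) : shifti 0 f = f.
Proof. by apply/funext => n; rewrite /shifti addr0. Qed.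

Lemma pr_hits (n : nat) : pr [set w | hits (v ^~ w) (s ^~ w) 0 n] = a n.
Proof.
apply: (@pr_event 0 n _ _ (@local_hits n)); last exact: event_hits.
by move=> w; rewrite !shifti0.
Qed.

Definition reach_prob : R := pr [set w | reaches0 (v ^~ w) (alive half_line (v ^~ w) (s ^~ w))].

Lemma reach_prob_cvg : (fun n => \sum_(0 <= i < n) a i) @ \oo --> reach_prob.
Proof.
have := pr_exists_cvg measurableT (event_hits v s 0) (@trivIset_hits setT).
rewrite !setTI; have -> : pr [set w | exists n, hits (v ^~ w) (s ^~ w) 0 n] = reach_prob.
  rewrite (pr_almost _ measurable_good pr_good); last first.
    by apply: event_exists => n; exact: event_hits.
  rewrite /reach_prob [RHS](pr_almost _ measurable_good pr_good); last first.
    exact: event_reaches0.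
  by congr pr; apply/seteqP; split=> w [? g]; split=> //; apply/(reaches0E _ g).
by under eq_fun do under eq_bigr do rewrite setTI pr_hits.
Qed.

Lemma pr_static : pr [set w | v 0 w = 0] = p.
Proof.
rewrite -[RHS](prob_static p rho).
apply: (@pr_event (-1) 1 (fun V _ => V 1 == 0) _ (@local_letter (fun x _ => x == 0))).
  by move=> w; rewrite /shifti; split=> /eqP.
exact: (event_value (v 0) (fun x => x = 0)).
Qed.

Lemma shifti_hits (b i : int) (V S : int -> int) (n : nat) :
  hits (shifti b V) (shifti b S) i n = hits V S (i + b) n.
Proof.
by apply/propext; apply: iff_sym; apply: hits_shift => m _; rewrite /shifti.
Qed.

Lemma shifti_rhits (b i : int) (V S : int -> int) (n : nat) :
  rhits (shifti b V) (shifti b S) i n = rhits V S (i + b) n.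
Proof.
have := @hits_shift (mirror (shifti b V)) (mirror (shifti b S)) (mirror V) (mirror S)
  (- i) (- b) n.
have -> : - i - b = - (i + b) by lia.
move=> H; apply/propext; rewrite !rhits_mirror; apply: iff_sym; apply: H => m _.
by rewrite /mirror /shifti; have -> : - (m - b) = - m + b by lia.
Qed.

Lemma pr_static_hits (n : nat) :
  pr ([set w | v 0 w = 0] `&` [set w | hits (v ^~ w) (s ^~ w) 0 n]) = p * a n.
Proof.
rewrite -{1}(prob_static p rho) -(prob_letter_hits p rho (fun x _ => x == 0)).
have L : local n.+1 (fun V S => V 1 == 0 /\ hits V S 1 n).
  move=> V S V' S' H [V1 h]; split; first by have [|<- _] := H 1; lia.
  apply: (iffRL (hits_shift0 V' S' 1 n)).
  apply: (@local_hits n _ _ _ _ _ (iffLR (hits_shift0 V S 1 n) h)).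
  by move=> m mn; apply: H; lia.
apply: (@pr_event (-1) n.+1 _ _ L).
  move=> w; rewrite shifti_hits /shifti subrr.
  by split=> -[/eqP].
apply: event_and; last exact: event_hits.
exact: (event_value (v 0) (fun x => x = 0)).
Qed.

Lemma pr_static_rhits (m : nat) :
  pr ([set w | v 0 w = 0] `&` [set w | rhits (v ^~ w) (s ^~ w) 0 m]) = p * a m.
Proof.
have := prob_reaches_static1 p rho (fun x _ => x == 0) m.
rewrite prob_static => <-.
apply: (@pr_event (- m.+1%:Z) m.+1 _ _ (@local_reaches_static1 (fun x _ => x == 0) m)).
  by move=> w; rewrite shifti_rhits /shifti subrr; split=> [[/eqP]|[? /eqP]].
apply: event_and; last exact: event_rhits.
exact: (event_value (v 0) (fun x => x = 0)).
Qed.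

Lemma pr_static_rhits_hits (m n : nat) :
  pr ([set w | v 0 w = 0] `&` [set w | rhits (v ^~ w) (s ^~ w) 0 m] `&`
      [set w | hits (v ^~ w) (s ^~ w) 0 n]) = p * a m * a n.
Proof.
have := prob_reaches_static2 p rho (fun x _ => x == 0) m n.
rewrite prob_static => <-.
apply: (@pr_event (- m.+1%:Z) _ _ _ (@local_reaches_static2 (fun x _ => x == 0) m n)).
  move=> w; rewrite shifti_rhits shifti_hits /shifti subrr.
  by split=> [[[/eqP]]|[? /eqP]].
apply: event_and; last exact: event_hits.
apply: event_and; last exact: event_rhits.
exact: (event_value (v 0) (fun x => x = 0)).
Qed.

Local Notation q := reach_prob.

(** Given a static particle at 0, the two sides are independent. Factorization is known for pairs of
    first arrivals, so it is summed over each side in turn, and inclusion-exclusion gives the event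
    that neither side reaches 0. *)
Lemma pr_survives :
  pr ([set w | forall k, alive setT (v ^~ w) (s ^~ w) k 0] `&` [set w | v 0 w = 0])
  = p * (1 - q) ^+ 2.
Proof.
set Z := [set w | v 0 w = 0].
set H := [set w | exists n, hits (v ^~ w) (s ^~ w) 0 n].
set H' := [set w | exists n, rhits (v ^~ w) (s ^~ w) 0 n].
have mZ : measurable Z by exact: (event_value (v 0) (fun x => x = 0)).
have mH : measurable H by apply: event_exists => n; exact: event_hits.
have mH' : measurable H' by apply: event_exists => n; exact: event_rhits.
have mC := measurableC mH; have mC' := measurableC mH'.
have qc (x : R) : (fun n => \sum_(0 <= i < n) x * a i) @ \oo --> x * q.
  under eq_fun do rewrite -mulr_sumr; apply: cvgMr; exact: reach_prob_cvg.
have Rh m : measurable (Z `&` [set w | rhits (v ^~ w) (s ^~ w) 0 m]).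
  by apply: measurableI => //; exact: event_rhits.
have ZH : pr (Z `&` H) = p * q.
  have := pr_exists_cvg mZ (event_hits v s 0) (@trivIset_hits Z).
  under eq_fun do under eq_bigr do rewrite pr_static_hits.
  by move=> /cvg_lim <- //; apply: cvg_lim.
have ZH' : pr (Z `&` H') = p * q.
  have := pr_exists_cvg mZ (event_rhits v s 0) (@trivIset_rhits Z).
  under eq_fun do under eq_bigr do rewrite pr_static_rhits.
  by move=> /cvg_lim <- //; apply: cvg_lim.
have ZRH m : pr (Z `&` [set w | rhits (v ^~ w) (s ^~ w) 0 m] `&` H) = p * q * a m.
  have := pr_exists_cvg (Rh m) (event_hits v s 0)
    (@trivIset_hits (Z `&` [set w | rhits (v ^~ w) (s ^~ w) 0 m])).
  under eq_fun do under eq_bigr do rewrite pr_static_rhits_hits.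
  move=> /cvg_lim <- //; rewrite mulrAC; apply: cvg_lim => //.
have ZHH : pr (Z `&` H `&` H') = p * q * q.
  have tr : trivIset setT (fun n => Z `&` H `&` [set w | rhits (v ^~ w) (s ^~ w) 0 n]
      `&` good_config) := @trivIset_rhits (Z `&` H).
  have := pr_exists_cvg (measurableI _ _ mZ mH) (event_rhits v s 0) tr.
  under eq_fun do under eq_bigr do rewrite setIAC ZRH.
  by move=> /cvg_lim <- //; apply: cvg_lim.
have -> : pr ([set w | forall k, alive setT (v ^~ w) (s ^~ w) k 0] `&` Z) =
    pr (Z `&` ~` H `&` ~` H').
  rewrite (pr_almost _ measurable_good pr_good); last first.
    apply: measurableI => //; apply: event_forall => k; exact: event_alive.
  rewrite [RHS](pr_almost _ measurable_good pr_good); last first.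
    by apply: measurableI => //; apply: measurableI.
  congr pr; apply/seteqP; split=> w.
    move=> [[Hw Zw] g]; split=> //; have [N1 N2] := iffLR (static_survives _ g Zw) Hw.
    by split=> //; split.
  move=> [[[Zw N1] N2] g]; split=> //; split=> //.
  by apply/(static_survives _ g Zw); split.
have E1 := pr_setID P mZ mH.
have E2 := pr_setID P (measurableI _ _ mZ mC) mH'.
have E3 := pr_setID P (measurableI _ _ mZ mH') mH.
have e1 : Z `&` H' `&` H = Z `&` H `&` H' by rewrite setIAC.
have e2 : Z `&` H' `&` ~` H = Z `&` ~` H `&` H' by rewrite setIAC.
rewrite e1 e2 ZHH ZH' in E3; rewrite pr_static ZH in E1.
by rewrite expr2; nra.
Qed.

End link.

(** * The laws of words in the two models *)

Section laws.
Context (d : measure_display) (T : measurableType d) (R : realType) (P : probability T R).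
Variables (v s : int -> {mfun T >-> int}) (p : R).
Local Open Scope classical_set_scope.

Definition coordinate (i : int + int) : {mfun T >-> int} :=
  match i with inl n => v n | inr n => s n end.

Lemma independent_seq (J : seq (int + int)) (A : int + int -> set int) :
  mutually_independent P coordinate -> uniq J ->
  P [set w | forall i, i \in J -> A i (coordinate i w)] =
  (\prod_(i <- J) P (coordinate i @^-1` A i))%E.
Proof.
move=> ind uJ; have := ind [fset x in J]%fset A (fun=> I).
have -> : \bigcap_(i in [set` [fset x in J]%fset]) (coordinate i @^-1` A i) =
    [set w | forall i, i \in J -> A i (coordinate i w)].
  apply/seteqP; split=> w H i.
    by move=> iJ; apply: H; rewrite /= inE.
  by rewrite /= inE => iJ; apply: H.
move=> ->; apply: perm_big; apply: uniq_perm => //.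
by move=> x; rewrite inE.
Qed.

Hypothesis law : ballistic_law p P v s.

Lemma velocity_law (n x : int) : x \in [:: -1; 0; 1] ->
  P (v n @^-1` [set x]) = (if x == 0 then p else (1 - p) / 2)%:E.
Proof.
by case: law => /(_ n)[P0 Pm P1] _ _; rewrite !inE => /or3P[]/eqP ->.
Qed.

Lemma sign_law (n x : int) : x \in [:: -1; 0; 1] ->
  P (s n @^-1` [set x]) = (if x == 0 then 1 - 1 else 1 / 2)%:E.
Proof.
case: law => _ /(_ n)[Pm P1] _; rewrite !inE => /or3P[]/eqP -> //=.
have m x' : measurable (s n @^-1` [set x']) by exact: (event_value (s n) (fun y => y = x')).
have D x' y' : x' != y' -> s n @^-1` [set x'] `&` s n @^-1` [set y'] = set0.
  by move=> xy; apply/seteqP; split=> // w /= [-> e]; rewrite e eqxx in xy.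
have e1 := @prU _ _ _ P _ _ (m (-1)) (m 1) (D (-1) 1 isT).
have m2 := measurableU _ _ (m (-1)) (m 1).
have e2 := @prU _ _ _ P _ _ m2 (m 0).
rewrite setIUl !D // setU0 in e2.
have e3 := e2 erefl.
have e4 := le_pr P (measurableU _ _ m2 (m 0)) measurableT (@subsetT _ _).
rewrite (prE P (m 0)); congr EFin; apply/eqP; rewrite subrr eq_le pr_ge0 andbT.
rewrite e3 e1 prT in e4; rewrite {1 2}/pr Pm P1 /= in e4.
by lra.
Qed.

Lemma alphabetP (l : int * int) : l \in alphabet ->
  l.1 \in [:: -1; 0; 1] /\ l.2 \in [:: -1; 0; 1].
Proof. by case/allpairsP => -[x y] [? ? ->]. Qed.

Lemma word_indep (a : int) (u : seq (int * int)) :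
  P [set w | forall i, (i < size u)%N -> v (i.+1%:Z + a) w = (nth (0%R, 0%R) u i).1] =
    (\prod_(i < size u) P (v (i.+1%:Z + a) @^-1` [set (nth (0%R, 0%R) u i).1]))%E /\
  P (cylinder v s a u) =
    ((\prod_(i < size u) P (v (i.+1%:Z + a) @^-1` [set (nth (0%R, 0%R) u i).1])) *
    (\prod_(i < size u) P (s (i.+1%:Z + a) @^-1` [set (nth (0%R, 0%R) u i).2])))%E.
Proof.
case: law => _ _ ind.
pose A (x : int + int) : set int := match x with
  | inl n => [set (nth (0, 0) u (absz (n - a)%R).-1).1]
  | inr n => [set (nth (0, 0) u (absz (n - a)%R).-1).2] end.
pose il (i : nat) : int + int := inl (i.+1%:Z + a).
pose ir (i : nat) : int + int := inr (i.+1%:Z + a).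
have ilj : injective il by move=> i j [] ; lia.
have irj : injective ir by move=> i j [] ; lia.
have ei (i : nat) : (absz (i.+1%:Z + a - a)%R).-1 = i by lia.
have ul : uniq (map il (iota 0 (size u))) by rewrite map_inj_uniq // iota_uniq.
split.
  have := independent_seq (J := map il (iota 0 (size u))) A ind ul.
  rewrite big_map -[X in iota 0 X]subn0 -/(index_iota 0 (size u)) big_mkord.
  under eq_bigr => i _ do rewrite /= ei.
  move=> <-; congr (P _); apply/seteqP; split=> w H.
    move=> x /mapP[i]; rewrite mem_index_iota => /andP[_ iu] -> /=.
    by rewrite ei; apply: H.
  move=> i iu; have := H (il i); rewrite /= ei; apply.
  by apply: map_f; rewrite mem_index_iota.
have uc : uniq (map il (iota 0 (size u)) ++ map ir (iota 0 (size u))).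
  rewrite cat_uniq ul map_inj_uniq // iota_uniq andbT /=.
  by apply/hasPn => x /mapP[i _ ->]; apply/negP => /mapP[].
have := independent_seq A ind uc.
rewrite big_cat !big_map -[X in iota 0 X]subn0 -/(index_iota 0 (size u)) !big_mkord /=.
under eq_bigr => i _ do rewrite /= ei.
under [X in (_ * X)%E]eq_bigr => i _ do rewrite /= ei.
move=> <-; congr (P _); apply/seteqP; split=> w H.
  move=> x; rewrite mem_cat => /orP[]/mapP[i]; rewrite mem_index_iota => /andP[_ iu] -> /=.
    by rewrite ei; apply: (H _ iu).1.
  by rewrite ei; apply: (H _ iu).2.
move=> i iu; split.
  have := H (il i); rewrite /= ei; apply.
  by rewrite mem_cat map_f ?mem_index_iota.
have := H (ir i); rewrite /= ei; apply.
by rewrite mem_cat orbC map_f ?mem_index_iota.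
Qed.

Lemma signed_word_law : word_law P v s p 1.
Proof.
move=> a u /allP au; have [_ ->] := word_indep a u.
rewrite (big_nth (0, 0)) big_mkord /weight.
rewrite big_split EFinM -!prodEFin; congr (_ * _)%E; apply: eq_bigr => i _.
  by rewrite velocity_law //; case: (alphabetP (au _ (mem_nth (0, 0) (ltn_ord i)))).
by rewrite sign_law //; case: (alphabetP (au _ (mem_nth (0, 0) (ltn_ord i)))).
Qed.

(** A word with a nonzero sign has weight 0 and an empty cylinder; on the other words the sign
    factors are 1. *)
Lemma unsigned_word_law : word_law P v (fun=> cst 0) p 0.
Proof.
move=> a u /allP au; have [Pu _] := word_indep a u.
have [z|/allPn[l lu l0]] := boolP (all (fun l => l.2 == 0) u).
  have -> : cylinder v (fun=> cst 0) a u =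
      [set w | forall i, (i < size u)%N -> v (i.+1%:Z + a) w = (nth (0, 0) u i).1].
    apply/seteqP; split=> w H i iu; first by have [] := H i iu.
    by split; [exact: H | rewrite /=; apply/esym/eqP; apply: (allP z); exact: mem_nth].
  rewrite Pu (big_nth (0, 0)) big_mkord -prodEFin; apply: eq_bigr => i _.
  have iu := mem_nth (0, 0) (ltn_ord i).
  rewrite velocity_law; last by case: (alphabetP (au _ iu)).
  by rewrite /weight (allP z _ iu) subr0 mulr1.
have -> : cylinder v (fun=> cst 0) a u = set0.
  apply/seteqP; split=> // w H; have /(nthP (0, 0))[i iu il] := lu.
  by have [_ /= e] := H i iu; move: l0; rewrite -il -e eqxx.
rewrite measure0; congr EFin; apply/esym/eqP.
rewrite prodf_seq_eq0; apply/hasP; exists l => //=.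
by rewrite /weight (negbTE l0) !mul0r mulr0.
Qed.

Lemma q_hat_reach : q_hat P v = reach_prob P v (fun=> cst 0).
Proof.
rewrite /q_hat /reach_prob /pr; congr (fine (P _)); apply/funext => w /=.
congr (reaches0 _ _); apply/funext => k; exact: alive_hatE.
Qed.

Lemma psi_reach : psi P v = p * (1 - reach_prob P v (fun=> cst 0)) ^+ 2 / p.
Proof.
rewrite /psi /cond_prob; congr (_ / _).
  rewrite -(pr_survives unsigned_word_law) /pr; congr (fine (P (_ `&` _))).
  by apply/funext => w /=; apply/propext; split=> H k; move: (H k); rewrite alive_hatE.
exact: (pr_static unsigned_word_law).
Qed.

End laws.

(** * Total masses *)

Section series.
Variable R : realType.
Implicit Types x y : nat -> R.
Local Open Scope classical_set_scope.

Definition partial_sum x (n : nat) : R := \sum_(i < n) x i.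

Definition sums_to x (X : R) := partial_sum x n @[n --> \oo] --> X.

Definition conv x y (n : nat) : R := \sum_(i < n.+1) x i * y (n - i)%N.

Lemma partial_sumS x n : partial_sum x n.+1 = partial_sum x n + x n.
Proof. by rewrite /partial_sum big_ord_recr. Qed.

Lemma partial_sum_ge0 x n : (forall i, 0 <= x i) -> 0 <= partial_sum x n.
Proof. by move=> x0; apply: sumr_ge0. Qed.

Lemma partial_sum_homo x : (forall i, 0 <= x i) ->
  {homo partial_sum x : m n / (m <= n)%N >-> m <= n}.
Proof.
move=> x0; apply: homo_leq => [//|? ? ?|n]; first exact: le_trans.
by rewrite partial_sumS lerDl.
Qed.

Lemma sums_to_ge x X n : (forall i, 0 <= x i) -> sums_to x X -> partial_sum x n <= X.
Proof.
move=> x0 xX; rewrite -(cvg_lim _ xX) //.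
apply: nondecreasing_cvgn_le; last exact: cvgP xX.
by move=> m k mk; apply: partial_sum_homo.
Qed.

Lemma sums_to_le x X B : (forall n, partial_sum x n <= B) -> sums_to x X -> X <= B.
Proof.
move=> xB xX; rewrite -(cvg_lim _ xX) //.
by apply: limr_le; [exact: cvgP xX | near=> n].
Unshelve. all: by end_near.
Qed.

Lemma sums_to_bounded x B : (forall i, 0 <= x i) -> (forall n, partial_sum x n <= B) ->
  exists X, sums_to x X.
Proof.
move=> x0 xB; exists (limn (partial_sum x)); apply: nondecreasing_is_cvgn.
  by move=> m k mk; apply: partial_sum_homo.
by exists B => _ [n _ <-].
Qed.

Lemma sums_to_unique x X Y : sums_to x X -> sums_to x Y -> X = Y.
Proof. by move=> xX xY; rewrite -(cvg_lim _ xX) // -(cvg_lim _ xY). Qed.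

Lemma sums_to_shift x X : sums_to x X -> sums_to (fun n => x n.+1) (X - x 0%N).
Proof.
move=> xX; rewrite /sums_to.
have -> : partial_sum (fun n => x n.+1) = (fun n => partial_sum x n.+1 - x 0%N).
  by apply/funext => n; rewrite /partial_sum big_ord_recl addrC addKr.
by apply: cvgB; [rewrite cvg_shiftS | exact: cvg_cst].
Qed.

Lemma sums_toD x y X Y : sums_to x X -> sums_to y Y -> sums_to (fun n => x n + y n) (X + Y).
Proof.
move=> xX yY; rewrite /sums_to.
have -> : partial_sum (fun n => x n + y n) = (fun n => partial_sum x n + partial_sum y n).
  by apply/funext => n; rewrite /partial_sum big_split.
exact: cvgD.
Qed.

Lemma sums_toZ k x X : sums_to x X -> sums_to (fun n => k * x n) (k * X).
Proof.
move=> xX; rewrite /sums_to.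
have -> : partial_sum (fun n => k * x n) = (fun n => k * partial_sum x n).
  by apply/funext => n; rewrite /partial_sum mulr_sumr.
by apply: cvgMr.
Qed.

Lemma sums_to_delta k : sums_to (fun n => (n == 0)%:R * k) k.
Proof.
rewrite /sums_to -cvg_shiftS.
have -> : (fun n => partial_sum (fun n => (n == 0)%:R * k) n.+1) = (fun=> k).
  apply/funext => n; rewrite /partial_sum big_ord_recl mul1r big1 ?addr0 // => i _.
  by rewrite mul0r.
exact: cvg_cst.
Qed.

Lemma partial_sum_conv x y n :
  partial_sum (conv x y) n = \sum_(i < n) x i * partial_sum y (n - i)%N.
Proof.
elim: n => [|n IH]; first by rewrite /partial_sum !big_ord0.
rewrite partial_sumS IH [RHS]big_ord_recr /conv [X in _ + X = _]big_ord_recr /=.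
rewrite addrA -big_split /= subnn subSnn; congr (_ + _).
  by apply: eq_bigr => i _; rewrite -mulrDr subSn ?partial_sumS // ltnW.
by rewrite /partial_sum big_ord1.
Qed.

(** Squeeze: the triangle of index pairs contains the square of side [n./2], and its sum is at most
    the partial sum of [x] times [Y]. *)
Lemma sums_to_conv x y X Y : (forall i, 0 <= x i) -> (forall i, 0 <= y i) ->
  sums_to x X -> sums_to y Y -> sums_to (conv x y) (X * Y).
Proof.
move=> x0 y0 xX yY.
have half : (fun n => partial_sum x n./2 * partial_sum y n./2) @ \oo --> X * Y.
  have h : (fun n => n./2) @ \oo --> \oo.
    move=> A [N _ NA]; exists N.*2 => // n /= nN; apply: NA => /=.
    by rewrite geq_half_double.
  by apply: cvgM; [exact: (cvg_comp _ _ h xX) | exact: (cvg_comp _ _ h yY)].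
apply: (squeeze_cvgr _ half (cvg_cst (X * Y))); near=> n; apply/andP; split.
  rewrite partial_sum_conv.
  apply: (@le_trans _ _ (\sum_(i < n./2) x i * partial_sum y (n - i)%N)).
    rewrite {1}/partial_sum mulr_suml; apply: ler_sum => i _; apply: ler_wpM2l => //.
    apply: partial_sum_homo => //.
    by have := ltn_ord i; have := odd_double_half n; lia.
  rewrite (big_ord_widen n (fun i => x i * partial_sum y (n - i)%N)); last first.
    by have := odd_double_half n; lia.
  rewrite [leLHS]big_mkcond; apply: ler_sum => i _; case: ifP => // _.
  by apply: mulr_ge0 => //; apply: partial_sum_ge0.
rewrite partial_sum_conv; apply: (@le_trans _ _ (partial_sum x n * Y)).
  rewrite /partial_sum mulr_suml; apply: ler_sum => i _; apply: ler_wpM2l => //.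
  exact: sums_to_ge.
apply: ler_wpM2r; last exact: sums_to_ge.
by apply: le_trans (sums_to_ge 0 y0 yY); apply: partial_sum_ge0.
Unshelve. all: by end_near.
Qed.

(** The squares placed at even indices, so that ties, which occupy lengths governed by [d.*2],
    become convolutions. For [x] the sequence a, the total is t. *)
Definition doubled x (m : nat) : R := if odd m then 0 else x m./2 ^+ 2.

Lemma doubled_ge0 x m : 0 <= doubled x m.
Proof. by rewrite /doubled; case: ifP => // _; apply: sqr_ge0. Qed.

Lemma sum_double (f : nat -> nat -> R) n :
  \sum_(d < n.+1 | (d.*2 <= n)%N) f d (n - d.*2)%N =
  \sum_(m < n.+1) if odd m then 0 else f m./2 (n - m)%N.
Proof.
under [RHS]eq_bigr => m _ do rewrite -if_neg.
rewrite -(big_mkord (fun d => (d.*2 <= n)%N) (fun d => f d (n - d.*2)%N)).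
rewrite -(big_mkord xpredT (fun m => if ~~ odd m then f m./2 (n - m)%N else 0)).
rewrite -big_mkcond /=.
rewrite -big_filter -[RHS]big_filter.
have -> : [seq m <- index_iota 0 n.+1 | ~~ odd m] =
    [seq d.*2 | d <- index_iota 0 n.+1 & (d.*2 <= n)%N].
  apply: (@irr_sorted_eq _ ltn) => //.
  - exact: ltn_trans.
  - exact: ltnn.
  - by apply: sorted_filter; [exact: ltn_trans | exact: iota_ltn_sorted].
  - rewrite sorted_map; apply: (@sub_sorted _ ltn).
      by move=> i j ij /=; rewrite /relpre /= ltn_double.
    by apply: sorted_filter; [exact: ltn_trans | exact: iota_ltn_sorted].
  move=> m; rewrite mem_filter mem_index_iota; apply/andP/mapP.
    move=> [om mn]; exists m./2; last by rewrite even_halfK.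
    by rewrite mem_filter mem_index_iota even_halfK //; lia.
  by move=> [d]; rewrite mem_filter => /andP[dn _] ->; rewrite odd_double.
by rewrite big_map; apply: eq_bigr => d _; rewrite doubleK.
Qed.

Lemma conv_doubled x y n :
  \sum_(d < n.+1 | (d.*2 <= n)%N) x d * x d * y (n - d.*2)%N = conv (doubled x) y n.
Proof.
rewrite (sum_double (fun d j => x d * x d * y j)); apply: eq_bigr => m _.
by rewrite /doubled; case: ifP; rewrite ?mul0r // expr2.
Qed.

Lemma diagonal x n : \sum_(d < n.+1 | d.*2 == n) x d * x d = doubled x n.
Proof.
rewrite /doubled; case: ifP => on.
  by rewrite big1 // => d /eqP e; rewrite -e odd_double in on.
have lt : (n./2 < n.+1)%N by have := odd_double_half n; lia.
rewrite (big_pred1 (Ordinal lt)) ?expr2 // => d /=.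
apply/eqP/eqP => [e|->]; last by rewrite even_halfK ?on.
by apply/val_inj => /=; have := congr1 half e; rewrite doubleK.
Qed.

(** Pairs split into those with the smaller index first, their mirror images, and the diagonal. *)
Lemma conv_half x n :
  conv x x n = 2 * \sum_(d < n.+1 | (d.*2 < n)%N) x d * x (n - d)%N + doubled x n.
Proof.
rewrite /conv (bigID (fun d : 'I_n.+1 => (d.*2 < n)%N)) /=.
rewrite mulr2n mulrDl !mul1r -addrA; congr (_ + _).
rewrite (bigID (fun d : 'I_n.+1 => d.*2 == n)) /= addrC; congr (_ + _).
  rewrite (reindex_inj rev_ord_inj) /=; apply: eq_big => d /=.
    by rewrite subSS; have := ltn_ord d; lia.
  by move=> _; rewrite subSS subKn 1?mulrC // -ltnS.
rewrite -diagonal; apply: eq_big => d; first lia.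
by move=> /andP[_ /eqP e]; congr (_ * x _); lia.
Qed.

Lemma sum_conv2 (F : nat -> nat -> R) y n :
  \sum_(d < n.+1) \sum_(d' < n.+1 | (d + d' <= n)%N) F d d' * y (n - d - d')%N =
  conv (fun m => \sum_(d < m.+1) F d (m - d)%N) y n.
Proof.
rewrite /conv.
transitivity (\sum_(d < n.+1) \sum_(m < n.+1 | (d <= m)%N) F d (m - d)%N * y (n - m)%N).
  apply: eq_bigr => d _.
  rewrite -(big_mkord (fun d' => (d + d' <= n)%N) (fun d' => F d d' * y (n - d - d')%N)).
  rewrite -(big_mkord (fun m => (d <= m)%N) (fun m => F d (m - d)%N * y (n - m)%N)).
  have dn := ltn_ord d.
  rewrite (big_cat_nat (n := n.+1 - d)) ?leq_subr //= [X in _ + X]big_nat_cond.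
  rewrite [X in _ + X]big1 ?addr0; last by move=> i; lia.
  rewrite [RHS](big_cat_nat (n := d)) //=; last by lia.
  rewrite [X in _ = X + _]big_nat_cond [X in _ = X + _]big1 ?add0r; last by move=> i; lia.
  have H (G : nat -> R) (Q : pred nat) : \sum_(d <= i < n.+1 | Q i) G i =
      \sum_(0 <= i < n.+1 - d | Q (i + d)%N) G (i + d)%N.
    by rewrite -{1}[nat_of_ord d]add0n big_addn.
  rewrite H big_nat_cond [RHS]big_nat_cond.
  apply: eq_big => i; first lia.
  by move=> _; rewrite addnK; congr (_ * y _); lia.
rewrite (exchange_big_dep xpredT) //=; apply: eq_bigr => m _; rewrite mulr_suml.
rewrite (big_ord_widen n.+1 (fun d => F d (m - d)%N * y (n - m)%N)) //.
Qed.

End series.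

Section totals.
Variables (R : realType) (p rho : R).
Local Notation a := (hits_prob p rho).
Local Notation c := (crossing_prob p rho).
Local Notation ordered n := ((conv a a n - doubled a n) / 2).

Lemma ordered_sum (n : nat) :
  \sum_(d < n.+1 | (d.*2 < n)%N) a d * a (n - d)%N = ordered n.
Proof. by rewrite conv_half; lra. Qed.

Lemma hits_prob_conv (n : nat) :
  a n.+1 = (n == 0)%:R * ((1 - p) / 2) + p * conv a a n
    + (conv c a n.+1 + (1 - rho) * p * conv (doubled a) a n
       + p * ordered n + rho / 2 * p * doubled a n).
Proof.
rewrite hits_prob_rec -ordered_sum -conv_doubled -diagonal !mulr_sumr.
congr (_ + _ + (_ + _ + _ + _)); apply: eq_bigr => i _; rewrite ?mulrA //.
Qed.

Lemma block_weight_sum (m : nat) :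
  \sum_(d < m.+1) block_weight rho d (m - d)%N * p * a d * a (m - d)%N
  = p * (ordered m + (1 - rho / 2) * doubled a m).
Proof.
rewrite -ordered_sum -diagonal mulrDr !mulr_sumr.
rewrite (bigID (fun d : 'I_m.+1 => (d.*2 < m)%N)) /=; congr (_ + _).
  apply: eq_bigr => d dm; rewrite /block_weight.
  have -> : (d < m - d)%N by lia.
  by rewrite /=; ring.
rewrite (bigID (fun d : 'I_m.+1 => d.*2 == m)) /= addrC big1 ?add0r.
  apply: eq_big => d; first lia.
  move=> /andP[_ /eqP e]; rewrite /block_weight.
  have -> : (m - d)%N = d by lia.
  by rewrite ltnn eqxx; ring.
move=> d; rewrite /block_weight => dm.
have -> : (d < m - d)%N = false by have := ltn_ord d; lia.
have -> : ((d : nat) == m - d)%N = false by have := ltn_ord d; lia.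
by rewrite !mul0r.
Qed.

Lemma crossing_prob_conv (n : nat) :
  (1 - p) / 2 * a n = c n.+1 +
    p * conv (fun m => ordered m + (1 - rho / 2) * doubled a m) a n.
Proof.
rewrite crossing_prob_rec; congr (_ + _).
rewrite (sum_conv2 (fun d d' => block_weight rho d d' * p * a d * a d') a n).
rewrite /conv mulr_sumr; apply: eq_bigr => m _.
by rewrite block_weight_sum mulrA.
Qed.

Hypothesis p01 : 0 <= p <= 1.
Hypothesis rho01 : 0 <= rho <= 1.

Lemma hits_prob_ge0 (n : nat) : 0 <= a n.
Proof. by apply: expect_ge0 => // w; rewrite ler0n. Qed.

Lemma crossing_prob_ge0 (n : nat) : 0 <= c n.
Proof. by apply: expect_ge0 => // w; rewrite ler0n. Qed.

Lemma conv_ge0 (x y : nat -> R) (n : nat) :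
  (forall i, 0 <= x i) -> (forall i, 0 <= y i) -> 0 <= conv x y n.
Proof. by move=> x0 y0; apply: sumr_ge0 => i _; apply: mulr_ge0. Qed.

Lemma ordered_ge0 (n : nat) : 0 <= ordered n.
Proof.
rewrite -ordered_sum; apply: sumr_ge0 => i _.
by apply: mulr_ge0; apply: hits_prob_ge0.
Qed.

Variable q : R.
Hypothesis sum_a : sums_to a q.

(** In the second recursion the other terms are nonnegative, so [c n.+1] is at most
    [(1 - p) / 2 * a n]. *)
Lemma crossing_prob_sum : exists C, sums_to c C.
Proof.
have [p0 p1] := andP p01; have [r0 r1] := andP rho01.
apply: (@sums_to_bounded _ _ ((1 - p) / 2 * q)); first exact: crossing_prob_ge0.
move=> n; apply: (@le_trans _ _ (partial_sum c n.+1)).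
  by apply: partial_sum_homo => //; exact: crossing_prob_ge0.
rewrite /partial_sum big_ord_recl [c _]crossing_prob0 add0r.
apply: (@le_trans _ _ ((1 - p) / 2 * partial_sum a n)).
  rewrite /partial_sum mulr_sumr; apply: ler_sum => i _ /=.
  rewrite crossing_prob_conv lerDl mulr_ge0 // conv_ge0 //; last exact: hits_prob_ge0.
  move=> m; have := ordered_ge0 m; have := doubled_ge0 a m => d0 o0.
  by apply: addr_ge0 => //; apply: mulr_ge0 => //; lra.
apply: ler_wpM2l; first by lra.
by apply: sums_to_ge sum_a; exact: hits_prob_ge0.
Qed.

Lemma doubled_sum : exists t, sums_to (doubled a) t.
Proof.
apply: (@sums_to_bounded _ _ (q * q)); first exact: doubled_ge0.
move=> n; have sc := sums_to_conv hits_prob_ge0 hits_prob_ge0 sum_a sum_a.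
apply: (@le_trans _ _ (partial_sum (conv a a) n)).
  apply: ler_sum => i _.
  by have := ordered_ge0 i; lra.
by apply: sums_to_ge sc => i; apply: conv_ge0; exact: hits_prob_ge0.
Qed.

Lemma total_equations (C t : R) : sums_to c C -> sums_to (doubled a) t ->
  q = (1 - p) / 2 + p * q ^+ 2 + C * q + (1 - rho) * p * t * q
      + p * ((q ^+ 2 - t) / 2) + rho / 2 * p * t /\
  (1 - p) / 2 * q = C + p * (((q ^+ 2 - t) / 2 + (1 - rho / 2) * t) * q).
Proof.
move=> sc st; have a0 := hits_prob_ge0; have c0 := crossing_prob_ge0.
have d0 := doubled_ge0 a.
have saa := sums_to_conv a0 a0 sum_a sum_a.
have so : sums_to (fun n => ordered n) ((q ^+ 2 - t) / 2).
  have := @sums_toZ _ (2^-1) _ _ (sums_toD saa (@sums_toZ _ (-1) _ _ st)).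
  have -> : 2^-1 * (q * q + -1 * t) = (q ^+ 2 - t) / 2 by rewrite expr2; lra.
  by under eq_fun do rewrite mulN1r mulrC.
have sda := sums_to_conv d0 a0 st sum_a.
(* The shift by one index loses nothing, as [c 0 = 0]. *)
have sca : sums_to (fun n => conv c a n.+1) (C * q).
  have := sums_to_shift (sums_to_conv c0 a0 sc sum_a).
  by rewrite {2}/conv big_ord1 [c _]crossing_prob0 mul0r subr0.
split.
  have := sums_toD (sums_toD (@sums_to_delta _ ((1 - p) / 2)) (@sums_toZ _ p _ _ saa))
    (sums_toD (sums_toD (sums_toD sca (@sums_toZ _ ((1 - rho) * p) _ _ sda)) (@sums_toZ _ p _ _ so))
      (@sums_toZ _ (rho / 2 * p) _ _ st)).
  under eq_fun do rewrite -hits_prob_conv.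
  have sa := sums_to_shift sum_a; rewrite hits_prob0 subr0 in sa.
  by move=> /(sums_to_unique sa) {1}->; rewrite expr2; ring.
have sx := sums_toD so (@sums_toZ _ (1 - rho / 2) _ _ st).
have x0 n : 0 <= ordered n + (1 - rho / 2) * doubled a n.
  have [r0 r1] := andP rho01.
  by apply: addr_ge0; [exact: ordered_ge0 | apply: mulr_ge0 => //; lra].
have sxa := sums_to_conv x0 a0 sx sum_a.
have sc' := sums_to_shift sc; rewrite [c _]crossing_prob0 subr0 in sc'.
have := sums_toD sc' (@sums_toZ _ p _ _ sxa).
under eq_fun do rewrite -crossing_prob_conv.
by move=> /(sums_to_unique (@sums_toZ _ ((1 - p) / 2) _ _ sum_a)).
Qed.

End totals.

(** * The equation for the probability of reaching 0 *)

Section dichotomy.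
Variables (R : realType) (p : R).
Hypothesis p01 : 0 <= p <= 1.

Lemma signed_dichotomy (q : R) : sums_to (hits_prob p 1) q ->
  q = 1 \/ p * (1 + q) ^+ 2 = 1.
Proof.
move=> sa; have r01 : 0 <= (1 : R) <= 1 by rewrite ler01 lexx.
have [C sc] := crossing_prob_sum p01 r01 sa; have [t st] := doubled_sum p01 r01 sa.
have [e1 e2] := total_equations p01 r01 sa sc st.
have : (1 - q) ^+ 2 * (p * (1 + q) ^+ 2 - 1) = 0.
  have eC : C = (1 - p) / 2 * q - p * (((q ^+ 2 - t) / 2 + (1 - 1 / 2) * t) * q) by lra.
  by rewrite eC !expr2 in e1 *; lra.
move=> /eqP; rewrite mulf_eq0 expf_eq0 /= !subr_eq0 => /orP[/eqP|/eqP]; first by left.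
by right.
Qed.

Variables (q C t : R).
Hypothesis sa : sums_to (hits_prob p 0) q.
Hypothesis sc : sums_to (crossing_prob p 0) C.
Hypothesis st : sums_to (doubled (hits_prob p 0)) t.

Let r01 : 0 <= (0 : R) <= 1. Proof. by rewrite lexx ler01. Qed.

Lemma unsigned_dichotomy : q = 1 \/ p * ((1 + q) ^+ 2 + t) = 1.
Proof.
have [e1 e2] := total_equations p01 r01 sa sc st.
have : (1 - q) ^+ 2 * (p * ((1 + q) ^+ 2 + t) - 1) = 0.
  have eC : C = (1 - p) / 2 * q - p * (((q ^+ 2 - t) / 2 + (1 - 0 / 2) * t) * q) by lra.
  by rewrite eC !expr2 in e1 *; lra.
move=> /eqP; rewrite mulf_eq0 expf_eq0 /= !subr_eq0 => /orP[/eqP|/eqP]; first by left.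
by right.
Qed.

(** At [q = 1] the second equation reads 2 C = 1 - 2 p - p t, so adding p t leaves a value free of
    t. Otherwise p t is known from the dichotomy, and the excess is a square. *)
Lemma crossing_total : 2 * C + p * t =
  if q == 1 then 1 - 2 * p else 1 - 2 * p + p * (1 - q) ^+ 2.
Proof.
have [_ e2] := total_equations p01 r01 sa sc st.
case: eqP => [q1|q1]; first by rewrite q1 !expr2 in e2 *; lra.
case: unsigned_dichotomy => // e3.
have eC : C = (1 - p) / 2 * q - p * (((q ^+ 2 - t) / 2 + (1 - 0 / 2) * t) * q) by lra.
have et : p * t = 1 - p * (1 + q) ^+ 2 by lra.
rewrite eC.
have -> : p * (((q ^+ 2 - t) / 2 + (1 - 0 / 2) * t) * q) = (p * q ^+ 2 + p * t) / 2 * q by field.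
by rewrite et; field.
Qed.

End dichotomy.

(** * The supercritical interval *)

Section continuity.
Variable R : realType.
Local Open Scope classical_set_scope.

Lemma continuous_expect (rho : R) (n : nat) (F : seq (int * int) -> R) :
  continuous (fun p => expect p rho n F).
Proof.
elim: n F => [|n IH] F p /=; first exact: cvg_cst.
have W l : (fun p => weight p rho l * expect p rho n (fun w => F (l :: w))) x @[x --> p] -->
    weight p rho l * expect p rho n (fun w => F (l :: w)).
  apply: cvgM; last exact: IH.
  apply: cvgM; last exact: cvg_cst.
  case: ifP => _; first exact: cvg_id.
  apply: cvgM; last exact: cvg_cst.
  by apply: cvgB; [exact: cvg_cst | exact: cvg_id].
elim: alphabet => [|l r IHr].
  by under eq_fun do rewrite big_nil; exact: cvg_cst.
by under eq_fun do rewrite big_cons; apply: cvgD.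
Qed.

Lemma continuous_partial_sum (x : R -> nat -> R) (n : nat) :
  (forall i, continuous (fun p => x p i)) -> continuous (fun p => partial_sum (x p) n).
Proof.
move=> xc; elim: n => [|n IH] p.
  by rewrite /partial_sum; under eq_fun do rewrite big_ord0; exact: cvg_cst.
under eq_fun do rewrite partial_sumS.
by apply: cvgD; [exact: IH | exact: xc].
Qed.

Lemma continuous_doubled (x : R -> nat -> R) (m : nat) :
  (forall i, continuous (fun p => x p i)) -> continuous (fun p => doubled (x p) m).
Proof.
move=> xc p; rewrite /doubled; case: (odd m); first exact: cvg_cst.
exact: (continuousM (xc _ p) (xc _ p)).
Qed.

Lemma continuous_gt_near (f : R -> R) (p k : R) : {for p, continuous f} -> k < f p ->
  \forall x \near p, k < f x.
Proof. by move=> fc kf; exact: (cvgr_gt _ fc _ kf). Qed.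

(** Let s be the supremum of the points where [Q] is 1. If [Q] were 1 at s, then s < 1 and such
    points would exist beyond s; if it were less than 1 there, none would exist just below s. *)
Lemma clopen_interval (Q : R -> R) (p0 : R) :
  (forall p, p0 <= p <= 1 -> Q p <= 1) -> Q 1 < 1 ->
  (forall p, p0 <= p <= 1 -> Q p < 1 -> \forall x \near p, p0 <= x <= 1 -> Q x < 1) ->
  (forall p, p0 <= p <= 1 -> Q p = 1 -> \forall x \near p, p0 <= x <= 1 -> Q x = 1) ->
  forall p, p0 <= p <= 1 -> Q p < 1.
Proof.
move=> Qle Q1 Olt Oeq p pp; rewrite lt_neqAle Qle // andbT; apply/negP => /eqP Qp.
pose A := [set x : R | p0 <= x <= 1 /\ Q x = 1].
have Ap : A p by [].
have hA : has_sup A by split; [exists p | exists 1 => x [/andP[]]].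
have sA x : A x -> x <= sup A by move=> Ax; apply: ub_le_sup => //; case: hA.
have s01 : p0 <= sup A <= 1.
  apply/andP; split; first by apply: le_trans (sA _ Ap); case/andP: pp.
  by apply: ge_sup; [exists p | move=> x [/andP[]]].
have := Qle _ s01; rewrite le_eqVlt => /orP[/eqP Qs|Qs].
  have s1 : sup A < 1.
    by case/andP: s01 => _; rewrite le_eqVlt => /orP[/eqP e|//]; rewrite e in Qs; lra.
  have [e /= e0 He] := Oeq _ s01 Qs.
  have [x [sx x1 xe]] : exists x, [/\ sup A < x, x <= 1 & x <= sup A + e / 2].
    exists (Num.min (sup A + e / 2) 1); split.
    - by rewrite lt_min s1 andbT ltrDl divr_gt0.
    - by rewrite ge_min lexx orbT.
    - by rewrite ge_min lexx.
  have := sA x; suff: A x by move=> Ax /(_ Ax); rewrite leNgt sx.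
  have xp : p0 <= x <= 1 by rewrite x1 andbT; case/andP: s01 => ? ?; lra.
  split=> //; apply: He => //=; rewrite ler0_norm; lra.
have [e /= e0 He] := Olt _ s01 Qs.
have [x [xp Qx] xs] := sup_adherent e0 hA.
have : Q x < 1; last by rewrite Qx ltxx.
have xA := sA x (conj xp Qx).
by apply: He => //=; rewrite ger0_norm; lra.
Qed.

End continuity.

Section unsigned.
Variables (R : realType) (Q : R -> R).
Local Open Scope classical_set_scope.
Hypothesis Qsum : forall p : R, 0 <= p <= 1 -> sums_to (hits_prob p 0) (Q p).
Hypothesis Qle : forall p : R, 0 <= p <= 1 -> Q p <= 1.
Local Notation a p := (hits_prob p 0).
Local Notation c p := (crossing_prob p 0).

Let r01 : 0 <= (0 : R) <= 1. Proof. by rewrite lexx ler01. Qed.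

Let ac (i : nat) : continuous (fun p : R => a p i).
Proof. exact: continuous_expect. Qed.

Let cc (i : nat) : continuous (fun p : R => c p i).
Proof. exact: continuous_expect. Qed.

Let pac n : continuous (fun p : R => partial_sum (a p) n).
Proof. exact: (continuous_partial_sum ac). Qed.

Let pcc n : continuous (fun p : R => partial_sum (c p) n).
Proof. exact: (continuous_partial_sum cc). Qed.

Let pdc n : continuous (fun p : R => partial_sum (doubled (a p)) n).
Proof. by apply: continuous_partial_sum => i; apply: continuous_doubled. Qed.

Lemma unsigned_lt1_near (p : R) : 0 < p <= 1 -> Q p < 1 ->
  \forall x \near p, 0 <= x <= 1 -> Q x < 1.
Proof.
move=> /andP[p0 p1] Qp; have p01 : 0 <= p <= 1 by rewrite (ltW p0).
have sa := Qsum p01.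
have [C sc] := crossing_prob_sum p01 r01 sa; have [t st] := doubled_sum p01 r01 sa.
(* By [crossing_total], [f p n] tends to [p * (1 - Q p) ^+ 2 > 0], whereas [f x n <= 0] wherever
   [Q x = 1]. *)
pose f (x : R) n := 2 * partial_sum (c x) n + x * partial_sum (doubled (a x)) n - (1 - 2 * x).
have fC : f p n @[n --> \oo] --> 2 * C + p * t - (1 - 2 * p).
  by apply: cvgB; [apply: cvgD; apply: cvgMr | exact: cvg_cst].
have f0 : 0 < 2 * C + p * t - (1 - 2 * p).
  rewrite (crossing_total p01 sa sc st) lt_eqF // addrC addKr.
  by apply: mulr_gt0 => //; apply: exprn_gt0; rewrite subr_gt0.
have [n _ /(_ n (leqnn n)) fn] := @cvgr_gt _ _ _ _ _ _ fC _ f0.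
have fcont : {for p, continuous (fun x => f x n)}.
  apply: cvgB; last first.
    by apply: cvgB; [exact: cvg_cst | apply: cvgMr; exact: cvg_id].
  apply: cvgD; first by apply: cvgMr; exact: pcc.
  apply: cvgM; first exact: cvg_id.
  exact: pdc.
have := continuous_gt_near fcont fn; apply: filterS => x fx x01.
rewrite lt_neqAle Qle // andbT; apply/negP => /eqP Qx.
have sa' := Qsum x01.
have [C' sc'] := crossing_prob_sum x01 r01 sa'; have [t' st'] := doubled_sum x01 r01 sa'.
have := crossing_total x01 sa' sc' st'; rewrite Qx eqxx => e.
have h1 := sums_to_ge n (crossing_prob_ge0 x01 r01) sc'.
have h2 := sums_to_ge n (doubled_ge0 _) st'.
have x0 : 0 <= x by case/andP: x01.
have h3 := ler_wpM2l x0 h2.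
by rewrite /f in fx; lra.
Qed.

Lemma unsigned_eq1_near (p : R) (n : nat) : 0 <= p <= 1 -> Q p = 1 ->
  1 < p * (4 + partial_sum (doubled (a p)) n) ->
  \forall x \near p, 0 <= x <= 1 -> Q x = 1.
Proof.
move=> p01 Qp pn; have sa := Qsum p01.
(* The index [n] is imposed by the hypothesis; only the partial sum of q grows, through [m]. By the
   dichotomy, [f x m <= 1] wherever [Q x] is not 1. *)
pose f (x : R) m := x * ((1 + partial_sum (a x) m) ^+ 2 + partial_sum (doubled (a x)) n).
have fC : f p m @[m --> \oo] --> p * (4 + partial_sum (doubled (a p)) n).
  apply: cvgMr; apply: cvgD; last exact: cvg_cst.
  have -> : 4 = (1 + Q p) * (1 + Q p) by rewrite Qp; lra.
  under eq_fun do rewrite expr2.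
  by apply: cvgM; apply: cvgD; (exact: cvg_cst || exact: sa).
have [m _ /(_ m (leqnn m)) fm] := @cvgr_gt _ _ _ _ _ _ fC _ pn.
have fcont : {for p, continuous (fun x => f x m)}.
  apply: cvgM; first exact: cvg_id.
  apply: cvgD; last exact: pdc.
  under eq_fun do rewrite expr2.
  by apply: cvgM; (apply: cvgD; [exact: cvg_cst | exact: pac]).
have := continuous_gt_near fcont fm; apply: filterS => x fx x01.
have sa' := Qsum x01.
have [t' st'] := doubled_sum x01 r01 sa'.
case: (unsigned_dichotomy x01 sa' (projT2 (cid (crossing_prob_sum x01 r01 sa'))) st') => // e.
have a0 := hits_prob_ge0 x01 r01.
have h1 := sums_to_ge m a0 sa'; have h0 := partial_sum_ge0 m a0.
have h2 := sums_to_ge n (doubled_ge0 _) st'.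
have x0 : 0 <= x by case/andP: x01.
have h3 : (1 + partial_sum (a x) m) ^+ 2 <= (1 + Q x) ^+ 2.
  by apply: lerXn2r; rewrite ?nnegrE; lra.
have h4 := ler_wpM2l x0 (lerD h3 h2).
by rewrite /f in fx; lra.
Qed.

Lemma unsigned_supercritical (p0 : R) (n : nat) : 0 < p0 ->
  (forall p, p0 <= p <= 1 -> 1 < p * (4 + partial_sum (doubled (a p)) n)) ->
  forall p, p0 <= p <= 1 -> Q p < 1.
Proof.
move=> p00 H.
have w p : p0 <= p <= 1 -> 0 <= p <= 1.
  by move=> /andP[? ->]; rewrite andbT; lra.
apply: clopen_interval => [p /w/Qle //||p pp Qp|p pp Qp].
- have p01 : 0 <= (1 : R) <= 1 by rewrite ler01 lexx.
  rewrite lt_neqAle Qle // andbT; apply/negP => /eqP Q1; have sa := Qsum p01.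
  have [C sc] := crossing_prob_sum p01 r01 sa; have [t st] := doubled_sum p01 r01 sa.
  (* With [p = 1], the value [q = 1] would give 2 C + t = -1. *)
  have := crossing_total p01 sa sc st; rewrite Q1 eqxx.
  have := sums_to_ge 0 (crossing_prob_ge0 p01 r01) sc.
  have := sums_to_ge 0 (doubled_ge0 _) st.
  by rewrite /partial_sum !big_ord0; lra.
- have p1 : 0 < p <= 1 by case/andP: pp => ? ->; rewrite andbT; lra.
  by have := unsigned_lt1_near p1 Qp; apply: filterS => x Hx /w.
- have := unsigned_eq1_near (w _ pp) Qp (H _ pp).
  by apply: filterS => x Hx /w.
Qed.

End unsigned.

(** * Certified lower bounds on the mass *)

Section interval_recursion.
Variable R : realType.
Implicit Types x y : nat -> R.

(** The convolution at [n.+1] without its two vanishing end terms. This keeps index [n.+1] off the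
    right-hand side, so the recursion can be evaluated step by step. *)
Definition cross x y (n : nat) : R := \sum_(i < n) x i.+1 * y (n - i)%N.

(** For [rho = 0], twice the sum over pairs [d <= d'] of length [m] in the second recursion. *)
Definition pair_mass x (m : nat) : R := conv x x m + doubled x m.

Lemma conv_cross x y n : x 0%N = 0 -> y 0%N = 0 -> conv x y n.+1 = cross x y n.
Proof.
move=> x0 y0; rewrite /conv big_ord_recl x0 mul0r add0r big_ord_recr /= subnn y0 mulr0 addr0.
by apply: eq_bigr => i _; rewrite /bump /= add1n subSS.
Qed.

Lemma conv_scale (k l : R) x y n :
  conv (fun i => k * x i) (fun i => l * y i) n = k * l * conv x y n.
Proof. by rewrite /conv mulr_sumr; apply: eq_bigr => i _; ring. Qed.

Lemma doubled_scale (k : R) x n : doubled (fun i => k * x i) n = k ^+ 2 * doubled x n.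
Proof. by rewrite /doubled; case: ifP => _; rewrite ?mulr0 // exprMn. Qed.

Lemma conv_le x x' y y' n :
  (forall i, (i <= n)%N -> 0 <= x i <= x' i) -> (forall i, (i <= n)%N -> 0 <= y i <= y' i) ->
  0 <= conv x y n <= conv x' y' n.
Proof.
move=> hx hy; apply/andP; split.
  apply: sumr_ge0 => i _; have /andP[x0 _] := hx i (leq_ord i).
  by have /andP[y0 _] := hy (n - i)%N (leq_subr _ _); apply: mulr_ge0.
apply: ler_sum => i _; have /andP[x0 xx] := hx i (leq_ord i).
by have /andP[y0 yy] := hy (n - i)%N (leq_subr _ _); apply: ler_pM.
Qed.

Lemma cross_le x x' y y' n :
  (forall i, (i <= n)%N -> 0 <= x i <= x' i) -> (forall i, (i <= n)%N -> 0 <= y i <= y' i) ->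
  cross x y n <= cross x' y' n.
Proof.
move=> hx hy; apply: ler_sum => i _; have /andP[x0 xx] := hx i.+1 (ltn_ord i).
by have /andP[y0 yy] := hy (n - i)%N (leq_subr _ _); apply: ler_pM.
Qed.

Lemma doubled_le x x' n : (forall i, (i <= n)%N -> 0 <= x i <= x' i) ->
  0 <= doubled x n <= doubled x' n.
Proof.
move=> hx; rewrite doubled_ge0 /doubled /=; case: ifP => // _.
have /andP[x0 xx] : 0 <= x n./2 <= x' n./2 by apply: hx; lia.
by apply: lerXn2r; rewrite ?nnegrE //; apply: le_trans xx.
Qed.

Lemma pair_mass_le x x' n : (forall i, (i <= n)%N -> 0 <= x i <= x' i) ->
  0 <= pair_mass x n <= pair_mass x' n.
Proof.
move=> hx; have /andP[c0 cc] := conv_le hx hx; have /andP[d0 dd] := doubled_le hx.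
by rewrite addr_ge0 //= lerD.
Qed.

Lemma doubled_conv_le x n : (forall i, 0 <= x i) -> doubled x n <= conv x x n.
Proof.
move=> x0; rewrite conv_half lerDr mulr_ge0 //; apply: sumr_ge0 => i _.
exact: mulr_ge0.
Qed.

(** With [c] for [conv a a], [d] for [doubled a] and [e] for [conv (doubled a) a], all scaled by
    powers of [D], this expression gathers the terms with factor [p] in the first recursion, doubled
    to clear denominators. *)
Lemma scaled_mass_ge0 (c d D e : R) :
  d <= c -> 0 <= c -> 0 <= D -> 0 <= e -> 0 <= (3 * c - d) * D + 2 * e.
Proof.
move=> dc c0 D0 e0; have : 0 <= (3 * c - d) * D by apply: mulr_ge0; lra.
by lra.
Qed.

Lemma scaled_mass_le (c c' d d' D e e' : R) : 0 <= D -> c <= c' -> d' <= d -> e <= e' ->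
  (3 * c - d) * D + 2 * e <= (3 * c' - d') * D + 2 * e'.
Proof.
move=> D0 cc dd ee; have : (3 * c - d) * D <= (3 * c' - d') * D.
  by apply: ler_wpM2r; lra.
by lra.
Qed.

(** Stated for abstract numbers so that [lra] meets no convolution. The subtracted term with [d] is
    moved across the inequality, because the checks run over naturals, where subtraction
    truncates. *)
Lemma lower_step (Z z L c d e D n1 n1' Y X x : R) : Z = n1 + Y + X ->
  z + L * d * D <= n1' + L * (3 * c * D + 2 * e) + x ->
  L * ((3 * c - d) * D + 2 * e) <= Y -> n1' <= n1 -> x <= X -> z <= Z.
Proof. by move=> *; lra. Qed.

Lemma upper_step (Z z U c d e D n1 n1' Y X x : R) : Z = n1 + Y + X ->
  n1' + U * (3 * c * D + 2 * e) + x <= z + U * d * D ->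
  Y <= U * ((3 * c - d) * D + 2 * e) -> n1 <= n1' -> X <= x -> Z <= z.
Proof. by move=> *; lra. Qed.

Lemma lower_remainder (Z z W w Q q : R) : Z + W = Q -> z + w <= q -> W <= w -> q <= Q -> z <= Z.
Proof. by move=> *; lra. Qed.

Lemma upper_remainder (Z z W w Q q : R) : Z + W = Q -> q <= z + w -> w <= W -> Q <= q -> Z <= z.
Proof. by move=> *; lra. Qed.

Variables (D p L U : R) (al ah cl ch : nat -> R) (N : nat).
Hypothesis D0 : 0 < D.
Hypothesis LU : 0 <= L <= D * p /\ D * p <= U <= D.
Hypothesis base : al 0%N = 0 /\ ah 0%N = 0 /\ cl 0%N = 0 /\ ch 0%N = 0.
Hypothesis al0 : forall i, 0 <= al i.
Hypothesis cl0 : forall i, 0 <= cl i.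

(** The alternative covers the indices at which the rule yields no positive lower bound. *)
Hypothesis check_cl : forall n, (n < N)%N -> cl n.+1 = 0 \/
  2 * D ^+ 3 * cl n.+1 + U * conv (pair_mass ah) ah n <= (D - U) * al n * D ^+ 2.
Hypothesis check_ch : forall n, (n < N)%N ->
  (D - L) * ah n * D ^+ 2 <= 2 * D ^+ 3 * ch n.+1 + L * conv (pair_mass al) al n.
Hypothesis check_al : forall n, (n < N)%N ->
  2 * D ^+ 3 * al n.+1 + L * doubled ah n * D <= (n == 0)%:R * (D - U) * D ^+ 3
    + L * (3 * conv al al n * D + 2 * conv (doubled al) al n) + 2 * D ^+ 2 * cross cl al n.
Hypothesis check_ah : forall n, (n < N)%N ->
  (n == 0)%:R * (D - L) * D ^+ 3
    + U * (3 * conv ah ah n * D + 2 * conv (doubled ah) ah n) + 2 * D ^+ 2 * cross ch ah n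
  <= 2 * D ^+ 3 * ah n.+1 + U * doubled al n * D.

Local Notation A := (fun n => D * hits_prob p 0 n).
Local Notation B := (fun n => D * crossing_prob p 0 n).

Let p01 : 0 <= p <= 1.
Proof.
have [/andP[L0 Lp] /andP[pU UD]] := LU; apply/andP; split.
  by rewrite -(pmulr_rge0 _ D0); lra.
by rewrite -(ler_pM2l D0); lra.
Qed.

Let r01 : 0 <= (0 : R) <= 1. Proof. by rewrite lexx ler01. Qed.

Let A0 n : 0 <= A n.
Proof. by apply: mulr_ge0; [exact: ltW | apply: hits_prob_ge0]. Qed.

Let B0 n : 0 <= B n.
Proof. by apply: mulr_ge0; [exact: ltW | apply: crossing_prob_ge0]. Qed.

Lemma scaled_crossing n : 2 * D ^+ 3 * B n.+1 + D * p * conv (pair_mass A) A n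
  = (D - D * p) * A n * D ^+ 2.
Proof.
have e := crossing_prob_conv p 0 n.
have eP : conv (pair_mass A) A n = 2 * D ^+ 3 *
    conv (fun m => (conv (hits_prob p 0) (hits_prob p 0) m - doubled (hits_prob p 0) m) / 2 +
      (1 - 0 / 2) * doubled (hits_prob p 0) m) (hits_prob p 0) n.
  rewrite /conv mulr_sumr; apply: eq_bigr => i _.
  by rewrite -/(conv _ _ i) /pair_mass conv_scale doubled_scale; field.
rewrite eP; move: (conv _ _ n) e => X e.
have -> : (D - D * p) * (D * hits_prob p 0 n) * D ^+ 2 =
   2 * D ^+ 4 * ((1 - p) / 2 * hits_prob p 0 n) by field.
by rewrite e; ring.
Qed.

Lemma scaled_hits n : 2 * D ^+ 3 * A n.+1 = (n == 0)%:R * (D - D * p) * D ^+ 3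
  + D * p * ((3 * conv A A n - doubled A n) * D + 2 * conv (doubled A) A n)
  + 2 * D ^+ 2 * cross B A n.
Proof.
have e := hits_prob_conv p 0 n.
rewrite -conv_cross ?hits_prob0 ?crossing_prob0 ?mulr0 // !conv_scale doubled_scale e.
have -> : conv (doubled A) A n = D ^+ 3 * conv (doubled (hits_prob p 0)) (hits_prob p 0) n.
  by rewrite /conv mulr_sumr; apply: eq_bigr => i _; rewrite doubled_scale; ring.
by field.
Qed.

(** Interval arithmetic by induction: each quantity entering with a minus sign is replaced by its
    opposite bound, and [D * p] by [L] or [U] accordingly. *)
Lemma interval_bounds n : (n <= N)%N -> forall i, (i <= n)%N ->
  al i <= A i <= ah i /\ cl i <= B i <= ch i.
Proof.
have [/andP[L0 Lp] /andP[pU UD]] := LU; have [a0 [a0' [c0 c0']]] := base.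
have U0 : 0 <= U by lra.
have P0 : 0 <= D * p by lra.
have DU0 : 0 <= D - U by lra.
have DP0 : 0 <= D - D * p by lra.
have DUP : D - U <= D - D * p by lra.
have DPL : D - D * p <= D - L by lra.
have D1 := ltW D0.
have D2 : 0 < D ^+ 2 by apply: exprn_gt0.
have D3 : 0 < D ^+ 3 by apply: exprn_gt0.
have D2' : 0 <= 2 * D ^+ 2 by apply: mulr_ge0 => //; exact: ltW.
have D3' : 0 < 2 * D ^+ 3 by apply: mulr_gt0.
elim: n => [_ i|n IH nN i].
  rewrite leqn0 => /eqP ->.
  by rewrite a0 a0' c0 c0' hits_prob0 crossing_prob0 mulr0 lexx.
rewrite leq_eqVlt => /orP[/eqP ->|]; last by rewrite ltnS; apply: IH; exact: ltnW.
have {}IH i' := IH (ltnW nN) i'.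
have hl i' : (i' <= n)%N -> 0 <= al i' <= A i' by move=> /IH[/andP[? _] _]; rewrite al0.
have hh i' : (i' <= n)%N -> 0 <= A i' <= ah i' by move=> /IH[/andP[_ ?] _]; rewrite A0.
have gl i' : (i' <= n)%N -> 0 <= cl i' <= B i' by move=> /IH[_ /andP[? _]]; rewrite cl0.
have gh i' : (i' <= n)%N -> 0 <= B i' <= ch i' by move=> /IH[_ /andP[_ ?]]; rewrite B0.
have [/andP[_ al_A] /andP[_ A_ah]] := (hl n (leqnn n), hh n (leqnn n)).
have ml i' : (i' <= n)%N -> 0 <= pair_mass al i' <= pair_mass A i'.
  by move=> i'n; apply: pair_mass_le => j ji; apply: hl; apply: leq_trans i'n.
have mh i' : (i' <= n)%N -> 0 <= pair_mass A i' <= pair_mass ah i'.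
  by move=> i'n; apply: pair_mass_le => j ji; apply: hh; apply: leq_trans i'n.
have /andP[m0 ml'] := conv_le ml hl; have /andP[m0' mh'] := conv_le mh hh.
have dl i' : (i' <= n)%N -> 0 <= doubled al i' <= doubled A i'.
  by move=> i'n; apply: doubled_le => j ji; apply: hl; apply: leq_trans i'n.
have dh i' : (i' <= n)%N -> 0 <= doubled A i' <= doubled ah i'.
  by move=> i'n; apply: doubled_le => j ji; apply: hh; apply: leq_trans i'n.
have [/andP[d0 dl'] /andP[d0' dh']] := (dl n (leqnn n), dh n (leqnn n)).
have /andP[_ al'] := conv_le hl hl; have /andP[a0h ah'] := conv_le hh hh.
have /andP[_ el'] := conv_le dl hl; have /andP[e0h eh'] := conv_le dh hh.
have xl := ler_wpM2l D2' (cross_le gl hl); have xh := ler_wpM2l D2' (cross_le gh hh).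
set Y := (3 * conv A A n - doubled A n) * D + 2 * conv (doubled A) A n.
have Y0 : 0 <= Y by apply: scaled_mass_ge0 => //; exact: doubled_conv_le.
have Yl := scaled_mass_le D1 al' dh' el'; have Yh := scaled_mass_le D1 ah' dl' eh'.
have LY := le_trans (ler_wpM2l L0 Yl) (ler_wpM2r Y0 Lp).
have UY := le_trans (ler_wpM2r Y0 pU) (ler_wpM2l U0 Yh).
have n01 : 0 <= ((n == 0)%:R : R) by rewrite ler0n.
have nl : (n == 0)%:R * (D - U) * D ^+ 3 <= (n == 0)%:R * (D - D * p) * D ^+ 3.
  by rewrite ler_pM2r //; apply: ler_wpM2l.
have nh : (n == 0)%:R * (D - D * p) * D ^+ 3 <= (n == 0)%:R * (D - L) * D ^+ 3.
  by rewrite ler_pM2r //; apply: ler_wpM2l.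
have pl : L * conv (pair_mass al) al n <= D * p * conv (pair_mass A) A n.
  exact: ler_pM.
have ph : D * p * conv (pair_mass A) A n <= U * conv (pair_mass ah) ah n.
  exact: ler_pM.
have ql : (D - U) * al n * D ^+ 2 <= (D - D * p) * A n * D ^+ 2.
  by rewrite ler_pM2r //; apply: ler_pM.
have qh : (D - D * p) * A n * D ^+ 2 <= (D - L) * ah n * D ^+ 2.
  by rewrite ler_pM2r //; apply: ler_pM => //; exact: A0.
split; apply/andP; split; rewrite -(ler_pM2l D3').
- exact: lower_step (scaled_hits n) (check_al nN) LY nl xl.
- exact: upper_step (scaled_hits n) (check_ah nN) UY nh xh.
- case: (check_cl nN) => [->|k1]; first by rewrite mulr0; apply: mulr_ge0; [exact: ltW|exact: B0].
  exact: lower_remainder (scaled_crossing n) k1 ph ql.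
- exact: upper_remainder (scaled_crossing n) (check_ch nN) pl qh.
Qed.

(** The first [N.*2.+1] terms of [doubled] involve exactly the indices up to [N], those for which
    bounds are available. *)
Lemma interval_conclusion : D ^+ 3 < L * (4 * D ^+ 2 + partial_sum (doubled al) N.*2.+1) ->
  1 < p * (4 + partial_sum (doubled (hits_prob p 0)) N.*2.+1).
Proof.
have [/andP[L0 Lp] /andP[pU UD]] := LU => H.
have le : partial_sum (doubled al) N.*2.+1 <= D ^+ 2 * partial_sum (doubled (hits_prob p 0)) N.*2.+1.
  rewrite /partial_sum mulr_sumr; apply: ler_sum => i _; rewrite -doubled_scale.
  have iN : (i./2 <= N)%N by have := ltn_ord i; lia.
  have [/andP[al_A _] _] := interval_bounds (leqnn N) iN.
  rewrite /doubled; case: ifP => // _; apply: lerXn2r; rewrite ?nnegrE //.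
have D3 : 0 < D ^+ 3 by apply: exprn_gt0.
rewrite -(ltr_pM2l D3) mulr1; apply: (lt_le_trans H).
have p0 : 0 <= partial_sum (doubled al) N.*2.+1 by apply: partial_sum_ge0 => i; exact: doubled_ge0.
have D2 : 0 < D ^+ 2 by apply: exprn_gt0.
apply: (@le_trans _ _ (D * p * (4 * D ^+ 2 + D ^+ 2 * partial_sum (doubled (hits_prob p 0)) N.*2.+1))).
  by apply: ler_pM => //; lra.
by rewrite le_eqVlt; apply/orP; left; apply/eqP; ring.
Qed.

End interval_recursion.

(** * Binary arithmetic for the certificates *)

Section binary_numbers.
Variable R : realType.

(** Following the binary digits lets a numeral unfold to a short expression that [lra] can handle;
    unary numbers appear only inside proofs. *)
Fixpoint pos_real (x : positive) : R :=
  match x with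
  | xH => 1
  | xO y => 2 * pos_real y
  | xI y => 2 * pos_real y + 1
  end.

Definition bin_real (x : N) : R := if x is N.pos y then pos_real y else 0.

Lemma pos_realE (x : positive) : pos_real x = (Pos.to_nat x)%:R.
Proof.
elim: x => [y|y|] /=; last by [].
  have -> : Pos.to_nat (xI y) = (Pos.to_nat y + Pos.to_nat y).+1 by lia.
  by move=> ->; rewrite -[RHS]natr1 natrD; ring.
have -> : Pos.to_nat (xO y) = (Pos.to_nat y + Pos.to_nat y)%N by lia.
by move=> ->; rewrite natrD; ring.
Qed.

Lemma bin_realE (x : N) : bin_real x = (N.to_nat x)%:R.
Proof. by case: x => //= y; rewrite pos_realE. Qed.

Lemma bin_real_ge0 (x : N) : 0 <= bin_real x.
Proof. by rewrite bin_realE ler0n. Qed.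

Lemma bin_realD (x y : N) : bin_real (N.add x y) = bin_real x + bin_real y.
Proof. by rewrite !bin_realE -natrD N2Nat.inj_add plusE. Qed.

Lemma bin_realM (x y : N) : bin_real (N.mul x y) = bin_real x * bin_real y.
Proof. by rewrite !bin_realE -natrM N2Nat.inj_mul multE. Qed.

Lemma bin_realB (x y : N) : N.leb y x -> bin_real (N.sub x y) = bin_real x - bin_real y.
Proof.
move=> /N.leb_le yx; rewrite !bin_realE -natrB; last by lia.
by congr (_%:R); lia.
Qed.

Lemma bin_real_le (x y : N) : N.leb x y -> bin_real x <= bin_real y.
Proof. by move=> /N.leb_le xy; rewrite !bin_realE ler_nat; lia. Qed.

Lemma bin_real_lt (x y : N) : N.ltb x y -> bin_real x < bin_real y.
Proof. by move=> /N.ltb_lt xy; rewrite !bin_realE ltr_nat; lia. Qed.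

Definition bin_sum (h : nat -> N) (r : seq nat) : N :=
  foldr (fun i acc => N.add (h i) acc) 0%num r.

Lemma bin_real_sum (h : nat -> N) (n : nat) :
  bin_real (bin_sum h (iota 0 n)) = \sum_(i < n) bin_real (h i).
Proof.
have : bin_real (bin_sum h (iota 0 n)) = \sum_(i <- iota 0 n) bin_real (h i).
  elim: (iota 0 n) => [|i r IH]; first by rewrite big_nil.
  by rewrite big_cons /= bin_realD IH.
by move=> ->; rewrite -[in LHS](subn0 n) -/(index_iota 0 n) big_mkord.
Qed.

Definition bin_conv (f g : nat -> N) (n : nat) : N :=
  bin_sum (fun i => N.mul (f i) (g (n - i)%N)) (iota 0 n.+1).

Definition bin_cross (f g : nat -> N) (n : nat) : N :=
  bin_sum (fun i => N.mul (f i.+1) (g (n - i)%N)) (iota 0 n).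

Definition bin_doubled (f : nat -> N) (n : nat) : N :=
  if odd n then 0%num else N.mul (f n./2) (f n./2).

Definition bin_pair_mass (f : nat -> N) (n : nat) : N := N.add (bin_conv f f n) (bin_doubled f n).

Local Notation real f := (fun i => bin_real (f i)).

Lemma bin_convE (f g : nat -> N) (n : nat) : bin_real (bin_conv f g n) = conv (real f) (real g) n.
Proof. by rewrite bin_real_sum; apply: eq_bigr => i _; rewrite bin_realM. Qed.

Lemma bin_crossE (f g : nat -> N) (n : nat) :
  bin_real (bin_cross f g n) = cross (real f) (real g) n.
Proof. by rewrite bin_real_sum; apply: eq_bigr => i _; rewrite bin_realM. Qed.

Lemma bin_doubledE (f : nat -> N) (n : nat) : bin_real (bin_doubled f n) = doubled (real f) n.
Proof. by rewrite /bin_doubled /doubled; case: ifP => // _; rewrite bin_realM. Qed.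

Lemma bin_pair_massE (f : nat -> N) (n : nat) :
  bin_real (bin_pair_mass f n) = pair_mass (real f) n.
Proof. by rewrite bin_realD bin_convE bin_doubledE. Qed.

(** The hypotheses of [interval_conclusion] in a form that [vm_compute] decides; the four checks
    come in the order [check_cl], [check_ch], [check_al], [check_ah]. *)
Definition bin_enclosure (D L U : N) (tl tu sl su : seq N) (K : nat) : bool :=
  let al := nth 0%num tl in let ah := nth 0%num tu in
  let cl := nth 0%num sl in let ch := nth 0%num su in
  let D2 := N.mul D D in let D3 := N.mul D2 D in
  let check n :=
    let cub x := if n == 0 then N.mul x D3 else 0%num in
    [&& N.eqb (cl n.+1) 0 ||
        N.leb (N.add (N.mul (N.mul 2 D3) (cl n.+1)) (N.mul U (bin_conv (bin_pair_mass ah) ah n)))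
              (N.mul (N.mul (N.sub D U) (al n)) D2),
        N.leb (N.mul (N.mul (N.sub D L) (ah n)) D2)
              (N.add (N.mul (N.mul 2 D3) (ch n.+1)) (N.mul L (bin_conv (bin_pair_mass al) al n))),
        N.leb (N.add (N.mul (N.mul 2 D3) (al n.+1)) (N.mul (N.mul L (bin_doubled ah n)) D))
              (N.add (N.add (cub (N.sub D U))
                 (N.mul L (N.add (N.mul (N.mul 3 (bin_conv al al n)) D)
                                 (N.mul 2 (bin_conv (bin_doubled al) al n)))))
                 (N.mul (N.mul 2 D2) (bin_cross cl al n))) &
        N.leb (N.add (N.add (cub (N.sub D L))
                 (N.mul U (N.add (N.mul (N.mul 3 (bin_conv ah ah n)) D)
                                 (N.mul 2 (bin_conv (bin_doubled ah) ah n)))))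
                 (N.mul (N.mul 2 D2) (bin_cross ch ah n)))
              (N.add (N.mul (N.mul 2 D3) (ah n.+1)) (N.mul (N.mul U (bin_doubled al n)) D))] in
  [&& [&& N.eqb (al 0) 0, N.eqb (ah 0) 0, N.eqb (cl 0) 0 & N.eqb (ch 0) 0],
      [&& N.ltb 0 D, N.leb L D & N.leb U D], all check (iota 0 K) &
      N.ltb D3 (N.mul L (N.add (N.mul 4 D2) (bin_sum (bin_doubled al) (iota 0 K.*2.+1))))].

Lemma bin_conv_pair_massE (f : nat -> N) (n : nat) :
  bin_real (bin_conv (bin_pair_mass f) f n) = conv (pair_mass (real f)) (real f) n.
Proof. by rewrite bin_convE; apply: eq_bigr => i _; rewrite bin_pair_massE. Qed.

Lemma bin_conv_doubledE (f : nat -> N) (n : nat) :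
  bin_real (bin_conv (bin_doubled f) f n) = conv (doubled (real f)) (real f) n.
Proof. by rewrite bin_convE; apply: eq_bigr => i _; rewrite bin_doubledE. Qed.

Lemma bin_enclosureP (D L U : N) (tl tu sl su : seq N) (K : nat) (p : R) :
  bin_enclosure D L U tl tu sl su K ->
  bin_real L <= bin_real D * p <= bin_real U ->
  1 < p * (4 + partial_sum (doubled (hits_prob p 0)) K.*2.+1).
Proof.
rewrite /bin_enclosure => /and4P[/and4P[a0 a0' c0 c0'] /and3P[/bin_real_lt D0 LD UD] /allP H Hc].
move/N.eqb_spec: a0 => a0; move/N.eqb_spec: a0' => a0'.
move/N.eqb_spec: c0 => c0; move/N.eqb_spec: c0' => c0' /andP[Lp pU].
have two : bin_real 2 = 2 by rewrite /= mulr1.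
have three : bin_real 3 = 3 by rewrite /=; ring.
have four : bin_real 4 = 4 by rewrite /=; ring.
have sU := bin_realB UD; have sL := bin_realB LD.
have cub n x : bin_real (if n == 0 then N.mul x (N.mul (N.mul D D) D) else 0%num) =
    (n == 0)%:R * bin_real x * bin_real D ^+ 3.
  by case: (n == 0) => /=; rewrite ?mul0r // !bin_realM; ring.
set al := nth 0%num tl in a0 H Hc; set ah := nth 0%num tu in a0' H.
set cl := nth 0%num sl in c0 H; set ch := nth 0%num su in c0' H.
have rules := (sU, sL, cub, bin_conv_pair_massE, bin_conv_doubledE, bin_convE, bin_crossE,
  bin_doubledE, two, three, four, bin_realD, bin_realM).
have H' n (nK : (n < K)%N) := H n (etrans (mem_iota 0 K n) nK).
apply: (@interval_conclusion R (bin_real D) p (bin_real L) (bin_real U)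
  (real al) (real ah) (real cl) (real ch) K).
- exact: D0.
- by rewrite bin_real_ge0 Lp pU bin_real_le.
- by rewrite a0 a0' c0 c0'.
- by move=> i; exact: bin_real_ge0.
- by move=> i; exact: bin_real_ge0.
- move=> n /H'/and4P[/orP[/N.eqb_spec ->|/bin_real_le h] _ _ _]; first by left.
  by right; rewrite !rules in h; clear -h; lra.
- move=> n /H'/and4P[_ /bin_real_le h _ _].
  by rewrite !rules in h; clear -h; lra.
- move=> n /H'/and4P[_ _ /bin_real_le h _].
  by rewrite !rules in h; clear -h; lra.
- move=> n /H'/and4P[_ _ _ /bin_real_le h].
  by rewrite !rules in h; clear -h; lra.
have e : bin_real (bin_sum (bin_doubled al) (iota 0 K.*2.+1)) =
    partial_sum (doubled (real al)) K.*2.+1.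
  by rewrite bin_real_sum; apply: eq_bigr => i _; rewrite bin_doubledE.
move/bin_real_lt: Hc; move: (bin_sum _ _) e => z e; rewrite !rules e => h.
by clear -h; lra.
Qed.

End binary_numbers.

(* Bounds of 10^6 a_n and 10^6 c_n, n < 25, computed by the two recursions with
   directed rounding: "near" for p in [0.240599, 0.2409], "far" for p in
   [0.2409, 0.25]. *)
Definition near_hits_lower : seq N :=
  [:: 0; 379550; 0; 89323; 13155; 45200; 10489; 27268; 9409; 18872; 7986; 13746; 7082; 10673;
      6195; 8502; 5539; 7027; 4936; 5900; 4457; 5074; 4023; 4409; 3663]%num.
Definition near_hits_upper : seq N :=
  [:: 0; 379701; 0; 89488; 13188; 45366; 10530; 27434; 9464; 19036; 8051; 13912; 7160; 10840;
      6285; 8673; 5641; 7202; 5050; 6081; 4584; 5261; 4163; 4605; 3817]%num.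
Definition near_crossing_lower : seq N :=
  [:: 0; 0; 144058; 0; 20715; 4992; 10939; 3065; 5733; 2515; 3938; 1900; 2624; 1586; 2013; 1285;
      1505; 1095; 1223; 922; 974; 799; 821; 687; 681]%num.
Definition near_crossing_upper : seq N :=
  [:: 0; 0; 144173; 0; 20824; 5008; 11034; 3087; 5827; 2545; 4029; 1935; 2715; 1628; 2105; 1334;
      1598; 1151; 1318; 984; 1073; 868; 923; 763; 788]%num.
Definition far_hits_lower : seq N :=
  [:: 0; 375000; 0; 86197; 12703; 42477; 9935; 24719; 8666; 16459; 7110; 11384; 6046; 8354;
      5023; 6179; 4216; 4694; 3473; 3563; 2843; 2819; 2312; 2238; 1913]%num.
Definition far_hits_upper : seq N :=
  [:: 0; 379550; 0; 91122; 13670; 47372; 11112; 29589; 10239; 21248; 8976; 16204; 8270; 13194;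
      7563; 11118; 7112; 9737; 6709; 8732; 6449; 8036; 6236; 7527; 6116]%num.
Definition far_crossing_lower : seq N :=
  [:: 0; 0; 140625; 0; 18654; 4763; 9365; 2740; 4281; 2094; 2587; 1399; 1296; 999; 712; 618;
      192; 342; 0; 85; 0; 0; 0; 0; 0]%num.
Definition far_crossing_upper : seq N :=
  [:: 0; 0; 144059; 0; 21882; 5189; 12140; 3357; 7011; 2917; 5215; 2396; 3939; 2186; 3346; 1984;
      2881; 1899; 2636; 1829; 2445; 1816; 2347; 1815; 2270]%num.

Lemma near_enclosure : bin_enclosure 1000000%num 240599%num 240900%num
  near_hits_lower near_hits_upper near_crossing_lower near_crossing_upper 24%N.
Proof. by vm_compute. Qed.

Lemma far_enclosure : bin_enclosure 1000000%num 240900%num 250000%num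
  far_hits_lower far_hits_upper far_crossing_lower far_crossing_upper 24%N.
Proof. by vm_compute. Qed.

Lemma hits_prob1 (R : realType) (p rho : R) : hits_prob p rho 1 = (1 - p) / 2.
Proof.
rewrite hits_prob_conv /conv !big_ord_recr !big_ord0 /= /doubled /= hits_prob0 crossing_prob0.
by rewrite expr2; ring.
Qed.

(** At the left end the sum exceeds what is needed by an amount of order 10^-5 only, which calls for
    a narrow first interval; a coarse one suffices up to 1/4, beyond which [4 * p] alone exceeds 1.
    Starting 10^-6 below 0.2406 makes the final bound strict. *)
Lemma doubled_mass_gt (R : realType) (p : R) : 2406 / 10 ^+ 4 - 1 / 10 ^+ 6 <= p <= 1 ->
  1 < p * (4 + partial_sum (doubled (hits_prob p 0)) 49).
Proof.
move=> /andP[pl p1].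
have [pn|pn] := leP p (2409 / 10 ^+ 4).
  by apply: (bin_enclosureP near_enclosure); apply/andP; split=> /=; lra.
have [pf|pf] := leP p (1 / 4).
  by apply: (bin_enclosureP far_enclosure); apply/andP; split=> /=; lra.
have p0 : 0 < p by lra.
have d0 := doubled_ge0 (hits_prob p 0).
have : doubled (hits_prob p 0) 2 <= partial_sum (doubled (hits_prob p 0)) 49.
  apply: (@le_trans _ _ (partial_sum (doubled (hits_prob p 0)) 3)).
    by rewrite partial_sumS lerDr partial_sum_ge0.
  exact: partial_sum_homo.
have -> : doubled (hits_prob p 0) 2 = ((1 - p) / 2) ^+ 2 by rewrite /doubled /= hits_prob1.
move=> h; have := sqr_ge0 ((1 - p) / 2) => h'.
have : p * 4 <= p * (4 + partial_sum (doubled (hits_prob p 0)) 49).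
  by rewrite ler_pM2l //; lra.
by lra.
Qed.

(** * The subcritical bound *)

(* Without spared particles, a static or right-moving neighbour on the left of
   [n] would stop it. *)
Lemma hits_neighbour (V : int -> int) (n : nat) :
  (forall m, V m = -1 \/ V m = 0 \/ V m = 1) -> hits V (fun=> 0) 0 n.+2 ->
  V n.+1%:Z = -1.
Proof.
move=> HV hn; have An k := hits_survivor HV k hn; rewrite add0r in An.
have [_ Vn _ _] := hn; rewrite add0r in Vn.
have nospare A k m : ~ spared V (fun=> 0) A k m by move=> [i [j [_ _ _ _ /=]]]; lia.
have p1 k := posP HV k n.+1%:Z; have p2 k := posP HV k n.+2%:Z.
have B0 : alive (block 0 n.+2) V (fun=> 0) 0 n.+1%:Z by rewrite /= /block /=; lia.
case: (HV n.+1%:Z) => [//|[V0|V1]]; exfalso.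
- have B1 : alive (block 0 n.+2) V (fun=> 0) 1 n.+1%:Z.
    rewrite aliveS; split=> //; left; apply/met0P => m _ em.
    by have := posP HV 1 m; have := p1 1%N; lia.
  have /aliveS[_ [/met0P /(_ _ B1)|/nospare //]] := An 2%N.
  by have := p1 2%N; have := p2 2%N; lia.
- have /aliveS[_ [/met0P /(_ _ B0)|/nospare //]] := An 1%N.
  by have := p1 1%N; have := p2 1%N; lia.
Qed.

Section subcritical.
Variables (R : realType) (p : R).
Hypothesis p01 : 0 <= p <= 1.
Local Notation alpha := ((1 - p) / 2).
Local Notation Pr := (word_prob p 0).
Local Notation a := (hits_prob p 0).

Let r01 : 0 <= (0 : R) <= 1. Proof. by rewrite lexx ler01. Qed.

(** At [rho = 0], words containing a nonzero sign have weight 0. *)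
Lemma expect_le_unsigned (n : nat) (F G : seq (int * int) -> R) :
  (forall w, good_word n w -> all (fun l => l.2 == 0) w -> F w <= G w) ->
  expect p 0 n F <= expect p 0 n G.
Proof.
elim: n F G => [|n IH] F G FG /=; first exact: FG.
rewrite big_seq [leRHS]big_seq; apply: ler_sum => l lA.
have [l0|l0] := boolP (l.2 == 0); last by rewrite /weight (negbTE l0) mul0r mulr0 !mul0r.
apply: ler_wpM2l; first exact: weight_ge0.
apply: IH => w [sw aw] zw; apply: FG; last by rewrite /= l0.
by split; rewrite /= ?sw // lA.
Qed.

(** The first particle is not left-moving, or it would arrive first, and the last two are
    left-moving by [hits_neighbour]; these three letters are independent. *)
Lemma hits_prob_le (m : nat) : a m.+3 <= (1 - alpha) * alpha ^+ 2.
Proof.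
pose L (f : int -> bool) := fun (V S : int -> int) => f (V 1) : Prop.
have LL f : local 1 (L f) by move=> V S V' S' H; rewrite /L; have [|-> _] := H 1.
have LT : local m (fun _ _ => True) by [].
have E1 := word_prob_shift p 0 (LL (fun x => x == -1)) (LL (fun x => x == -1)).
have E2 := word_prob_shift p 0 LT (local_and_shift (LL (fun x => x == -1)) (LL (fun x => x == -1))).
have E3 := word_prob_shift p 0 (LL (fun x => x != -1))
  (local_and_shift LT (local_and_shift (LL (fun x => x == -1)) (LL (fun x => x == -1)))).
have T : Pr m (fun _ _ => True) = 1.
  by rewrite -[RHS](expect1 p 0 m); apply: expect_ext => w _; rewrite asboolT.
have N : Pr 1 (L (fun x => x != -1)) = 1 - alpha.
  rewrite (word_prob_letter p 0 (fun x _ => x != -1)) /weight /alphabet /=.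
  by rewrite !big_cons big_nil /=; field.
have PL : Pr 1 (L (fun x => x == -1)) = alpha := prob_left p 0.
rewrite E2 E1 N T PL mul1r -expr2 in E3; rewrite -E3.
have -> : (1 + (m + (1 + 1)))%N = m.+3 by lia.
apply: expect_le_unsigned => w gw zw; rewrite ler_nat.
case: (asboolP (hits _ _ _ _)) => // h; rewrite asboolT // /L.
have HV := word_velocities gw.
have S0 : word_s w = (fun=> 0).
  apply/funext => -[[|k]|k] //=; have [kw|kw] := ltnP k (size w).
    by apply/eqP; apply: (allP zw); apply: mem_nth.
  by rewrite nth_default.
rewrite S0 in h; have [_ Vn _ _] := h.
have Vn' := hits_neighbour HV h.
rewrite !shift_shift /shiftz.
have -> : (1 + (m + 1)%N%:Z) = m.+2%:Z by lia.
have -> : (1 + (1 + (m + 1))%N%:Z) = m.+3%:Z by lia.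
rewrite add0r in Vn; rewrite Vn Vn'; split=> //.
by apply/negP => /eqP /(hits_left _ HV m.+3) /iffLR /(_ h).
Qed.

Lemma partial_sum_doubled (x : nat -> R) (n : nat) :
  partial_sum (doubled x) n.*2 = partial_sum (fun i => x i ^+ 2) n.
Proof.
elim: n => [|n IH]; first by rewrite /partial_sum !big_ord0.
by rewrite doubleS !partial_sumS IH /doubled /= odd_double /= doubleK addr0.
Qed.

Lemma hits_prob2 : a 2 = 0.
Proof.
have c1 : crossing_prob p 0 1 = 0.
  have := crossing_prob_conv p 0 0; rewrite /conv !big_ord_recr !big_ord0 /= hits_prob0.
  by lra.
rewrite hits_prob_conv /conv !big_ord_recr !big_ord0 /= /doubled /= hits_prob0 c1.
by rewrite crossing_prob0; ring.
Qed.

Lemma subcritical (q : R) : sums_to a q -> q <= 1 -> p <= 236 / 10 ^+ 3 -> q = 1.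
Proof.
move=> sa q1 pc; have [p0 p1] := andP p01.
have [t st] := doubled_sum p01 r01 sa; have [C sc] := crossing_prob_sum p01 r01 sa.
case: (unsigned_dichotomy p01 sa sc st) => // e; exfalso.
have a0 := hits_prob_ge0 p01 r01.
set M := (1 - alpha) * alpha ^+ 2.
have M0 : 0 <= M by apply: mulr_ge0; [lra | exact: sqr_ge0].
(* [M] dominates [a i] for [i >= 2] ([a 2] is 0); the indicator corrects the term [a 1 = alpha]. *)
have sq i : a i ^+ 2 <= M * a i + (i == 1)%:R * (alpha ^+ 2 - M * alpha).
  case: i => [|[|[|i]]].
  - by rewrite hits_prob0 expr2 !mulr0 mul0r addr0.
  - by rewrite hits_prob1 /=; lra.
  - by rewrite hits_prob2 expr2 !mulr0 mul0r addr0.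
  - have -> : (i.+3 == 1) = false by [].
    by rewrite mulr0n mul0r addr0 expr2; apply: ler_wpM2r => //; apply: hits_prob_le.
have al0 : 0 <= alpha ^+ 2 - M * alpha.
  have -> : alpha ^+ 2 - M * alpha = alpha ^+ 2 * (1 - (1 - alpha) * alpha) by rewrite /M; ring.
  by apply: mulr_ge0; [exact: sqr_ge0 | nra].
have tM : t <= M * q + (alpha ^+ 2 - M * alpha).
  apply: (sums_to_le _ st) => n.
  apply: (@le_trans _ _ (partial_sum (doubled a) n.*2)).
    by apply: partial_sum_homo; [exact: doubled_ge0 | lia].
  rewrite partial_sum_doubled.
  apply: (@le_trans _ _ (M * partial_sum a n + (alpha ^+ 2 - M * alpha))).
    apply: (@le_trans _ _ (\sum_(i < n) (M * a i + (i == 1 :> nat)%:R * (alpha ^+ 2 - M * alpha)))).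
      by apply: ler_sum.
    rewrite big_split /= -mulr_sumr lerD2l.
    have [n1|n1] := ltnP 1 n.
      rewrite (bigD1 (Ordinal n1)) //= mul1r big1 ?addr0 // => i.
      by rewrite -val_eqE /= => /negbTE ->; rewrite mul0r.
    rewrite big1 // => i _; have := ltn_ord i.
    by case: eqP => [->|_]; [lia | rewrite mul0r].
  rewrite lerD2r; apply: ler_wpM2l => //; exact: sums_to_ge.
have tM' : t <= alpha ^+ 2 * (1 + (1 - alpha) ^+ 2).
  apply: (le_trans tM).
  have : M * q <= M by rewrite -[leRHS]mulr1; apply: ler_wpM2l.
  have -> : alpha ^+ 2 * (1 + (1 - alpha) ^+ 2) = alpha ^+ 2 - M * alpha + M by rewrite /M; ring.
  by lra.
have q0 : 0 <= q.
  by have := sums_to_ge 0 a0 sa; rewrite /partial_sum big_ord0.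
have q4 : (1 + q) ^+ 2 <= 4 by rewrite expr2; nra.
have bound : alpha ^+ 2 * (1 + (1 - alpha) ^+ 2) <= (1 - p) ^+ 2 / 4 * (1 + (1 + p) ^+ 2 / 4).
  by rewrite le_eqVlt; apply/orP; left; apply/eqP; field.
have : p * ((1 + q) ^+ 2 + t) <= p * (4 + (1 - p) ^+ 2 / 4 * (1 + (1 + p) ^+ 2 / 4)).
  by apply: ler_wpM2l => //; lra.
rewrite e; apply/negP; rewrite -ltNge.
(* At 0.236 the left side is about 0.382. As p (1 - p)^2 increases up to p = 1/3, it is at most its
   value at 0.236, about 0.1378; the total is then below 0.944 + 0.0483 < 1. *)
have b1 : (1 + p) ^+ 2 / 4 <= 2 / 5 by rewrite expr2; nra.
have b0 : 0 <= (1 - p) ^+ 2 / 4 by rewrite expr2; nra.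
have b2 : (1 - p) ^+ 2 / 4 * (1 + (1 + p) ^+ 2 / 4) <= (1 - p) ^+ 2 / 4 * (7 / 5).
  by apply: ler_wpM2l => //; lra.
have : p * ((1 - p) ^+ 2 / 4 * (1 + (1 + p) ^+ 2 / 4)) <= p * ((1 - p) ^+ 2 / 4 * (7 / 5)).
  exact: ler_wpM2l.
have b3 : p * (1 - p) ^+ 2 <= 236 / 10 ^+ 3 * (1 - 236 / 10 ^+ 3) ^+ 2.
  by rewrite !expr2; nra.
by move=> b4; rewrite mulrDr; nra.
Qed.

End subcritical.

Lemma reach_prob_le1 (d : measure_display) (T : measurableType d) (R : realType)
    (P : probability T R) (v s : int -> {mfun T >-> int}) : reach_prob P v s <= 1.
Proof.
rewrite -(prT P); apply: le_pr => //; exact: event_reaches0.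
Qed.

Lemma reach_prob_sums (d : measure_display) (T : measurableType d) (R : realType)
    (P : probability T R) (v s : int -> {mfun T >-> int}) (p rho : R) :
  word_law P v s p rho -> sums_to (hits_prob p rho) (reach_prob P v s).
Proof.
by move=> law; have := reach_prob_cvg law; under eq_fun do rewrite big_mkord.
Qed.

Theorem corollary20 (R : realType) (d : measure_display) (T : measurableType d)
    (P : R -> probability T R) (v s : int -> {mfun T >-> int})
    (law : forall p : R, 0 <= p <= 1 -> ballistic_law p (P p) v s) :
  (forall p : R, 1 / 4 <= p < 1 ->
     q_hat (P p) v < q (P p) v s /\ theta (P p) v s < psi (P p) v) /\
  [/\ 2354 / 10 ^+ 4 < pc_hat_minus P v,
      pc_hat_minus P v <= pc_hat_plus P v &
      pc_hat_plus P v < 2406 / 10 ^+ 4].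
Proof.
pose Q (p : R) := reach_prob (P p) v (fun=> cst 0).
have Qsum (p : R) : 0 <= p <= 1 -> sums_to (hits_prob p 0) (Q p).
  by move=> /law/unsigned_word_law/reach_prob_sums.
have Qle (p : R) : 0 <= p <= 1 -> Q p <= 1 by move=> _; exact: reach_prob_le1.
have psiE (p : R) : 0 <= p <= 1 -> psi (P p) v = p * (1 - Q p) ^+ 2 / p.
  by move=> /law; exact: psi_reach.
pose p1 : R := 2406 / 10 ^+ 4 - 1 / 10 ^+ 6.
have p1E : p1 = 2406 / 10 ^+ 4 - 1 / 10 ^+ 6 by [].
have super (p : R) : p1 <= p <= 1 -> Q p < 1.
  apply: (unsigned_supercritical Qsum Qle (n := 49)); first by rewrite p1E; lra.
  exact: doubled_mass_gt.
have sub (p : R) : 0 <= p <= 236 / 10 ^+ 3 -> Q p = 1.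
  move=> /andP[p0 pc]; have p01 : 0 <= p <= 1 by rewrite p0 /=; lra.
  exact: (subcritical p01 (Qsum p p01) (Qle p p01) pc).
clearbody p1; split.
  move=> p /andP[pl pu]; have p01 : 0 <= p <= 1 by apply/andP; split; lra.
  have Q1 : Q p < 1 by apply: super; apply/andP; split; lra.
  have sa := Qsum p p01.
  have sb : sums_to (hits_prob p 1) (q (P p) v s).
    exact: (reach_prob_sums (signed_word_law (law p p01))).
  have r01 : 0 <= (0 : R) <= 1 by rewrite lexx ler01.
  have s01 : 0 <= (1 : R) <= 1 by rewrite ler01 lexx.
  have [C sc] := crossing_prob_sum p01 r01 sa; have [t st] := doubled_sum p01 r01 sa.
  have Q0 : 0 <= Q p.
    by have := sums_to_ge 0 (hits_prob_ge0 p01 r01) sa; rewrite /partial_sum big_ord0.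
  have q0 : 0 <= q (P p) v s.
    by have := sums_to_ge 0 (hits_prob_ge0 p01 s01) sb; rewrite /partial_sum big_ord0.
  have q1 : q (P p) v s <= 1 by exact: reach_prob_le1.
  (* The strict comparison needs t > 0; the term a_1^2 provides it, and this is where [p < 1]
     enters. *)
  have t0 : 0 < t.
    apply: (@lt_le_trans _ _ (doubled (hits_prob p 0) 2)).
      by rewrite /doubled /= hits_prob1; apply: exprn_gt0; lra.
    apply: (@le_trans _ _ (partial_sum (doubled (hits_prob p 0)) 3)).
      by rewrite partial_sumS lerDr partial_sum_ge0 //; exact: doubled_ge0.
    by apply: sums_to_ge st; exact: doubled_ge0.
  (* If the main model has q = 1 this is [Q1]. Otherwise both quadratic relations hold, and p t > 0
     makes the root of the alternative model smaller. *)
  have lt : Q p < q (P p) v s.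
    case: (signed_dichotomy p01 sb) => [->//|e'].
    case: (unsigned_dichotomy p01 sa sc st) => [e|e]; first by rewrite e ltxx in Q1.
    rewrite ltNge; apply/negP => qQ; have : 0 < p * t by apply: mulr_gt0 => //; lra.
    have : (1 + q (P p) v s) ^+ 2 <= (1 + Q p) ^+ 2.
      by apply: lerXn2r; rewrite ?nnegrE; [lra | lra | rewrite lerD2l].
    have p0 : 0 < p by lra.
    rewrite -(ler_pM2l p0) e' => h1 h2; rewrite mulrDr in e; lra.
  split; first by rewrite q_hat_reach.
  rewrite psiE // /theta mulrAC mulfV; last by rewrite gt_eqF //; lra.
  by rewrite mul1r; apply: ltrXn2r => //; rewrite ?nnegrE; lra.
(* The numerator vanishes and the quotient by [p] is not simplified, so [p = 0] is included. *)
have psi0 (p : R) : 0 <= p <= 236 / 10 ^+ 3 -> psi (P p) v = 0.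
  move=> pc; rewrite psiE ?sub ?subrr ?expr0n /= ?mulr0 ?mul0r //.
  by case/andP: pc => -> /=; lra.
have psi_gt0 (p : R) : p1 <= p <= 1 -> 0 < psi (P p) v.
  move=> pp; have Q1 := super p pp; have [pl pu] := andP pp.
  rewrite psiE; last by apply/andP; split; lra.
  rewrite mulrAC mulfV; last by rewrite gt_eqF //; lra.
  by rewrite mul1r; apply: exprn_gt0; lra.
have psi_ge0 (p : R) : 0 <= p <= 1 -> 0 <= psi (P p) v.
  move=> p01; rewrite psiE //; case/andP: p01 => p0 _.
  by apply: divr_ge0 => //; apply: mulr_ge0 => //; exact: sqr_ge0.
rewrite /pc_hat_minus /pc_hat_plus.
set A := [set p | _ /\ 0 < _]%classic; set B := [set p | _ /\ _ = 0]%classic.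
have A1 : A 1.
  by split; [rewrite ler01 lexx | apply: psi_gt0; apply/andP; split; lra].
have B0 : B 0 by split; [rewrite lexx ler01 | apply: psi0; apply/andP; split; lra].
have Al : lbound A (236 / 10 ^+ 3).
  move=> p [p01 pp]; rewrite leNgt; apply/negP => lt.
  by rewrite psi0 ?ltxx // in pp; case/andP: p01 => -> _ /=; exact: ltW.
have Bu : ubound B p1.
  move=> p [p01 pp]; rewrite leNgt; apply/negP => lt.
  have := psi_gt0 p; rewrite pp ltxx => H; suff : false by [].
  by apply: H; case/andP: p01 => _ ->; rewrite ltW.
have infA : 236 / 10 ^+ 3 <= inf A by apply: lb_le_inf => //; exists 1.
have supB : sup B <= p1 by apply: ge_sup => //; exists 0.
split; [lra | | lra].
(* A point strictly between the supremum of the zeros of psi and the infimum of its positivity set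
   would belong to neither, although psi is nonnegative. *)
rewrite leNgt; apply/negP => lt.
have [m [m1 m2]] : exists m, sup B < m /\ m < inf A.
  by exists ((sup B + inf A) / 2); split; lra.
have sB x : B x -> x <= sup B by move=> Bx; apply: ub_le_sup => //; exists p1.
have iA x : A x -> inf A <= x by move=> Ax; apply: ge_inf => //; exists (236 / 10 ^+ 3).
have m01 : 0 <= m <= 1.
  by have := sB 0 B0; have := iA 1 A1 => ? ?; apply/andP; split; lra.
have := psi_ge0 m m01; rewrite le_eqVlt => /orP[/eqP e|e].
  by have := sB m (conj m01 (esym e)); lra.
by have := iA m (conj m01 e); lra.
Qed.
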